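(* Suppose that $(X,T)$ has the transitively-convex-saturated property and the entropy-dense property. Let $\alpha:M(T,X)\to\mathbb R$ be a continuous function satisfying conditions [A.1] and [A.2]. If $(X,T)$ is not uniquely ergodic and there is an invariant measure with full support, then the ordered collection $\{\emptyset,\ QR\cap BR_1,\ BR_1,\ BR_2,\ BR_3,\ BR_4,\ BR_5\}$ has full entropy gaps with respect to $R_\alpha\cap Tran$.
   Context: $X$ is a compact metric space with metric $d$ and $T:X\to X$ is continuous. $M(T,X)$ is the set of $T$-invariant Borel probability measures with the weak$^*$ topology; $S_\mu$ is the support of $\mu$ (full support: $S_\mu=X$) and $h_\mu=h_\mu(T)$ its metric entropy. $(X,T)$ is uniquely ergodic if $M(T,X)$ is a singleton. For $x\in X$, $\omega_T(x)$ is the $\omega$-limit set and $M_x$ is the set of weak$^*$ limit points of $\frac1n\sum_{j=0}^{n-1}\delta_{T^jx}$. $Tran=\{x:\omega_T(x)=X\}$. Topological entropy of $E\subseteq X$ (Bowen): let $B_n(x,\varepsilon)=\{y: d(T^jx,T^jy)\le\varepsilon,\ 0\le j\le n-1\}$; $\mathfrak F_n(E,\varepsilon)$ is the collection of finite or countable covers of $E$ by sets $B_m(x,\varepsilon)$ with $m\ge n$; $C(E;t,n,\varepsilon,T)=\inf\{\sum_{B_m(x,\varepsilon)\in\mathcal C}2^{-tm}:\mathcal C\in\mathfrak F_n(E,\varepsilon)\}$; $C(E;t,\varepsilon,T)=\lim_{n}C(E;t,n,\varepsilon,T)$; $h_{top}(E,\varepsilon,T)=\inf\{t\ge0:C(E;t,\varepsilon,T)=0\}$;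 $h_{top}(T,E)=\lim_{\varepsilon\to0}h_{top}(E,\varepsilon,T)$ (so $h_{top}(T,\emptyset)=0$). Metric entropy uses the same logarithm base $2$. $T$ is transitively-convex-saturated if for every nonempty compact connected $K\subseteq M(T,X)$ contained in the convex hull of finitely many invariant measures, $G^T_K:=\{x\in Tran:M_x=K\}\neq\emptyset$ and $h_{top}(T,G^T_K)=\inf\{h_\mu(T):\mu\in K\}$. $T$ has the entropy-dense property if for every $\mu\in M(T,X)$, every neighbourhood $G$ of $\mu$ in the space of probability measures on $X$ and every $\eta>0$ there is a closed $T$-invariant set $\Lambda\subseteq X$ such that every $T$-invariant probability measure supported on $\Lambda$ lies in $G$ and $h_{top}(T,\Lambda)>h_\mu-\eta$. Full entropy gaps: an ordered collection $Z_1,\dots,Z_k\subseteq X$ ($k\ge2$) has full entropy gaps with respect to $Y\subseteq X$ if $h_{top}(T,(Z_{i+1}\setminus Z_i)\cap Y)=h_{top}(T,Y)$ for all $1\le i<k$. Recurrence: for $S\subseteq\mathbb N$ the upper density is $\bar d(S)=\limsup_n\frac1n|S\cap\{0,\dots,n-1\}|$ and the Banach upper density is $B^*(S)=\limsup_{|I|\to\infty}|S\cap I|/|I|$ over finite integer intervals $I\subseteq\mathbb N$. For a ball $V_\varepsilon(x)$ let $N(x,V_\varepsilon(x))=\{n\ge1:T^nx\in V_\varepsilon(x)\}$. $BR$ is the set of $x$ such that $N(x,V_\varepsilon(x))$ has positive Banach upper density for every $\varepsilon>0$; $QW$ is the set of $x$ such that it has positive upper density for every $\varepsilon>0$. Let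 $C_x=\overline{\bigcup_{m\in M_x}S_m}$, and $BR^\#=BR\setminus QW$, $W^\#=\{x\in BR^\#:S_\mu=C_x\ \forall\mu\in M_x\}$, $V^\#=\{x\in BR^\#:\exists\mu\in M_x,\ S_\mu=C_x\}$, $S^\#=\{x\in X:\bigcap_{\mu\in M_x}S_\mu\ne\emptyset\}$; $BR_1=W^\#$, $BR_2=V^\#\cap S^\#$, $BR_3=V^\#$, $BR_4=V^\#\cup(BR^\#\cap S^\#)$, $BR_5=BR^\#$. $QR=\{x\in X: M_x\text{ is a singleton}\}$. For continuous $\alpha:M(T,X)\to\mathbb R$: $R_\alpha=\{x:\inf_{\mu\in M_x}\alpha(\mu)=\sup_{\mu\in M_x}\alpha(\mu)\}$. Condition [A.1]: for any $\mu,\nu\in M(T,X)$ with $\alpha(\mu)\ne\alpha(\nu)$, $\theta\mapsto\alpha(\theta\mu+(1-\theta)\nu)$ is strictly monotonic on $[0,1]$. Condition [A.2]: for any $\mu,\nu\in M(T,X)$ with $\alpha(\mu)=\alpha(\nu)$, $\theta\mapsto\alpha(\theta\mu+(1-\theta)\nu)$ is constant on $[0,1]$. *)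

(* Defs.v *)
From HB Require Import structures.
From mathcomp Require Import all_boot all_order all_algebra.
From mathcomp Require Import all_classical all_reals all_analysis.

Set Implicit Arguments.
Unset Strict Implicit.
Unset Printing Implicit Defensive.

Import Order.TTheory GRing.Theory Num.Theory.
Import numFieldNormedType.Exports.

Local Open Scope classical_set_scope.
Local Open Scope ring_scope.

(* The library's measurable types are pointed, hence the base point; it only
   excludes the empty space, on which there is no probability measure. *)
#[short(type="pointedMetricType")]
HB.structure Definition PointedMetric (R : numDomainType) :=
  {M of Metric R M & Pointed M}.

Section probability_constructions.
Context d (T : measurableType d) (R : realType).
Local Open Scope ereal_scope.

Lemma probability_eq (P Q : probability T R) : (forall A, P A = Q A) -> P = Q.
Proof.
move/funext; case: P => p cp; case: Q => q cq /= pq.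
case: _ / pq cq => cq; congr Probability.Pack.
move: cp cq => [[a1 a1'] [a2] [a3] [a4] [a5] [a6] [a7]].
move=> [[b1 b1'] [b2] [b3] [b4] [b5] [b6] [b7]].
have -> : a1 = b1 by exact: Prop_irrelevance.
move: a2; have -> : a1' = b1' by exact: Prop_irrelevance.
move=> a2; rewrite (Prop_irrelevance a2 b2) (Prop_irrelevance a3 b3).
rewrite (Prop_irrelevance a4 b4) (Prop_irrelevance a5 b5).
by rewrite (Prop_irrelevance a6 b6) (Prop_irrelevance a7 b7).
Qed.

Section measurable_part.
Variable P : probability T R.

Definition measurable_part (A : set T) : \bar R :=
  if `[< measurable A >] then P A else 0.

Lemma measurable_partE A : measurable A -> measurable_part A = P A.
Proof. by move=> mA; rewrite /measurable_part asboolT. Qed.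

Let measurable_part0 : measurable_part set0 = 0.
Proof. by rewrite measurable_partE. Qed.

Let measurable_part_ge0 A : 0 <= measurable_part A.
Proof. by rewrite /measurable_part; case: ifP. Qed.

Let measurable_part_sigma_additive : semi_sigma_additive measurable_part.
Proof.
move=> F mF tF mUF; rewrite measurable_partE//.
under eq_fun do under eq_bigr do rewrite measurable_partE//.
exact: measure_semi_sigma_additive.
Qed.

HB.instance Definition _ := isMeasure.Build _ _ _ measurable_part
  measurable_part0 measurable_part_ge0 measurable_part_sigma_additive.

Let measurable_partT : measurable_part setT = 1.
Proof. by rewrite measurable_partE// probability_setT. Qed.

HB.instance Definition _ :=
  Measure_isProbability.Build _ _ _ measurable_part measurable_partT.
End measurable_part.

Section mixture.
Variables (t : {i01 R}) (P Q : probability T R).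

Definition mixture :=
  measure_add (mscale t%:num%:nng%R P) (mscale (1 - t%:num)%:nng%R Q).

HB.instance Definition _ := Measure.on mixture.

Let mixtureT : mixture setT = 1.
Proof.
rewrite /mixture measure_addE/= /mscale/= !probability_setT !mule1 -EFinD.
by rewrite addrC subrK.
Qed.

HB.instance Definition _ :=
  Measure_isProbability.Build _ _ _ mixture mixtureT.
End mixture.

Section orbit_average.
Variables (f : T -> T) (x : T) (n : nat).

(* Indexed so that the average runs over the n.+1 points x, ..., f^n x. *)
Definition orbit_average : set T -> \bar R :=
  mscale (n.+1%:R^-1)%:nng%R (msum (fun j => \d_(iter j f x)) n.+1).

HB.instance Definition _ := Measure.on orbit_average.

Let orbit_averageT : orbit_average setT = 1.
Proof.
rewrite /orbit_average /mscale/= /msum/=.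
under eq_bigr do rewrite diracT.
by rewrite sumEFin sumr_const card_ord -EFinM mulVf.
Qed.

HB.instance Definition _ :=
  Measure_isProbability.Build _ _ _ orbit_average orbit_averageT.
End orbit_average.
End probability_constructions.

Definition borel (R : realType) (X : pointedMetricType R) :
  measurableType (@open X).-sigma := g_sigma_algebraType (@open X).

(* A [probability (borel X) R] is a set function on all subsets of [X], whose
   values outside the Borel sets are unconstrained.  Requiring these values to
   be 0 makes Leibniz equality on [borelProb X] the equality of Borel measures
   (see [borelProb_ext]). *)
Record borelProb (R : realType) (X : pointedMetricType R) := BorelProb {
  borel_prob :> probability (borel X) R ;
  borel_prob0 : forall A, ~ measurable A -> borel_prob A = 0%E }.

Section borel_probability.
Context {R : realType} {X : pointedMetricType R}.

Lemma borelProb_ext (mu nu : borelProb X) :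
  (forall A, measurable A -> mu A = nu A) -> mu = nu.
Proof.
move=> munu.
have {munu} : forall A, mu A = nu A.
  move=> A; have [mA|nA] := pselect (measurable A); first exact: munu.
  by rewrite !borel_prob0.
case: mu => P P0; case: nu => Q Q0 /= /probability_eq PQ.
by case: _ / PQ Q0 => Q0; congr BorelProb; exact: Prop_irrelevance.
Qed.

Let measurable_part_out (P : probability (borel X) R) A :
  ~ measurable A -> measurable_part P A = 0%E.
Proof. by move=> nA; rewrite /measurable_part asboolF. Qed.

Definition borel_normalize (P : probability (borel X) R) : borelProb X :=
  BorelProb (@measurable_part_out P).

End borel_probability.

Section weak_star.
Context {R : realType} {X : pointedMetricType R}.

HB.instance Definition _ := gen_eqMixin (borelProb X).
HB.instance Definition _ := gen_choiceMixin (borelProb X).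

(* The weak* topology is the coarsest one for which all the maps
   mu |-> \int f dmu, with f : X -> R continuous, are continuous. *)
Definition integrals (mu : borelProb X) : {ptws continuousType X R -> R} :=
  fun f => Rintegral mu [set: X] f.

HB.instance Definition _ :=
  Topological.copy (borelProb X) (initial_topology integrals).

Definition convex_comb (t : {i01 R}) (mu nu : borelProb X) : borelProb X :=
  borel_normalize (mixture t mu nu).

Definition convex_hull n (mu : 'I_n -> borelProb X) : set (borelProb X) :=
  [set nu | exists w : 'I_n -> R,
    [/\ forall i, 0 <= w i, \sum_i w i = 1 &
        forall A, measurable A -> nu A = (\sum_i (w i)%:E * mu i A)%E]].

Definition msupport (mu : borelProb X) : set X :=
  [set x | forall U, open U -> U x -> (0 < mu U)%E].

End weak_star.

Section dynamics.
Context {R : realType} {X : pointedMetricType R} (T : X -> X).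

Definition invariant_measures : set (borelProb X) :=
  [set mu : borelProb X |
    forall A : set (borel X), measurable A -> mu (T @^-1` A) = mu A].

Definition uniquely_ergodic := exists mu, invariant_measures = [set mu].

Definition orbit_seq (x : X) : X^nat := fun n => iter n T x.

Definition omega_limit (x : X) : set X := cluster (orbit_seq x @ \oo).

Definition transitive_points : set X := [set x | omega_limit x = setT].

Definition empirical (x : X) (n : nat) : borelProb X :=
  borel_normalize (@orbit_average _ (borel X) R T x n).

Definition limit_measures (x : X) : set (borelProb X) :=
  cluster (empirical x @ \oo).

Definition measurable_partition k (xi : 'I_k -> set (borel X)) :=
  [/\ forall i, measurable (xi i), trivIset setT xi &
      \bigcup_i xi i = setT].

(* the cell of the join of the T^-i xi, i < n, with itinerary w *)
Definition join_cell k (xi : 'I_k -> set X) n (w : {ffun 'I_n -> 'I_k}) :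
    set X :=
  [set x | forall i : 'I_n, xi (w i) (orbit_seq x i)].

(* Logarithms are in base 2; [ln 0 = 0] gives the convention 0 log 0 = 0. *)
Definition join_entropy (mu : borelProb X) k (xi : 'I_k -> set X) n : R :=
  - \sum_(w : {ffun 'I_n -> 'I_k})
      fine (mu (join_cell xi w)) * (ln (fine (mu (join_cell xi w))) / ln 2).

Definition partition_entropy (mu : borelProb X) k (xi : 'I_k -> set X) :
    \bar R :=
  limn (fun n => (join_entropy mu xi n / n%:R)%:E).

Definition metric_entropy (mu : borelProb X) : \bar R :=
  ereal_sup [set h | exists k (xi : 'I_k -> set X),
    measurable_partition xi /\ h = partition_entropy mu xi].

Definition bowen_ball (n : nat) (x : X) (e : R) : set X :=
  [set y | forall j, (j < n)%N -> mdist (orbit_seq x j) (orbit_seq y j) <= e].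

(* A cover by Bowen balls is coded by the set of the pairs (center, length). *)
Definition bowen_covers (E : set X) (n : nat) (e : R) : set (set (X * nat)) :=
  [set C | [/\ countable C, forall p, C p -> (n <= p.2)%N &
               E `<=` \bigcup_(p in C) bowen_ball p.2 p.1 e]].

Definition bowen_outer (E : set X) (t : R) (n : nat) (e : R) : \bar R :=
  ereal_inf [set (\esum_(p in C) (2 `^ (- (t * p.2%:R)))%:E)%E
            | C in bowen_covers E n e].

Definition bowen_measure (E : set X) (t e : R) : \bar R :=
  limn (fun n => bowen_outer E t n e).

Definition htop_scale (E : set X) (e : R) : \bar R :=
  ereal_inf [set t%:E | t in [set t | 0 <= t /\ bowen_measure E t e = 0%E]].

Definition htop (E : set X) : \bar R := lim (htop_scale E e @[e --> 0^'+]).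

Definition transitively_convex_saturated :=
  forall K : set (borelProb X),
    K `<=` invariant_measures -> K !=set0 -> compact K -> connected K ->
    (exists n (mu : 'I_n -> borelProb X),
      (forall i, invariant_measures (mu i)) /\ K `<=` convex_hull mu) ->
    let G := transitive_points `&` [set x | limit_measures x = K] in
    G !=set0 /\ htop G = ereal_inf (metric_entropy @` K).

(* The last inequality is in the extended reals, both entropies being possibly
   infinite; a T-invariant set is one that T maps into itself. *)
Definition entropy_dense :=
  forall mu, invariant_measures mu ->
  forall G, nbhs mu G -> forall eta : R, 0 < eta ->
  exists Lambda : set X,
    [/\ closed Lambda, T @` Lambda `<=` Lambda,
        forall nu, invariant_measures nu -> msupport nu `<=` Lambda -> G nu &
        (metric_entropy mu - eta%:E < htop Lambda)%E].

Definition full_entropy_gaps (Zs : seq (set X)) (Y : set X) :=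
  (2 <= size Zs)%N /\
  forall i, (i.+1 < size Zs)%N ->
    htop ((nth set0 Zs i.+1 `\` nth set0 Zs i) `&` Y) = htop Y.

Definition upper_density (S : set nat) : \bar R :=
  limn_esup (fun n => ((\sum_(0 <= i < n) \1_S i) / n%:R)%:E).

(* limsup over the intervals [a, a + n[ as their length n tends to infinity *)
Definition banach_upper_density (S : set nat) : \bar R :=
  ereal_inf [set ereal_sup
    [set ((\sum_(a <= i < a + n) \1_S i) / n%:R)%:E
    | a in [set: nat] & n in [set n | (N <= n)%N]] | N in [set: nat]].

Definition return_times (x : X) (e : R) : set nat :=
  [set n | (1 <= n)%N /\ ball x e (orbit_seq x n)].

Definition BR : set X :=
  [set x | forall e, 0 < e -> (0 < banach_upper_density (return_times x e))%E].

Definition QW : set X :=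
  [set x | forall e, 0 < e -> (0 < upper_density (return_times x e))%E].

Definition measure_center (x : X) : set X :=
  closure (\bigcup_(mu in limit_measures x) msupport mu).

(* BRs, Ws, Vs and Ss stand for BR^#, W^#, V^# and S^#. *)
Definition BRs : set X := BR `\` QW.

Definition Ws : set X :=
  [set x | BRs x /\
    forall mu, limit_measures x mu -> msupport mu = measure_center x].

Definition Vs : set X :=
  [set x | BRs x /\
    exists mu, limit_measures x mu /\ msupport mu = measure_center x].

Definition Ss : set X :=
  [set x | \bigcap_(mu in limit_measures x) msupport mu !=set0].

Definition BR1 := Ws.
Definition BR2 := Vs `&` Ss.
Definition BR3 := Vs.
Definition BR4 := Vs `|` (BRs `&` Ss).
Definition BR5 := BRs.

Definition QR : set X := [set x | exists mu, limit_measures x = [set mu]].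

(* [alpha] is only meant on the invariant measures; all the measures occurring
   below are invariant when [T] is continuous and [X] is compact, so its values
   elsewhere are irrelevant. *)
Section level_sets.
Variable alpha : borelProb X -> R.

Definition Ralpha : set X :=
  [set x | ereal_inf [set (alpha mu)%:E | mu in limit_measures x] =
           ereal_sup [set (alpha mu)%:E | mu in limit_measures x]].

Definition condA1 := forall mu nu, invariant_measures mu -> invariant_measures nu ->
  alpha mu <> alpha nu ->
  (forall s t : {i01 R}, s%:num < t%:num ->
    alpha (convex_comb s mu nu) < alpha (convex_comb t mu nu)) \/
  (forall s t : {i01 R}, s%:num < t%:num ->
    alpha (convex_comb t mu nu) < alpha (convex_comb s mu nu)).

Definition condA2 := forall mu nu, invariant_measures mu -> invariant_measures nu ->
  alpha mu = alpha nu ->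
  forall s t : {i01 R},
    alpha (convex_comb s mu nu) = alpha (convex_comb t mu nu).

End level_sets.
End dynamics.

(* Main.v *)
(* Given c < htop X, it suffices to find a set of entropy at least c inside each gap.
   By the variational principle (Misiurewicz) and entropy density there are finitely many
   invariant measures of entropy > c carried by pairwise disjoint closed invariant sets, and
   convex combinations of five of them yield three, a, b and d, with disjoint supports and
   the same value of alpha.  Fix p, q, r on the broken line from b to a to d; by [A.2] alpha
   is constant on K = [p, q] U [q, r].  The transitive points x with M_x = K have entropy
   at least c, and C_x is the union of the supports of p, q, r, which is not X because a
   transitive point in an invariant closed set makes it equal to X.  As x is then outside
   C_x, it is not in QW, whereas an invariant measure with full support puts every
   transitive point in BR.  The position of p, q, r decides which gap x belongs to; with
   h_1, h_2 interior points of [b, a] and [a, d]: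
     QR /\ BR_1:        p = q = r = a;
     BR_1 \ QR:         p <> q = r interior to [b, a];
     BR_2 \ BR_1:       p = a, q = r = h_1;
     BR_3 \ BR_2:       p = a, q = r = b;
     BR_4 \ BR_3:       p = h_1, q = a, r = h_2;
     BR_5 \ BR_4:       p = a, q = b, r = d. *)

(* Saturation takes a compact connected [K] inside a finite convex hull and returns the infimum of
   the entropies over [K]. A broken line qualifies, and a lower bound on the entropy of its vertices
   spreads to its edges because entropy is concave. Entropy density, however, delivers closed
   invariant sets of large topological entropy and not measures. The variational principle turns
   such a set into a measure carried by it; this needs weak* compactness of the space of measures,
   which rests on the Riesz-Markov-Kakutani theorem. Along a hook each support is a union of
   supports of vertices, so the classes become conditions on subsets of {a, b, d}: V^# asks for one
   measure that sees all the letters met along [K], S^# for a letter common to all the measures. On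
   a single segment an interior measure sees everything, so leaving V^# takes two edges and a third
   letter. Equalizing [alpha] without overlapping supports costs five measures: one fixes the level,
   and two disjoint pairs around it are moved to that level. *)
From HB Require Import structures.
Require Import Defs.
From mathcomp Require Import all_boot all_order all_algebra.
From mathcomp Require Import finmap.
From mathcomp Require Import all_classical all_reals all_analysis.
From mathcomp Require Import measurable_realfun.
From mathcomp Require Import ring lra zify.

Import Order.TTheory GRing.Theory Num.Theory.
Import numFieldNormedType.Exports.

Local Open Scope classical_set_scope.
Local Open Scope ring_scope.

Set Implicit Arguments.
Unset Strict Implicit.
Unset Printing Implicit Defensive.

(** * The Riesz-Markov-Kakutani theorem *)

Section bounded_measurable.
Context {R : realType} {X : pointedMetricType R}.
Implicit Types (mu nu : borelProb X) (f g : X -> R) (A : set X).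

Lemma borel_open A : open A -> measurable (A : set (borel X)).
Proof. by move=> oA; exact: sub_gen_smallest. Qed.

Lemma borel_closed A : closed A -> measurable (A : set (borel X)).
Proof.
move=> cA; rewrite -[A]setCK; apply: measurableC.
by apply: borel_open; exact: closed_openC.
Qed.

Lemma borel_continuous (Y : X -> X) (A : set X) : continuous Y ->
  measurable (A : set (borel X)) -> measurable (Y @^-1` A : set (borel X)).
Proof.
move=> cY mA.
have mY : @measurable_fun _ _ (borel X) (borel X) setT Y.
  apply: (@measurability _ _ (borel X) (borel X) setT Y (@open X)) => //.
  move=> _ [U oU <-]; rewrite setTI; apply: borel_open.
  by move/continuousP : cY => /(_ _ oU).
by rewrite -[_ @^-1` _]setTI; exact: mY.
Qed.

Lemma borelProb_setT mu : mu [set: X] = 1%E.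
Proof. exact: (@probability_setT _ (borel X) R mu). Qed.

(** A linear class that contains the indicators of Borel sets and, on compact [X], the continuous
    functions, so that integrals of the two can be compared without further integrability
    conditions. *)
Definition bounded_measurable f :=
  @measurable_fun _ _ (borel X) R setT f /\ exists M : R, forall x, `|f x| <= M.

Definition integ mu f : R := Rintegral mu [set: X] f.

Lemma bm_integrable mu f : bounded_measurable f ->
  mu.-integrable [set: borel X] (EFin \o f).
Proof.
move=> [mf [M fM]]; apply: (@measurable_bounded_integrable _ (borel X)) => //.
  by rewrite [X in (X < _)%E]borelProb_setT ltry.
exists M; split; first exact: num_real.
by move=> x Mx y _; exact: le_trans (fM y) (ltW Mx).
Qed.

Lemma bm_cst (r : R) : bounded_measurable (fun=> r).
Proof. by split=> //; exists `|r|. Qed.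

Lemma bmD f g : bounded_measurable f -> bounded_measurable g ->
  bounded_measurable (fun x => f x + g x).
Proof.
move=> [mf [M fM]] [mg [N gN]]; split; first exact: measurable_funD.
by exists (M + N) => x; rewrite (le_trans (ler_normD _ _))// lerD.
Qed.

Lemma bmZ (r : R) f : bounded_measurable f -> bounded_measurable (fun x => r * f x).
Proof.
move=> [mf [M fM]]; split; first exact: measurable_funM.
by exists (`|r| * M) => x; rewrite normrM ler_wpM2l.
Qed.

Lemma bmB f g : bounded_measurable f -> bounded_measurable g ->
  bounded_measurable (fun x => f x - g x).
Proof.
move=> bf bg; have := bmD bf (bmZ (-1) bg).
by under [X in bounded_measurable X -> _]eq_fun do rewrite mulN1r.
Qed.

Lemma bm_indic A : measurable (A : set (borel X)) -> bounded_measurable (\1_A).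
Proof.
move=> mA; split; first exact: (@measurable_indic _ (borel X)).
by exists 1 => x; rewrite indicE; case: (_ \in _); rewrite ?normr1 ?normr0.
Qed.

Lemma bm_sum (I : Type) (s : seq I) (F : I -> X -> R) :
  (forall i, bounded_measurable (F i)) ->
  bounded_measurable (fun x => \sum_(i <- s) F i x).
Proof.
move=> bF; elim: s => [|i s IH].
  by under eq_fun do rewrite big_nil; exact: bm_cst.
by under eq_fun do rewrite big_cons; exact: bmD.
Qed.

Lemma bm_continuous f : compact [set: X] -> continuous f -> bounded_measurable f.
Proof.
move=> cX cf; split.
  apply: (measurability _ (RGenOpens.measurableE R)).
  move=> _ [_ [a [b ->] <-]]; rewrite setTI; apply: borel_open.
  by move/continuousP : cf; apply; exact: interval_open.
have /compact_bounded [M [_ /(_ (M + 1))]] : compact (f @` [set: X]).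
  by apply: continuous_compact => //; exact: continuous_subspaceT.
rewrite ltrDl ltr01 => /(_ isT) fM.
by exists (M + 1) => x; apply: fM; exists x.
Qed.

Lemma integ_cst mu r : integ mu (fun=> r) = r.
Proof.
rewrite /integ (@Rintegral_cst _ (borel X))//.
rewrite -[RHS]mulr1; congr (_ * _).
exact: (congr1 fine (borelProb_setT mu)).
Qed.

Lemma integD mu f g : bounded_measurable f -> bounded_measurable g ->
  integ mu (fun x => f x + g x) = integ mu f + integ mu g.
Proof. by move=> bf bg; apply: (@RintegralD _ (borel X)) => //; exact: bm_integrable. Qed.

Lemma integB mu f g : bounded_measurable f -> bounded_measurable g ->
  integ mu (fun x => f x - g x) = integ mu f - integ mu g.
Proof. by move=> bf bg; apply: (@RintegralB _ (borel X)) => //; exact: bm_integrable. Qed.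

Lemma integZ mu r f : bounded_measurable f -> integ mu (fun x => r * f x) = r * integ mu f.
Proof. by move=> bf; apply: (@RintegralZl _ (borel X)) => //; exact: bm_integrable. Qed.

Lemma integ_sum mu (I : Type) (s : seq I) (F : I -> X -> R) :
  (forall i, bounded_measurable (F i)) ->
  integ mu (fun x => \sum_(i <- s) F i x) = \sum_(i <- s) integ mu (F i).
Proof.
move=> bF; elim: s => [|i s IH].
  by under eq_fun do rewrite big_nil; rewrite big_nil; exact: integ_cst.
under eq_fun do rewrite big_cons; rewrite big_cons -IH; apply: integD => //.
exact: bm_sum.
Qed.

Lemma le_integ mu f g : bounded_measurable f -> bounded_measurable g ->
  (forall x, f x <= g x) -> integ mu f <= integ mu g.
Proof. by move=> bf bg fg; apply: (@le_Rintegral _ (borel X)) => //; exact: bm_integrable. Qed.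

Lemma integ_ge0 mu f : (forall x, 0 <= f x) -> 0 <= integ mu f.
Proof. by move=> f0; apply: (@Rintegral_ge0 _ (borel X)). Qed.

Lemma eq_integ mu f g : f =1 g -> integ mu f = integ mu g.
Proof. by move=> /funext ->. Qed.

Lemma integ_le_cst mu f r : bounded_measurable f -> (forall x, f x <= r) -> integ mu f <= r.
Proof.
move=> bf fr; rewrite -[leRHS](integ_cst mu).
by apply: le_integ => //; exact: bm_cst.
Qed.

Lemma ge_integ_cst mu f r : bounded_measurable f -> (forall x, r <= f x) -> r <= integ mu f.
Proof.
move=> bf fr; rewrite -[leLHS](integ_cst mu).
by apply: le_integ => //; exact: bm_cst.
Qed.

Definition pr mu A : R := fine (mu A).

(** For a set that is not Borel both sides are 0, by [borel_prob0]. *)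
Lemma prE mu A : mu A = (pr mu A)%:E.
Proof.
rewrite /pr fineK// ge0_fin_numE//.
have [mA|nA] := pselect (measurable (A : set (borel X))).
  by rewrite (le_lt_trans (@probability_le1 _ (borel X) _ _ _ _))// ltry.
by rewrite borel_prob0.
Qed.

Lemma pr_ge0 mu A : 0 <= pr mu A.
Proof. exact: fine_ge0. Qed.

Lemma integ_indic mu A : measurable (A : set (borel X)) -> integ mu \1_A = pr mu A.
Proof.
move=> mA; rewrite /integ /Rintegral (@integral_indic _ (borel X))// setIT//.
Qed.

Lemma pr_setT mu : pr mu setT = 1.
Proof. by rewrite /pr borelProb_setT. Qed.

Lemma le_pr mu A B : measurable (A : set (borel X)) -> measurable (B : set (borel X)) ->
  A `<=` B -> pr mu A <= pr mu B.
Proof. by move=> mA mB AB; rewrite -lee_fin -!prE le_measure// inE. Qed.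

Lemma pr_le1 mu A : pr mu A <= 1.
Proof.
have [mA|nA] := pselect (measurable (A : set (borel X))).
  by rewrite -(pr_setT mu) le_pr.
by rewrite /pr borel_prob0.
Qed.

Lemma prU mu A B : measurable (A : set (borel X)) -> measurable (B : set (borel X)) ->
  A `&` B = set0 -> pr mu (A `|` B) = pr mu A + pr mu B.
Proof.
move=> mA mB AB; apply: EFin_inj; rewrite EFinD -!prE.
by rewrite [LHS](@measureU _ _ (borel X)).
Qed.

Lemma prC mu A : measurable (A : set (borel X)) -> pr mu (~` A) = 1 - pr mu A.
Proof.
move=> mA; rewrite -(pr_setT mu) -(setvU A) prU//; last exact: setICl.
  by rewrite addrK.
exact: (@measurableC _ (borel X)).
Qed.

End bounded_measurable.

(** * Continuous functions built from the distance to a set *)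

Section distance_to_set.
Context {R : realType} {X : pointedMetricType R}.
Implicit Types (C : set X) (x y : X).

Lemma ball_mdist x (e : R) y : ball x e y = (mdist x y < e).
Proof. by rewrite ballEmdist. Qed.

Lemma lipschitz_continuous (f : X -> R) :
  (forall x y, f x <= f y + mdist x y) -> continuous f.
Proof.
move=> fl x; apply/cvgrPdist_lt => e e0; near=> y.
have xy : mdist x y < e by rewrite -ball_mdist; near: y; exact: nbhsx_ballx.
have := fl x y; have := fl y x; rewrite (metric_sym y x) => h1 h2.
by rewrite ltr_norml; apply/andP; split; lra.
Unshelve. all: end_near. Qed.

(* The cap at 1 makes the distance to the empty set meaningful. *)
Definition cdist C x : R := inf [set r | r = 1 \/ exists2 y, C y & r = mdist x y].

Let cdist_set C x : has_inf [set r | r = 1 \/ exists2 y, C y & r = mdist x y].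
Proof.
split; first by exists 1; left.
by exists 0 => r [->|[y _ ->]] //; exact: mdist_ge0.
Qed.

Lemma cdist_ge0 C x : 0 <= cdist C x.
Proof.
apply: lb_le_inf; first by exists 1; left.
by move=> r [->|[y _ ->]] //; exact: mdist_ge0.
Qed.

Lemma cdist_le1 C x : cdist C x <= 1.
Proof. by apply: ge_inf; [case: (cdist_set C x)|left]. Qed.

Lemma cdist_le C x y : C y -> cdist C x <= mdist x y.
Proof. by move=> Cy; apply: ge_inf; [case: (cdist_set C x)|right; exists y]. Qed.

Lemma cdist0 C x : C x -> cdist C x = 0.
Proof.
by move=> Cx; apply/eqP; rewrite eq_le cdist_ge0 andbT -(mdistxx x) cdist_le.
Qed.

Lemma cdist_lipschitz C x y : cdist C x <= cdist C y + mdist x y.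
Proof.
rewrite -lerBlDr; apply: lb_le_inf; first by exists 1; left.
move=> r [->|[z Cz ->]].
  by rewrite lerBlDr (le_trans (cdist_le1 C x))// lerDl mdist_ge0.
rewrite lerBlDr (le_trans (cdist_le x Cz))// (le_trans (metric_triangle x y z))//.
by rewrite addrC.
Qed.

Lemma continuous_cdist C : continuous (cdist C).
Proof. exact/lipschitz_continuous/cdist_lipschitz. Qed.

Lemma cdist_gt0 C x : closed C -> ~ C x -> 0 < cdist C x.
Proof.
move=> cC nCx; have : nbhs x (~` C) by apply: open_nbhs_nbhs; split => //; exact: closed_openC.
move=> /nbhs_ballP [e /= e0 be]; rewrite (@lt_le_trans _ _ (Num.min 1 e))//.
  by rewrite lt_min ltr01.
apply: lb_le_inf; first by exists 1; left.
move=> r [->|[y Cy ->]]; first by rewrite ge_min lexx.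
rewrite ge_min; apply/orP; right; rewrite leNgt; apply/negP => xy.
by apply: (be y) => //; rewrite ball_mdist.
Qed.

End distance_to_set.

Section real_continuity.
Context {R : realType} {X : topologicalType}.
Implicit Types f g : X -> R.

Lemma contD f g : continuous f -> continuous g -> continuous (fun x => f x + g x).
Proof. by move=> cf cg x; apply: cvgD; [exact: cf|exact: cg]. Qed.

Lemma contB f g : continuous f -> continuous g -> continuous (fun x => f x - g x).
Proof. by move=> cf cg x; apply: cvgB; [exact: cf|exact: cg]. Qed.

Lemma contM f g : continuous f -> continuous g -> continuous (fun x => f x * g x).
Proof. by move=> cf cg x; apply: cvgM; [exact: cf|exact: cg]. Qed.

Lemma cont_cst (r : R) : continuous (fun _ : X => r).
Proof. by move=> x; exact: cvg_cst. Qed.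

Lemma contZ (r : R) f : continuous f -> continuous (fun x => r * f x).
Proof. by move=> cf; apply: contM => //; exact: cont_cst. Qed.

Lemma cont_max f g : continuous f -> continuous g ->
  continuous (fun x => Num.max (f x) (g x)).
Proof. by move=> cf cg x; apply: (@continuous_max _ _ f g); [exact: cf|exact: cg]. Qed.

Lemma cont_min f g : continuous f -> continuous g ->
  continuous (fun x => Num.min (f x) (g x)).
Proof. by move=> cf cg x; apply: (@continuous_min _ _ f g); [exact: cf|exact: cg]. Qed.

Lemma cont_sum (I : Type) (s : seq I) (F : I -> X -> R) :
  (forall i, continuous (F i)) -> continuous (fun x => \sum_(i <- s) F i x).
Proof.
move=> cF; elim: s => [|i s IH].
  by under eq_fun do rewrite big_nil; exact: cont_cst.
by under eq_fun do rewrite big_cons; exact: contD.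
Qed.

End real_continuity.

Section riesz_markov_kakutani.
Context {R : realType} {X : pointedMetricType R} (cX : compact [set: X]).
Variable L : (X -> R) -> R.
Hypothesis LD : forall f g : X -> R, continuous f -> continuous g ->
  L (fun x => f x + g x) = L f + L g.
Hypothesis LZ : forall (r : R) (f : X -> R), continuous f -> L (fun x => r * f x) = r * L f.
Hypothesis L_ge0 : forall f : X -> R, continuous f -> (forall x, 0 <= f x) -> 0 <= L f.
Hypothesis L1 : L (fun=> 1) = 1.
Implicit Types (f g : X -> R) (A B : set X).

Lemma rmkB f g : continuous f -> continuous g ->
  L (fun x => f x - g x) = L f - L g.
Proof.
move=> cf cg; have := LD cf (@contZ _ _ (-1) _ cg); rewrite LZ// mulN1r => <-.
by congr L; apply/funext => x; rewrite mulN1r.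
Qed.

Lemma rmk_le f g : continuous f -> continuous g -> (forall x, f x <= g x) ->
  L f <= L g.
Proof.
move=> cf cg fg; rewrite -subr_ge0 -rmkB// L_ge0//; first exact: contB.
by move=> x; rewrite subr_ge0.
Qed.

Lemma rmk_cst r : L (fun=> r) = r.
Proof.
by have := LZ r (@cont_cst R X 1); rewrite L1 !mulr1.
Qed.

Lemma rmk_sum (F : nat -> X -> R) n : (forall i, continuous (F i)) ->
  L (fun x => \sum_(0 <= i < n) F i x) = \sum_(0 <= i < n) L (F i).
Proof.
move=> cF; elim: n => [|n IH].
  rewrite big_geq// -[RHS]rmk_cst; congr L; apply/funext => x.
  by rewrite big_geq.
rewrite big_nat_recr//= -IH -LD//; last exact: cont_sum.
by congr L; apply/funext => x; rewrite big_nat_recr.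
Qed.

(** Vanishing off [A] is all that is asked; the compact support inside [A] of the classical
    construction is recovered by [cut]. *)
Definition admissible (A : set X) : set (X -> R) :=
  [set f : X -> R | [/\ continuous f, forall x, 0 <= f x <= 1 & forall x, ~ A x -> f x = 0]].

Definition inner_content (A : set X) : \bar R := ereal_sup [set (L f)%:E | f in admissible A].

Definition rmk_outer (A : set X) : \bar R :=
  ereal_inf [set inner_content U | U in [set U | open U /\ A `<=` U]].

Lemma admissible0 A : admissible A (fun=> 0).
Proof. by split=> [|x|//]; [exact: cont_cst|rewrite lexx ler01]. Qed.

Lemma le_inner_content A f : admissible A f -> ((L f)%:E <= inner_content A)%E.
Proof. by move=> Af; apply: ereal_sup_ubound; exists f. Qed.

Lemma inner_content_ge0 A : (0 <= inner_content A)%E.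
Proof. by have := le_inner_content (admissible0 A); rewrite rmk_cst. Qed.

Lemma inner_content_le1 A : (inner_content A <= 1)%E.
Proof.
apply: ge_ereal_sup => _ [f [cf f01 _] <-]; rewrite lee_fin -(rmk_cst 1).
by apply: rmk_le => //; [exact: cont_cst|move=> x; case/andP: (f01 x)].
Qed.

Lemma inner_content_mono A B : A `<=` B -> (inner_content A <= inner_content B)%E.
Proof.
move=> AB; apply: ereal_sup_le => _ [f [cf f01 f0] <-]; exists f => //.
by split => // x nB; apply: f0 => Ax; exact/nB/AB.
Qed.

Lemma rmk_outer_mono A B : A `<=` B -> (rmk_outer A <= rmk_outer B)%E.
Proof.
move=> AB; apply: ereal_inf_le_tmp => _ [U [oU BU] <-]; exists U => //.
by split => //; exact: subset_trans BU.
Qed.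

Lemma rmk_outer_ge0 A : (0 <= rmk_outer A)%E.
Proof. by apply: le_ereal_inf_tmp => _ [U _ <-]; exact: inner_content_ge0. Qed.

Lemma rmk_outer_open A : open A -> rmk_outer A = inner_content A.
Proof.
move=> oA; apply/eqP; rewrite eq_le; apply/andP; split.
  by apply: ereal_inf_lbound; exists A => //; split => //; exact: subset_refl.
by apply: le_ereal_inf_tmp => _ [U [_ AU] <-]; exact: inner_content_mono.
Qed.

Lemma rmk_outer0 : rmk_outer set0 = 0%E.
Proof.
apply/eqP; rewrite eq_le rmk_outer_ge0 andbT rmk_outer_open; last exact: open0.
apply: ge_ereal_sup => _ [f [_ _ f0] <-].
by rewrite (_ : f = fun=> 0) ?rmk_cst//; apply/funext => x; exact: f0.
Qed.

Lemma rmk_outerT : rmk_outer setT = 1%E.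
Proof.
rewrite rmk_outer_open; last exact: openT.
apply/eqP; rewrite eq_le inner_content_le1/= -(rmk_cst 1).
apply: le_inner_content; split; first exact: cont_cst.
  by move=> x; rewrite ler01 lexx.
by move=> x [].
Qed.

(** The cut function lives on the closed set where [e <= f x], which for [0 < e] is a compact subset
    of any open set off which [f] vanishes; by [rmk_cut] passing to it costs at most [e]. *)
Definition cut (e : R) (f : X -> R) (x : X) : R := Num.max 0 (f x - e).

Lemma continuous_cut e f : continuous f -> continuous (cut e f).
Proof.
move=> cf; apply: cont_max; first exact: cont_cst.
by apply: contB => //; exact: cont_cst.
Qed.

Lemma rmk_cut e f : continuous f -> L f <= L (cut e f) + e.
Proof.
move=> cf; rewrite -[X in _ <= _ + X](rmk_cst e) -LD; last 2 first.
- exact: continuous_cut.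
- exact: cont_cst.
apply: rmk_le => //.
  by apply: contD; [exact: continuous_cut|exact: cont_cst].
by move=> x; rewrite /cut -lerBlDr le_max lexx orbT.
Qed.

Lemma superlevel_closed (e : R) (f : X -> R) : continuous f -> closed [set x | e <= f x].
Proof.
move=> cf; rewrite (_ : [set x | _] = f @^-1` [set y | e <= y]); last by [].
by apply: closed_comp; [move=> x _; exact: cf|exact: closed_ge].
Qed.

Lemma strict_superlevel_open (e : R) (f : X -> R) : continuous f -> open [set x | e < f x].
Proof.
move=> cf; rewrite (_ : [set x | _] = f @^-1` [set y | e < y]); last by [].
by apply: open_comp; [move=> x _; exact: cf|exact: open_gt].
Qed.

(** For [f] admissible for the union, finitely many of the [U n] cover the compact set [K] where
    [e <= f x]. A sum of functions [phi n m], each admissible for its [U n], is at least 1 on [K]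
    and hence dominates [cut e f]; and [e] is arbitrary. *)
Lemma inner_content_sigma (U : nat -> set X) : (forall n, open (U n)) ->
  (inner_content (\bigcup_n U n) <= \sum_(0 <= n <oo) inner_content (U n))%E.
Proof.
move=> oU; apply: ge_ereal_sup => _ [f [cf f01 f0] <-].
apply/lee_addgt0Pr => e e0.
pose phi n (m : nat) x := Num.min 1 (m%:R * cdist (~` U n) x).
have phi_adm n m : admissible (U n) (phi n m).
  split.
  - apply: cont_min; first exact: cont_cst.
    by apply: contZ; exact: continuous_cdist.
  - move=> x; rewrite ge_min lexx/= andbT le_min ler01/= mulr_ge0//.
    exact: cdist_ge0.
  - by move=> x Ux; rewrite /phi cdist0// mulr0; apply/min_idPr.
pose K := [set x | e <= f x].
have cK : compact K.
  by apply: (subclosed_compact _ cX) => //; exact: superlevel_closed.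
(* A single [m] comes out of compactness and serves twice: as the bound on the indices [n] and as
   the slope that makes [phi n m] equal to 1. *)
have /compact_near_coveringP/(_ nat \oo
    (fun m x => exists2 n, (n < m)%N & 1 < m%:R * cdist (~` U n) x)) : compact K by [].
case.
  move=> x Kx.
  have [n _ Unx] : (\bigcup_n U n) x.
    apply: contrapT => /f0 fx; move: Kx; rewrite /K/= fx.
    by rewrite leNgt e0.
  have d0 : 0 < cdist (~` U n) x.
    apply: cdist_gt0; first exact: open_closedC.
    exact.
  pose d := cdist (~` U n) x / 2.
  have d'0 : 0 < d by rewrite divr_gt0.
  have nx : \forall x' \near x, d < cdist (~` U n) x'.
    apply: open_nbhs_nbhs; split.
      exact: (strict_superlevel_open d (@continuous_cdist _ _ (~` U n))).
    by rewrite /d /=; lra.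
  exists ([set x' | d < cdist (~` U n) x'], [set m | (n < m)%N /\ d^-1 < m%:R]).
    split => //=; apply: filterI; first exact: nbhs_infty_gt.
    exact: nbhs_infty_gtr.
  move=> [x' m] /= [dx' [nm dm]]; exists n => //.
  rewrite (@le_lt_trans _ _ (m%:R * d))//; last first.
    by rewrite ltr_pM2l// (lt_trans _ dm)// invr_gt0.
  by rewrite -ler_pdivrMr// mul1r ltW.
move=> m _ /(_ m (leqnn m)) Km.
apply: (@le_trans _ _ ((\sum_(0 <= n < m) L (phi n m)) + e)%:E).
  rewrite lee_fin (le_trans (rmk_cut e cf))// lerD2r -rmk_sum; last first.
    by move=> n; case: (phi_adm n m).
  apply: rmk_le; first exact: continuous_cut.
    by apply: cont_sum => n; case: (phi_adm n m).
  move=> x; rewrite /cut ge_max; apply/andP; split.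
    by apply: sumr_ge0 => n _; case: (phi_adm n m) => _ /(_ x)/andP[].
  have [xe|/ltW ex] := leP e (f x); last first.
    rewrite (@le_trans _ _ 0) ?subr_le0//.
    by apply: sumr_ge0 => n _; case: (phi_adm n m) => _ /(_ x)/andP[].
  have [n nm n1] := Km _ xe.
  rewrite (@le_trans _ _ (phi n m x))//.
    rewrite /phi (min_idPl _) ?(ltW n1)//; have /andP[_ fx] := f01 x.
    by rewrite lerBlDr (le_trans fx)// lerDl ltW.
  rewrite (big_rem n) ?mem_index_iota//= lerDl sumr_ge0// => i _.
  by case: (phi_adm i m) => _ /(_ x)/andP[].
rewrite EFinD leeD2r// -sumEFin.
apply: (@le_trans _ _ (\sum_(0 <= n < m) inner_content (U n))%E).
  by apply: lee_sum => n _; exact: le_inner_content.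
by apply: nneseries_lim_ge => n _ _; exact: inner_content_ge0.
Qed.

Lemma rmk_outer_sigma_subadditive : sigma_subadditive rmk_outer.
Proof.
move=> A; apply/lee_addgt0Pr => e e0.
have /choice[U UP] : forall n, exists U, [/\ open U, A n `<=` U &
    (inner_content U <= rmk_outer (A n) + (e / (2 ^ n.+1)%:R)%:E)%E].
  move=> n.
  have e2 : 0 < e / (2 ^ n.+1)%:R by rewrite divr_gt0// ltr0n expn_gt0.
  have fin : rmk_outer (A n) \is a fin_num.
    rewrite ge0_fin_numE ?rmk_outer_ge0// (@le_lt_trans _ _ 1%E) ?ltry//.
    by rewrite -rmk_outerT rmk_outer_mono.
  have [_ [U [oU AU] <-] lU] := lb_ereal_inf_adherent e2 fin.
  by exists U; split => //; exact: ltW.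
apply: (@le_trans _ _ (inner_content (\bigcup_n U n))).
  apply: ereal_inf_lbound; exists (\bigcup_n U n) => //; split.
    by apply: bigcup_open => n _; case: (UP n).
  by apply: subset_bigcup => n _; case: (UP n).
apply: le_trans (inner_content_sigma _) _; first by move=> n; case: (UP n).
apply: le_trans (epsilon_trick xpredT _ (ltW e0)); last first.
  by move=> n; exact: rmk_outer_ge0.
apply: lee_nneseries => n _ *; first exact: inner_content_ge0.
by case: (UP n).
Qed.

HB.instance Definition _ := isOuterMeasure.Build R X rmk_outer
  rmk_outer0 rmk_outer_ge0 rmk_outer_mono rmk_outer_sigma_subadditive.

(** If [f] is admissible for the intersection of [U] and [V], and [g] for the part [W] of [U] where
    [f x < e], then [cut e f] and [g] are nowhere nonzero together, so their sum is admissible for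
    [U]. As [f] vanishes off [V], [W] contains the part of [U] outside [V]. *)
Lemma rmk_caratheodory_open V : open V -> rmk_outer.-caratheodory V.
Proof.
move=> oV; apply: (@le_caratheodory_measurable R X rmk_outer) => A.
apply: le_ereal_inf_tmp => _ [U [oU AU] <-].
apply: (@le_trans _ _ (rmk_outer (U `&` V) + rmk_outer (U `&` ~` V))%E).
  by apply: leeD; apply: rmk_outer_mono; apply: setSI.
have fin B : rmk_outer B \is a fin_num.
  rewrite ge0_fin_numE ?rmk_outer_ge0// (@le_lt_trans _ _ 1%E) ?ltry//.
  by rewrite -rmk_outerT rmk_outer_mono.
rewrite rmk_outer_open; last exact: openI.
rewrite -leeBrDr//; apply: ge_ereal_sup => _ [f [cf f01 f0] <-].
rewrite leeBrDr//; apply/lee_addgt0Pr => e e0.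
pose W := U `&` ~` [set x | e <= f x].
have oW : open W by apply: openI => //; apply: closed_openC; exact: superlevel_closed.
apply: (@le_trans _ _ ((L (cut e f) + e)%:E + inner_content W)%E).
  apply: leeD; first by rewrite lee_fin rmk_cut.
  rewrite -rmk_outer_open//; apply: rmk_outer_mono => x [Ux nVx]; split => //=.
  by rewrite f0 ?leNgt ?e0// => -[].
rewrite EFinD addeAC leeD2r// -leeBrDl//; apply: ge_ereal_sup => _ [g [cg g01 g0] <-].
rewrite leeBrDl// -EFinD -LD//; last exact: continuous_cut.
apply: le_inner_content; split.
- by apply: contD => //; exact: continuous_cut.
- move=> x; have /andP[g0x g1x] := g01 x; have /andP[f0x f1x] := f01 x.
  rewrite addr_ge0//=; last by rewrite /cut le_max lexx.
  rewrite /cut; have [xe|ex] := leP e (f x).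
    by rewrite g0 ?addr0 ?ge_max ?ler01/=; [lra|case].
  by rewrite (max_idPl _) ?add0r//; lra.
- move=> x nUx; rewrite g0; last by case.
  rewrite /cut f0; last by case.
  by rewrite addr0; apply/max_idPl; lra.
Qed.

Lemma rmk_borel (A : set (borel X)) : measurable A -> rmk_outer.-caratheodory A.
Proof.
suff : <<s @open X >> `<=` rmk_outer.-caratheodory by exact.
apply: smallest_sub; last by move=> U; exact: rmk_caratheodory_open.
split => //.
- exact: caratheodory_measurable_set0.
- by move=> B mB; rewrite setTD; exact: caratheodory_measurable_setC.
- by move=> B mB; exact: caratheodory_measurable_bigcup.
Qed.

Let rmk_sigma_additive : semi_sigma_additive (R:=R) (T:=borel X) rmk_outer.
Proof.
move=> F mF tF mUF.
apply: (@caratheodory_measure_sigma_additive R X rmk_outer) => //.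
  by move=> i; apply: rmk_borel; exact: mF.
exact: rmk_borel.
Qed.

(** It suffices to show [L f <= integ mu f] for [0 <= f <= 1]: the same inequality for [1 - f] gives
    the reverse one, and every continuous function is an affine image of one with values in
    [0, 1]. *)
Lemma riesz_markov_kakutani : exists mu : borelProb X,
  forall f, continuous f -> integ mu f = L f.
Proof.
have [mu muE] : exists mu : borelProb X,
    forall A, measurable (A : set (borel X)) -> mu A = rmk_outer A.
  pose M0 : {measure set (borel X) -> \bar R} := HB.pack (rmk_outer : set (borel X) -> \bar R)
  (isMeasure.Build _ (borel X) R rmk_outer rmk_outer0 rmk_outer_ge0 rmk_sigma_additive).
  pose P : probability (borel X) R := HB.pack (rmk_outer : set (borel X) -> \bar R)
  (Measure.class M0)
  (Measure_isProbability.Build _ (borel X) R M0 rmk_outerT).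
  exists (borel_normalize P) => A mA.
  by rewrite /= measurable_partE.
suff H f : continuous f -> (forall x, 0 <= f x <= 1) -> L f <= integ mu f.
  have {}H f : continuous f -> (forall x, 0 <= f x <= 1) -> integ mu f = L f.
    move=> cf f01; apply/eqP; rewrite eq_le H// andbT.
    have cf1 : continuous (fun x => 1 - f x).
      by apply: contB => //; exact: cont_cst.
    have := H _ cf1; rewrite rmkB//; last exact: cont_cst.
    rewrite integB; [|exact: bm_cst|exact: bm_continuous].
    rewrite integ_cst L1 lerD2l lerN2; apply=> x.
    by have := f01 x; lra.
  exists mu => f cf.
  have [_ [M fM]] := bm_continuous cX cf.
  pose N := `|M| + 1.
  have N0 : 0 < N by rewrite ltr_wpDl.
  have Nf x : `|f x| <= N.
    by rewrite (le_trans (fM x))// (le_trans (ler_norm M))// lerDl.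
  pose g x := (2 * N)^-1 * (f x + N).
  have cfN : continuous (fun x => f x + N).
    by apply: contD => //; exact: cont_cst.
  have cg : continuous g by exact: contZ.
  have g01 x : 0 <= g x <= 1.
    have := Nf x; rewrite ler_norml => /andP[h1 h2].
    rewrite /g mulr_ge0 /=; [|by rewrite invr_ge0; lra|lra].
    by rewrite mulrC ler_pdivrMr; lra.
  have := H g cg g01.
  rewrite /g integZ; last exact: bm_continuous.
  have N20 : (2 * N)^-1 != 0 by rewrite invr_eq0 gt_eqF//; lra.
  rewrite LZ// => /(mulfI N20).
  rewrite (integD _ (bm_continuous cX cf) (bm_cst _)) (LD cf (@cont_cst _ _ _)).
  by rewrite integ_cst rmk_cst => /addIr.
move=> cf f01.
apply/ler_addgt0Pr => e e0.
have [n n0 ne] : exists2 n, (0 < n)%N & n%:R^-1 < e.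
  exists (Num.truncn e^-1).+1 => //.
  by rewrite invf_plt ?posrE// truncnS_gt.
have n0' : 0 < n%:R :> R by rewrite ltr0n.
(* [s i] is the layer of [n * f] between the heights [i] and [i + 1]. It lies between the indicators
   of [U i.+1] and [U i], so [L (s i.+1) <= pr mu (U i.+1) <= integ mu (s i)]: shifting the layers
   by one compares the two sums up to [L (s 0) <= 1], that is up to [n%:R^-1 < e] after division. *)
pose s i x := Num.min 1 (Num.max 0 (n%:R * f x - i%:R)).
have cs i : continuous (s i).
  apply: cont_min; first exact: cont_cst.
  apply: cont_max; first exact: cont_cst.
  by apply: contB; [exact: contZ|exact: cont_cst].
have s01 i x : 0 <= s i x <= 1.
  by rewrite le_min ler01 le_max lexx /= ge_min lexx.
have sumsE x m : \sum_(0 <= i < m) s i x = Num.min m%:R (n%:R * f x).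
  have nf0 : 0 <= n%:R * f x by case/andP: (f01 x) => ? _; rewrite mulr_ge0.
  elim: m => [|m IH]; first by rewrite big_geq// (min_idPl nf0).
  rewrite big_nat_recr//= IH /s -natr1.
  rewrite /Num.min /Num.max; do ! case: ifPn; rewrite -?leNgt; lra.
have fE x : f x = n%:R^-1 * \sum_(0 <= i < n) s i x.
  rewrite sumsE (min_idPr _) ?mulKf ?gt_eqF//.
  by case/andP: (f01 x) => _ f1; rewrite -[leRHS]mulr1 ler_pM2l.
pose U i := [set x | i%:R < n%:R * f x].
have oU i : open (U i).
  by apply: strict_superlevel_open; exact: contZ.
have mU i : measurable (U i : set (borel X)) by exact: borel_open.
have LsU i : L (s i) <= pr mu (U i).
  rewrite -lee_fin -prE muE// rmk_outer_open//; apply: le_inner_content.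
  split => // x /negP; rewrite -leNgt => h.
  by rewrite /s (max_idPl _) ?subr_le0// (min_idPr _).
have Us i : pr mu (U i.+1) <= integ mu (s i).
  rewrite -integ_indic//; apply: le_integ; [exact: bm_indic|exact: bm_continuous|].
  move=> x; rewrite indicE; case: (boolP (x \in U i.+1)) => [|_]; last first.
    by case/andP: (s01 i x).
  rewrite inE /U /= -natr1 => h; rewrite le_min lexx le_max; apply/orP; right.
  lra.
have -> : L f = n%:R^-1 * \sum_(0 <= i < n) L (s i).
  rewrite -rmk_sum// -LZ; last exact: cont_sum.
  by congr L; apply/funext => x; exact: fE.
have -> : integ mu f = n%:R^-1 * \sum_(0 <= i < n) integ mu (s i).
  rewrite -integ_sum => [|i]; last exact: bm_continuous.
  rewrite -integZ; last by apply: bm_sum => i; exact: bm_continuous.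
  by apply: eq_integ => x; exact: fE.
apply: (@le_trans _ _ (n%:R^-1 * (1 + \sum_(0 <= i < n) integ mu (s i)))).
  rewrite ler_pM2l ?invr_gt0//; move: n0; case: (n) => // m _.
  rewrite big_nat_recl//; apply: lerD.
    by apply: le_trans (LsU 0%N) _; exact: pr_le1.
  rewrite big_nat_recr//= -[leLHS]addr0; apply: lerD.
    by apply: ler_sum => i _; exact: le_trans (LsU _) (Us _).
  by apply: integ_ge0 => x; case/andP: (s01 m x).
by rewrite mulrDr mulr1 addrC lerD2l ltW.
Qed.

End riesz_markov_kakutani.

(** * Weak* topology *)

Section finite_mixtures.
Context {R : realType} {X : pointedMetricType R}.
Implicit Types (mu nu : borelProb X) (f g : X -> R) (A C : set X).

Lemma integE mu f : (forall x, 0 <= f x) -> bounded_measurable f ->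
  (\int[mu]_x (f x)%:E)%E = (integ mu f)%:E.
Proof.
move=> f0 bf; rewrite /integ /Rintegral fineK//.
exact: (integrable_fin_num measurableT (bm_integrable mu bf)).
Qed.

(** Proved for nonnegative functions, where the integral is additive in the measure, then
    transferred to [f] through [f + M]. *)
Lemma integ_mixture n (w : nat -> R) (m : nat -> borelProb X) mu :
  (forall i, 0 <= w i) ->
  (forall A, measurable (A : set (borel X)) -> pr mu A = \sum_(i < n) w i * pr (m i) A) ->
  forall f, bounded_measurable f -> integ mu f = \sum_(i < n) w i * integ (m i) f.
Proof.
move=> w0 mE.
have H f : (forall x, 0 <= f x) -> bounded_measurable f ->
    integ mu f = \sum_(i < n) w i * integ (m i) f.
  move=> f0 bf; apply: EFin_inj; rewrite -integE//.
  have mf : measurable_fun [set: borel X] (EFin \o f) by apply/measurable_EFinP; case: bf.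
  rewrite (@eq_measure_integral _ (borel X) R setT
      (msum (fun i => mscale (NngNum (w0 i)) (m i)) n)); last first.
    move=> A mA _; transitivity (pr mu A)%:E; first exact: prE.
    rewrite mE// /msum/= -sumEFin; apply: eq_bigr => i _.
    by rewrite /mscale/= EFinM; congr (_ * _)%E; rewrite -prE.
  rewrite (@ge0_integral_measure_sum _ (borel X))//; last by move=> x _; rewrite lee_fin.
  rewrite -sumEFin; apply: eq_bigr => i _.
  rewrite (@ge0_integral_mscale _ (borel X))//; last by move=> x _; rewrite lee_fin.
  by rewrite EFinM -integE.
move=> f bf; have [mf [M fM]] := bf.
have bfM : bounded_measurable (fun x => f x + M) by apply: bmD => //; exact: bm_cst.
have := H (fun x => f x + M) _ bfM; rewrite integD//; last exact: bm_cst.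
rewrite integ_cst => /(_ _)/wrap[|h].
  by move=> x; have := fM x; rewrite ler_norml => /andP[+ _]; rewrite -subr_ge0 opprK.
apply: (addIr M); rewrite h.
under eq_bigr do rewrite (integD _ bf (bm_cst M)).
under eq_bigr do rewrite integ_cst mulrDr.
rewrite big_split/= -mulr_suml; congr (_ + _).
(* The constant [M] cancels because the weights have sum 1, which is [mE] read on the whole
   space. *)
have := mE setT (@measurableT _ (borel X)); rewrite pr_setT.
by under eq_bigr do rewrite pr_setT mulr1; move=> <-; rewrite mul1r.
Qed.

Lemma exists_mixture n (w : nat -> R) (m : nat -> borelProb X) :
  (forall i, 0 <= w i) -> \sum_(i < n) w i = 1 ->
  exists mu, forall A, measurable (A : set (borel X)) ->
    pr mu A = \sum_(i < n) w i * pr (m i) A.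
Proof.
move=> w0 w1.
pose M : {measure set (borel X) -> \bar R} := msum (fun i => mscale (NngNum (w0 i)) (m i)) n.
have ME A : M A = (\sum_(i < n) w i * pr (m i) A)%:E.
  rewrite /M /= /msum /= -sumEFin; apply: eq_bigr => i _.
  by rewrite /mscale/= EFinM -prE.
have MT : M setT = 1%E.
  by rewrite ME; under eq_bigr do rewrite pr_setT mulr1; rewrite w1.
pose P : probability (borel X) R := HB.pack (M : set (borel X) -> \bar R)
  (Measure.class M) (Measure_isProbability.Build _ (borel X) R M MT).
exists (borel_normalize P) => A mA.
by apply: EFin_inj; rewrite -prE -ME /= measurable_partE.
Qed.

Lemma pr_convex_comb t mu nu A : measurable (A : set (borel X)) ->
  pr (convex_comb t mu nu) A = t%:num * pr mu A + (1 - t%:num) * pr nu A.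
Proof.
move=> mA; apply: EFin_inj; rewrite -prE /= measurable_partE//=.
rewrite /mixture measure_addE/= /mscale/=.
by rewrite [in RHS]EFinD !EFinM -!prE.
Qed.

Lemma integ_convex_comb t mu nu f : bounded_measurable f ->
  integ (convex_comb t mu nu) f = t%:num * integ mu f + (1 - t%:num) * integ nu f.
Proof.
move=> bf.
pose w i : R := if i == 0%N then t%:num else 1 - t%:num.
pose m i : borelProb X := if i == 0%N then mu else nu.
have w0 i : 0 <= w i.
  by rewrite /w; case: eqP => // _; rewrite subr_ge0.
rewrite (@integ_mixture 2 w m _ w0 _ f bf); first by rewrite big_ord_recr big_ord1.
by move=> A mA; rewrite pr_convex_comb// big_ord_recr big_ord1.
Qed.

Lemma pr_empirical (T : X -> X) x n A : measurable (A : set (borel X)) ->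
  pr (empirical T x n) A = n.+1%:R^-1 * \sum_(j < n.+1) \1_A (iter j T x).
Proof.
move=> mA; apply: EFin_inj; rewrite -prE /= measurable_partE//=.
rewrite /orbit_average /mscale/= /msum/= EFinM -sumEFin; congr (_ * _)%E.
Qed.

Lemma integ_empirical (T : X -> X) x n f : bounded_measurable f ->
  integ (empirical T x n) f = n.+1%:R^-1 * \sum_(j < n.+1) f (iter j T x).
Proof.
move=> bf.
pose m j : borelProb X := borel_normalize (\d_(iter j T x : borel X) : probability (borel X) R).
have mE j A : measurable (A : set (borel X)) -> pr (m j) A = \1_A (iter j T x).
  by move=> mA; apply: EFin_inj; rewrite -prE /= measurable_partE.
rewrite (@integ_mixture n.+1 (fun=> n.+1%:R^-1) m)//; last first.
  move=> A mA; rewrite pr_empirical// mulr_sumr; apply: eq_bigr => i _.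
  by rewrite mE.
rewrite mulr_sumr; apply: eq_bigr => i _; congr (_ * _).
rewrite /integ /Rintegral (@eq_measure_integral _ (borel X) R setT \d_(iter i T x : borel X)).
  rewrite (@integral_dirac _ (borel X))//; last by apply/measurable_EFinP; case: bf.
  by rewrite diracT mul1e.
by move=> A mA _; rewrite /m /= measurable_partE.
Qed.

End finite_mixtures.

Lemma ptws_cvg (I : Type) (Y : topologicalType) (F : set_system {ptws I -> Y})
    (g : I -> Y) : Filter F ->
  (F --> (g : {ptws I -> Y})) <-> forall i, h i @[h --> F] --> g i.
Proof.
move=> FF; split; last first.
  move=> h; apply/cvg_sup => i A [_ [[B oB <-]]] /= Bg sBA.
  by apply: filterS sBA _; apply: h; exact: open_nbhs_nbhs.
move=> /cvg_sup Fg i A; rewrite nbhsE => -[B [oB Bg] BA].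
apply: (Fg i); exists (@^~ i @^-1` B); split => //; first by exists B.
by move=> h /= Bh; exact: BA.
Qed.

Lemma ultra_cvg_compact (I : Type) (Y : topologicalType) (F : set_system I)
    (g : I -> Y) (K : set Y) : UltraFilter F -> compact K -> (forall i, K (g i)) ->
  exists l : Y, g i @[i --> F] --> l.
Proof.
move=> UF cK gK.
have [|l [Kl gl]] := cK (g i @[i --> F]).
  have : F (g @^-1` K) by apply: filterS filterT => i _; exact: gK.
  by [].
exists l => A; rewrite nbhsE => -[B [oB Bl] BA].
have [FB|FB] := in_ultra_setVsetC (g @^-1` B) UF.
  by apply: filterS FB => i; exact: BA.
have [y [nBy By]] := gl (~` B) B FB (open_nbhs_nbhs (conj oB Bl)).
by [].
Qed.

Section weak_star_topology.
Context {R : realType} {X : pointedMetricType R}.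
Hypothesis cX : compact [set: X].
Implicit Types (mu nu : borelProb X) (f g : X -> R) (A C : set X).

Lemma continuous_integ f : continuous f -> continuous (fun mu : borelProb X => integ mu f).
Proof.
move=> cf mu.
pose cf' := isContinuous.Build X R f cf.
pose f' : continuousType X R := HB.pack f cf'.
have : integrals x @[x --> mu] --> integrals mu by exact: initial_continuous.
move=> h.
have FF : Filter (integrals x @[x --> mu]) by apply: fmap_filter; exact: nbhs_filter.
by have := (ptws_cvg (integrals mu) FF).1 h f'.
Qed.

Lemma borelProb_cvg (F : set_system (borelProb X)) mu : Filter F ->
  (forall f, continuous f -> integ nu f @[nu --> F] --> integ mu f) -> F --> mu.
Proof.
move=> FF h.
have {}h : integrals x @[x --> F] --> integrals mu.
  by rewrite ptws_cvg => f; apply: h; exact: cts_fun.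
move=> A [_ [[B oB <-] Bmu sBA]].
by apply: filterS sBA _; apply: h; exact: open_nbhs_nbhs.
Qed.

(** The open sets where [cdist C] is below [n.+1%:R^-1] decrease to [C]. *)
Lemma closed_outer_approx mu C (e : R) : closed C -> 0 < e ->
  exists2 d, 0 < d & pr mu [set x | cdist C x < d] <= pr mu C + e.
Proof.
move=> cC e0.
pose F n := [set x | cdist C x < n.+1%:R^-1].
have oF n : open (F n).
  rewrite /F (_ : [set x | _] = cdist C @^-1` [set y | y < n.+1%:R^-1]); last by [].
  by apply: open_comp; [move=> x _; exact: continuous_cdist|exact: open_lt].
have mF n : measurable (F n : set (borel X)) by exact: borel_open.
have FC : \bigcap_n F n = C.
  apply/seteqP; split => x; last by move=> Cx n _; rewrite /F /= cdist0.
  move=> Fx; apply: contrapT => nCx; have d0 := cdist_gt0 cC nCx.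
  have := Fx (Num.truncn (cdist C x)^-1) I.
  rewrite /F/= ltNge => /negP; apply; apply: ltW.
  by rewrite invf_plt ?posrE// truncnS_gt.
have mC : measurable (C : set (borel X)) by exact: borel_closed.
have : (mu \o F) x @[x --> \oo] --> (pr mu C)%:E.
  rewrite -prE -FC; apply: (@nonincreasing_cvg_mu _ (borel X)) => //.
  - by apply: (@le_lt_trans _ _ (pr mu (F 0%N))%:E); rewrite ?ltry// -prE.
  - by rewrite FC.
  - move=> n m nm; apply/subsetPset => x; rewrite /F /= => /lt_le_trans; apply.
    by rewrite lef_pV2 ?posrE// ler_nat.
move/fine_cvgP => [_ /cvgrPdist_le /(_ _ e0)[N _ /(_ N (leqnn N))]] /= h.
exists N.+1%:R^-1 => //.
by move: h; rewrite -/(pr mu C) -/(pr mu _) ler_norml => /andP[+ _]; rewrite lerNl opprB lerBlDl.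
Qed.

(* [tent] tends to the indicator of the closed set [C] as [d] tends to 0. *)
Definition tent C (d : R) (x : X) : R := 1 - Num.min 1 (d^-1 * cdist C x).

Lemma continuous_tent C d : continuous (tent C d).
Proof.
apply: contB; first exact: cont_cst.
apply: cont_min; first exact: cont_cst.
by apply: contZ; exact: continuous_cdist.
Qed.

Lemma tent01 C d x : 0 < d -> 0 <= tent C d x <= 1.
Proof.
move=> d0; rewrite /tent subr_ge0 ge_min lexx/= lerBlDr lerDl le_min ler01/=.
by rewrite mulr_ge0 ?invr_ge0 ?cdist_ge0// ltW.
Qed.

Lemma tent_in C d x : C x -> tent C d x = 1.
Proof. by move=> Cx; rewrite /tent cdist0// mulr0 (min_idPr _)// subr0. Qed.

Lemma tent_out C d x : 0 < d -> d <= cdist C x -> tent C d x = 0.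
Proof.
move=> d0 dx; rewrite /tent (min_idPl _) ?subrr//.
by rewrite mulrC ler_pdivlMr// mul1r.
Qed.

Lemma pr_closed_tent mu C d : closed C -> 0 < d -> pr mu C <= integ mu (tent C d).
Proof.
move=> cC d0; have mC := borel_closed cC.
rewrite -integ_indic//; apply: le_integ; first exact: bm_indic.
  by apply: bm_continuous => //; exact: continuous_tent.
move=> x; rewrite indicE; case: (boolP (x \in C)) => [|_].
  by rewrite inE => /tent_in ->.
by case/andP: (tent01 C x d0).
Qed.

Lemma integ_tent mu C d : 0 < d -> integ mu (tent C d) <= pr mu [set x | cdist C x < d].
Proof.
move=> d0; set U := [set x | _].
have mU : measurable (U : set (borel X)).
  apply: borel_open; rewrite /U (_ : [set x | _] = cdist C @^-1` [set y | y < d]); last by [].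
  by apply: open_comp; [move=> x _; exact: continuous_cdist|exact: open_lt].
rewrite -integ_indic//; apply: le_integ; last 2 first.
- exact: bm_indic.
- move=> x; rewrite indicE; case: (boolP (x \in U)) => [_|].
    by case/andP: (tent01 C x d0).
  rewrite notin_setE /U /= => /negP; rewrite -leNgt => dx.
  by rewrite tent_out.
by apply: bm_continuous => //; exact: continuous_tent.
Qed.

Lemma borelProb_eq mu nu :
  (forall A, measurable (A : set (borel X)) -> pr mu A = pr nu A) -> mu = nu.
Proof. by move=> h; apply: borelProb_ext => A mA; rewrite !prE h. Qed.

Lemma borelProb_eq_open mu nu : (forall A, open A -> pr mu A = pr nu A) -> mu = nu.
Proof.
move=> h; apply: borelProb_ext => A mA.
apply: (@measure_unique _ R (borel X) (@open X) (fun=> setT)) => //.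
- by move=> B C oB oC; exact: openI.
- by move=> _; exact: openT.
- by apply/seteqP; split => // x _; exists 0%N.
- move=> B oB; transitivity (pr mu B)%:E; first exact: prE.
  by rewrite h//; exact/esym/prE.
- by move=> _; apply: (@le_lt_trans _ _ (pr mu setT)%:E); rewrite ?ltry// -prE.
Qed.

(** Integrals of tents around a closed set squeeze its measure, and the open sets, being stable
    under intersection, determine a Borel probability. *)
Lemma borelProb_eq_integ mu nu :
  (forall f, continuous f -> integ mu f = integ nu f) -> mu = nu.
Proof.
have H m1 m2 C : (forall f, continuous f -> integ m1 f = integ m2 f) -> closed C ->
    pr m1 C <= pr m2 C.
  move=> h cC; apply/ler_addgt0Pr => e e0.
  have [d d0 hd] := closed_outer_approx m2 cC e0.
  rewrite (le_trans (pr_closed_tent m1 cC d0))// h; last exact: continuous_tent.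
  exact: le_trans (integ_tent _ _ d0) hd.
move=> h; apply: borelProb_eq_open => A oA.
have cA : closed (~` A) by exact: open_closedC.
have mA := borel_open oA.
have : pr mu (~` A) = pr nu (~` A).
  by apply/eqP; rewrite eq_le !H// => f cf; rewrite h.
by rewrite !prC// => /addrI/oppr_inj.
Qed.

Lemma integ_norm_le mu f M : continuous f -> (forall x, `|f x| <= M) -> `|integ mu f| <= M.
Proof.
move=> cf fM; have bf := bm_continuous cX cf.
rewrite ler_norml; apply/andP; split.
  by apply: ge_integ_cst => // x; have := fM x; rewrite ler_norml => /andP[].
by apply: integ_le_cst => // x; have := fM x; rewrite ler_norml => /andP[].
Qed.

(** Along an ultrafilter every integral of a continuous function converges, being bounded by the sup
    norm. The limits form a positive normalized linear functional, and the measure that represents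
    it is the limit. *)
Lemma borelProb_compact : compact [set: borelProb X].
Proof.
rewrite compact_ultra => F UF _.
pose L f := lim (integ nu f @[nu --> F]).
have cvgL f : continuous f -> integ nu f @[nu --> F] --> L f.
  move=> cf; have [_ [M fM]] := bm_continuous cX cf.
  have cM : compact `[- M, M]%classic by exact: segment_compact.
  apply/cvg_ex; apply: (ultra_cvg_compact UF cM) => nu.
  by rewrite /= in_itv /= -ler_norml integ_norm_le.
have LE f l : integ nu f @[nu --> F] --> l -> L f = l by move=> h; exact: cvg_lim.
have [||||mu muE] := @riesz_markov_kakutani R X cX L.
- move=> f g cf cg; apply: LE.
  under eq_fun do rewrite (integD _ (bm_continuous cX cf) (bm_continuous cX cg)).
  by apply: cvgD; exact: cvgL.
- move=> r f cf; apply: LE.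
  under eq_fun do rewrite (integZ _ _ (bm_continuous cX cf)).
  by apply: cvgM; [exact: cvg_cst|exact: cvgL].
- move=> f cf f0; apply: limr_ge; first by apply/cvg_ex; exists (L f); exact: cvgL.
  by apply: filterS filterT => nu _; exact: integ_ge0.
- apply: LE; under eq_fun do rewrite integ_cst; exact: cvg_cst.
exists mu; split => //; apply: borelProb_cvg => f cf.
by rewrite muE//; exact: cvgL.
Qed.

Lemma exists_pushforward (T : X -> X) mu : continuous T ->
  exists2 nu, forall A, measurable (A : set (borel X)) -> pr nu A = pr mu (T @^-1` A) &
    forall f, bounded_measurable f -> integ nu f = integ mu (f \o T).
Proof.
move=> cT.
have mT : @measurable_fun _ _ (borel X) (borel X) setT T.
  by move=> _ A mA; rewrite setTI; exact: borel_continuous.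
have [nu nuE] : exists nu : borelProb X, forall A, measurable (A : set (borel X)) ->
    nu A = mu (T @^-1` A).
  have [M ME] : exists M : {measure set (borel X) -> \bar R}, forall A, M A = mu (T @^-1` A).
    by unshelve eexists (pushforward mu (T : borel X -> borel X) : {measure set _ -> \bar R}).
  pose m (A : set (borel X)) : \bar R := mu (T @^-1` A).
  have m0 : m set0 = 0%E by rewrite /m -ME measure0.
  have m_ge0 A : (0 <= m A)%E by rewrite /m -ME.
  have m_sigma : semi_sigma_additive m.
    have -> : m = M by apply/funext => A; rewrite ME.
    exact: measure_semi_sigma_additive.
  pose M0 : {measure set (borel X) -> \bar R} := HB.pack m
    (isMeasure.Build _ (borel X) R m m0 m_ge0 m_sigma).
  have MT : m setT = 1%E by rewrite /m preimage_setT borelProb_setT.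
  pose P : probability (borel X) R := HB.pack m
    (Measure.class M0) (Measure_isProbability.Build _ (borel X) R M0 MT).
  by exists (borel_normalize P) => A mA; rewrite /= measurable_partE.
exists nu; first by move=> A mA; rewrite /pr nuE.
have H f : (forall x, 0 <= f x) -> bounded_measurable f -> integ nu f = integ mu (f \o T).
  move=> f0 bf; rewrite /integ /Rintegral; congr fine.
  have mf : measurable_fun [set: borel X] (EFin \o f) by apply/measurable_EFinP; case: bf.
  have := @ge0_integral_pushforward _ _ (borel X) (borel X) R T mT mu setT (EFin \o f) measurableT mf.
  rewrite preimage_setT => <-; last by move=> x _; rewrite lee_fin.
  by apply: eq_measure_integral => A mA _; exact: nuE.
move=> f bf; have [mf [M fM]] := bf.
have bfT : bounded_measurable (f \o T).
  split; first exact: (measurableT_comp mf mT).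
  by exists M => x; exact: fM.
have := H (fun x => f x + M) _ (bmD bf (bm_cst M)).
rewrite (integD nu bf (bm_cst M)) (integD mu bfT (bm_cst M)) !integ_cst => /(_ _)/wrap[|/addIr//].
by move=> x; have := fM x; rewrite ler_norml => /andP[+ _]; rewrite -subr_ge0 opprK.
Qed.

(** The measure [mu] and its pushforward are equal as soon as they integrate continuous functions
    alike. In this form invariance passes to weak* limits. *)
Lemma invariant_integ (T : X -> X) mu : continuous T ->
  (invariant_measures T mu <->
   forall f, continuous f -> integ mu (f \o T) = integ mu f).
Proof.
move=> cT; have [nu nuE nuI] := exists_pushforward mu cT; split => [imu f cf|h].
  rewrite -nuI; last exact: bm_continuous.
  by congr integ; apply: borelProb_eq => A mA; rewrite nuE// /pr imu.
have munu : nu = mu.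
  apply: borelProb_eq_integ => f cf; rewrite nuI ?h//.
  exact: bm_continuous.
by move=> A mA; rewrite [LHS]prE -nuE// munu -prE.
Qed.

End weak_star_topology.

(** * Measure-theoretic entropy *)

Section gibbs.
Context {R : realType}.

Lemma ln_le_sub1 (x : R) : 0 < x -> ln x <= x - 1.
Proof.
move=> x0; have -> : ln x = ln (1 + (x - 1)) by congr ln; lra.
by apply: le_ln1Dx; lra.
Qed.

(** Relative entropy is nonnegative, by [ln y <= y - 1] at [y = q i / p i]. *)
Lemma gibbs (I : finType) (p q : I -> R) :
  (forall i, 0 <= p i) -> (forall i, 0 <= q i) -> \sum_i q i <= \sum_i p i ->
  (forall i, 0 < p i -> 0 < q i) ->
  \sum_i p i * ln (q i) <= \sum_i p i * ln (p i).
Proof.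
move=> p0 q0 qp pq; rewrite -subr_le0 -sumrB.
apply: (@le_trans _ _ (\sum_i (q i - p i))); last by rewrite sumrB subr_le0.
apply: ler_sum => i _; have := p0 i; rewrite le_eqVlt => /predU1P[<-|pi0].
  by rewrite !mul0r !subr0.
have qi0 := pq i pi0; rewrite -mulrBr -ln_div ?posrE//.
apply: (le_trans (ler_wpM2l (ltW pi0) (ln_le_sub1 (divr_gt0 qi0 pi0)))).
by rewrite mulrBr mulr1 mulrCA divff ?gt_eqF// mulr1.
Qed.

End gibbs.

Section code_entropy.
Context {R : realType} {X : pointedMetricType R}.
Implicit Types (mu nu : borelProb X).

(* A finite measurable partition is encoded by the map sending a point to its cell. *)
Definition measurable_code (A : finType) (c : X -> A) :=
  forall a, measurable ([set x | c x = a] : set (borel X)).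

(* In natural logarithms, whereas [join_entropy] is in base 2. *)
Definition entropy mu (A : finType) (c : X -> A) : R :=
  - \sum_a pr mu [set x | c x = a] * ln (pr mu [set x | c x = a]).

Lemma code_measurable (A : finType) (c : X -> A) (P : pred A) : measurable_code c ->
  measurable ([set x | P (c x)] : set (borel X)).
Proof.
move=> mc; rewrite (_ : [set x | _] = \bigcup_(a in [set a | P a]) [set x | c x = a]).
  by apply: fin_bigcup_measurable => // a _; exact: mc.
apply/seteqP; split => x /=.
  by move=> Px; exists (c x).
by move=> [a Pa /= ->].
Qed.

Lemma pr_code (A : finType) (c : X -> A) (P : pred A) mu : measurable_code c ->
  pr mu [set x | P (c x)] = \sum_(a | P a) pr mu [set x | c x = a].
Proof.
move=> mc; rewrite -integ_indic; last exact: code_measurable.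
rewrite -big_filter; under eq_bigr do rewrite -integ_indic//.
rewrite -integ_sum; last by move=> a; exact: bm_indic.
apply: eq_integ => x; rewrite indicE big_filter.
have [Pc|Pc] := boolP (P (c x)).
  rewrite mem_set//= (bigD1 (c x))//= indicE mem_set//= big1 ?addr0// => a /andP[_ ac].
  by rewrite indicE memNset//= => h; move/eqP: ac; apply; rewrite h.
rewrite memNset/=; last exact/negP.
rewrite big1// => a Pa; rewrite indicE memNset//= => h.
by move: Pc; rewrite h Pa.
Qed.

Lemma pr_code1 (A : finType) (c : X -> A) mu : measurable_code c ->
  \sum_a pr mu [set x | c x = a] = 1.
Proof.
move=> mc; rewrite -(pr_code predT mu mc) -(pr_setT mu); congr pr.
by apply/seteqP; split.
Qed.

Lemma measurable_code_comp (A B : finType) (phi : A -> B) (c : X -> A) :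
  measurable_code c -> measurable_code (phi \o c).
Proof.
move=> mc b; have := code_measurable (fun a => phi a == b) mc.
by congr measurable; apply/seteqP; split => x /= /eqP.
Qed.

Lemma pr_code_comp (A B : finType) (phi : A -> B) (c : X -> A) mu b : measurable_code c ->
  pr mu [set x | phi (c x) = b] = \sum_(a | phi a == b) pr mu [set x | c x = a].
Proof.
move=> mc; rewrite -(pr_code (fun a => phi a == b) mu mc); congr pr.
by apply/seteqP; split => x /= /eqP.
Qed.

Lemma measurable_code_pair (A B : finType) (c : X -> A) (d : X -> B) :
  measurable_code c -> measurable_code d -> measurable_code (fun x => (c x, d x)).
Proof.
move=> mc md [a b].
rewrite (_ : [set x | _] = [set x | c x = a] `&` [set x | d x = b]).
  exact: measurableI.
by apply/seteqP; split => x /=; [case|case=> -> ->].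
Qed.

Lemma entropy_ge0 mu (A : finType) (c : X -> A) : 0 <= entropy mu c.
Proof.
rewrite /entropy oppr_ge0; apply: sumr_le0 => a _.
by rewrite mulr_ge0_le0 ?pr_ge0// ln_le0// pr_le1.
Qed.

(** Every cell is contained in the cell of its image code, which has larger measure; both entropies
    are averages of [- ln] of these measures over the finer cells. *)
Lemma entropy_comp_le mu (A B : finType) (phi : A -> B) (c : X -> A) : measurable_code c ->
  entropy mu (phi \o c) <= entropy mu c.
Proof.
move=> mc; rewrite lerN2.
have -> : \sum_b pr mu [set x | (phi \o c) x = b] * ln (pr mu [set x | (phi \o c) x = b]) =
    \sum_a pr mu [set x | c x = a] * ln (pr mu [set x | phi (c x) = phi a]).
  rewrite [RHS](partition_big phi predT)//=; apply: eq_bigr => b _.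
  rewrite {1}pr_code_comp// mulr_suml; apply: eq_bigr => a /eqP <-//.
apply: ler_sum => a _; have := pr_ge0 mu [set x | c x = a].
rewrite le_eqVlt => /predU1P[<-|p0]; first by rewrite !mul0r.
rewrite ler_pM2l// ler_ln ?posrE//.
  apply: le_pr => //; last by move=> x /= ->.
  exact: (measurable_code_comp phi mc (phi a)).
apply: lt_le_trans p0 _; apply: le_pr => //; last by move=> x /= ->.
exact: (measurable_code_comp phi mc (phi a)).
Qed.

(** This is [gibbs] for the joint law against the product of its marginals. *)
Lemma entropy_pair_le mu (A B : finType) (c : X -> A) (d : X -> B) :
  measurable_code c -> measurable_code d ->
  entropy mu (fun x => (c x, d x)) <= entropy mu c + entropy mu d.
Proof.
move=> mc md; have mcd := measurable_code_pair mc md.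
pose p ab := pr mu [set x | (c x, d x) = ab].
pose pc a := pr mu [set x | c x = a]; pose pd b := pr mu [set x | d x = b].
have pcE a : pc a = \sum_(ab | ab.1 == a) p ab by exact: (pr_code_comp fst mu a mcd).
have pdE b : pd b = \sum_(ab | ab.2 == b) p ab by exact: (pr_code_comp snd mu b mcd).
have p_pc ab : p ab <= pc ab.1.
  by apply: le_pr => // x /= <-.
have p_pd ab : p ab <= pd ab.2.
  by apply: le_pr => // x /= <-.
have marg1 : \sum_a pc a * ln (pc a) = \sum_ab p ab * ln (pc ab.1).
  rewrite [RHS](partition_big fst predT)//=; apply: eq_bigr => a _.
  by rewrite {1}pcE mulr_suml; apply: eq_bigr => ab /eqP <-.
have marg2 : \sum_b pd b * ln (pd b) = \sum_ab p ab * ln (pd ab.2).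
  rewrite [RHS](partition_big snd predT)//=; apply: eq_bigr => a _.
  by rewrite {1}pdE mulr_suml; apply: eq_bigr => ab /eqP <-.
rewrite /entropy -opprD lerN2 marg1 marg2 -big_split/=.
apply: (@le_trans _ _ (\sum_ab p ab * ln (pc ab.1 * pd ab.2))).
  apply: ler_sum => ab _; have := pr_ge0 mu [set x | (c x, d x) = ab].
  rewrite -/(p ab) le_eqVlt => /predU1P[<-|p0]; first by rewrite !mul0r addr0.
  have ? : 0 < pc ab.1 by exact: lt_le_trans p0 (p_pc ab).
  have ? : 0 < pd ab.2 by exact: lt_le_trans p0 (p_pd ab).
  by rewrite lnM ?posrE// mulrDr.
apply: gibbs => //.
- by move=> ab; exact: pr_ge0.
- by move=> ab; rewrite mulr_ge0 ?pr_ge0.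
- rewrite pr_code1// -(pair_bigA _ (fun a b => pc a * pd b))/=.
  under eq_bigr do rewrite -mulr_sumr pr_code1// mulr1.
  by rewrite pr_code1.
- move=> ab p0; rewrite mulr_gt0//; first exact: lt_le_trans p0 (p_pc ab).
  exact: lt_le_trans p0 (p_pd ab).
Qed.

(** The entropy of the mixture is the average of the cross entropies of [mu] and [nu] relative to
    it, and [gibbs] bounds each of them from below by the entropy itself. *)
Lemma entropy_concave t mu nu (A : finType) (c : X -> A) : measurable_code c ->
  t%:num * entropy mu c + (1 - t%:num) * entropy nu c <= entropy (convex_comb t mu nu) c.
Proof.
move=> mc; have t0 : 0 <= t%:num by [].
have t1 : 0 <= 1 - t%:num by rewrite subr_ge0.
pose p a := pr mu [set x | c x = a]; pose q a := pr nu [set x | c x = a].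
pose m a := pr (convex_comb t mu nu) [set x | c x = a].
have mE a : m a = t%:num * p a + (1 - t%:num) * q a by exact: pr_convex_comb.
have H (s : R) (r : A -> R) : 0 <= s -> (forall a, 0 <= r a) -> \sum_a r a = 1 ->
    (forall a, s * r a <= m a) -> s * \sum_a r a * ln (m a) <= s * \sum_a r a * ln (r a).
  (* The weight [s = 0] is set apart, since then [m] may vanish where [r] does not. *)
  move=> s0 r0 r1 rm; move: s0; rewrite le_eqVlt => /predU1P[<-|s0]; first by rewrite !mul0r.
  rewrite ler_pM2l//; apply: gibbs => //.
  - by move=> a; exact: pr_ge0.
  - by rewrite r1 pr_code1.
  - by move=> a ra0; apply: lt_le_trans (rm a); rewrite mulr_gt0.
rewrite /entropy !mulrN -opprD lerN2 -/(m _).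
have -> : \sum_a m a * ln (m a) =
    t%:num * \sum_a p a * ln (m a) + (1 - t%:num) * \sum_a q a * ln (m a).
  rewrite !mulr_sumr -big_split/=; apply: eq_bigr => a _.
  by rewrite {1}mE mulrDl !mulrA.
apply: lerD; apply: H => //.
- by move=> a; exact: pr_ge0.
- exact: pr_code1.
- by move=> a; rewrite mE lerDl mulr_ge0// pr_ge0.
- by move=> a; exact: pr_ge0.
- exact: pr_code1.
- by move=> a; rewrite mE lerDr mulr_ge0// pr_ge0.
Qed.

Section dynamics.
Variable (T : X -> X).
Hypothesis cT : continuous T.

Definition itinerary (A : finType) (c : X -> A) n (x : X) : {ffun 'I_n -> A} :=
  [ffun i : 'I_n => c (iter i T x)].

Lemma continuous_iter n : continuous (iter n T).
Proof.
elim: n => [|n IH] x; first exact: cvg_id.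
by apply: (@continuous_comp _ _ _ (iter n T) T); [exact: IH|exact: cT].
Qed.

Lemma measurable_code_iter (A : finType) (c : X -> A) n : measurable_code c ->
  measurable_code (c \o iter n T).
Proof.
move=> mc a; have := borel_continuous (@continuous_iter n) (mc a).
exact.
Qed.

Lemma measurable_itinerary (A : finType) (c : X -> A) n : measurable_code c ->
  measurable_code (itinerary c n).
Proof.
move=> mc w.
rewrite (_ : [set x | _] = \bigcap_(i in [set: 'I_n]) [set x | (c \o iter i T) x = w i]).
  apply: fin_bigcap_measurable => // i _; exact: measurable_code_iter.
apply/seteqP; split => x /=.
  by move=> <- i _ /=; rewrite ffunE.
by move=> h; apply/ffunP => i; rewrite ffunE; exact: h.
Qed.

Lemma invariant_iter mu n A : invariant_measures T mu -> measurable (A : set (borel X)) ->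
  pr mu (iter n T @^-1` A) = pr mu A.
Proof.
move=> imu mA; elim: n => [//|n IH]; rewrite -[RHS]IH /pr -[in RHS]imu.
  by congr (fine (mu _)); apply/seteqP; split => x /=; rewrite -iterSr.
exact: borel_continuous (@continuous_iter n) mA.
Qed.

Lemma entropy_iter mu (A : finType) (c : X -> A) n : measurable_code c ->
  invariant_measures T mu -> entropy mu (c \o iter n T) = entropy mu c.
Proof.
move=> mc imu; congr (- _); apply: eq_bigr => a _.
by have := invariant_iter n imu (mc a) => /= <-.
Qed.

(** An itinerary of length [m + n] is read off the first [m] letters and the [n] letters from time
    [m] on; by invariance the latter have the entropy of the first [n]. *)
Lemma entropy_subadditive mu (A : finType) (c : X -> A) m n : measurable_code c ->
  invariant_measures T mu ->
  entropy mu (itinerary c (m + n)) <= entropy mu (itinerary c m) + entropy mu (itinerary c n).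
Proof.
move=> mc imu.
pose phi (uv : {ffun 'I_m -> A} * {ffun 'I_n -> A}) : {ffun 'I_(m + n) -> A} :=
  [ffun i : 'I_(m + n) => match fintype.split i with inl j => uv.1 j | inr j => uv.2 j end].
have -> : itinerary c (m + n) = phi \o (fun x => (itinerary c m x, itinerary c n (iter m T x))).
  apply/funext => x; apply/ffunP => i; rewrite !ffunE /=.
  case: fintype.splitP => j ij; rewrite ffunE ij//.
  by rewrite addnC iterD.
apply: le_trans (entropy_comp_le _ _ _) _.
  apply: measurable_code_pair; first exact: measurable_itinerary.
  by apply: (measurable_code_iter m); exact: measurable_itinerary.
apply: le_trans (entropy_pair_le _ _ _) _.
- exact: measurable_itinerary.
- by apply: (measurable_code_iter m); exact: measurable_itinerary.
- by rewrite lerD2l (@entropy_iter mu _ (itinerary c n) m)//; exact: measurable_itinerary.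
Qed.

End dynamics.
End code_entropy.

(** The limit is the infimum of [a n / n%:R] over positive [n], nearly attained at some [q];
    Euclidean division of [n] by [q] leaves a remainder at which [a] is at most the constant [C]. *)
Lemma fekete {R : realType} (a : nat -> R) : (forall n, 0 <= a n) ->
  (forall m n, a (m + n)%N <= a m + a n) -> cvg ((fun n => a n / n%:R) @ \oo).
Proof.
move=> a0 aD.
pose S := [set a n / n%:R | n in [set n | (0 < n)%N]].
have S0 : has_inf S.
  split; first by exists (a 1%N / 1), 1%N.
  by exists 0 => _ [n _ <-]; rewrite divr_ge0.
apply/cvg_ex; exists (inf S); apply/cvgrPdist_le => e e0.
have e20 : 0 < e / 2 by rewrite divr_gt0.
have [_ [q q0 <-] aq] := inf_adherent e20 S0.
have akq k r : a (k * q + r)%N <= k%:R * a q + a r.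
  elim: k => [|k IH]; first by rewrite mul0n add0n mul0r add0r.
  rewrite mulSn -addnA (le_trans (aD _ _))// -natr1 mulrDl mul1r.
  by move: IH; lra.
have ar r : a r <= a 0%N + r%:R * a 1%N.
  elim: r => [|r IH]; first by rewrite mul0r addr0.
  by rewrite -addn1 (le_trans (aD _ _))// natrD mulrDl mul1r addrA lerD2r.
pose C := a 0%N + q%:R * a 1%N.
near=> n.
have n0 : 0 < n%:R :> R by rewrite ltr0n; near: n; exact: nbhs_infty_gt.
have Cn : C / (e / 2) < n%:R by near: n; exact: nbhs_infty_gtr.
have q0' : 0 < q%:R :> R by rewrite ltr0n.
have infn : inf S <= a n / n%:R.
  by apply: ge_inf; [case: S0|exists n => //; rewrite /= -(ltr0n R)].
rewrite distrC ger0_norm ?subr_ge0// lerBlDl.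
apply: (@le_trans _ _ (a q / q%:R + e / 2)); last by lra.
rewrite ler_pdivrMr// mulrDl.
rewrite {1}(divn_eq n q) (le_trans (akq _ _))//; apply: lerD.
  rewrite [leRHS]mulrAC -[leRHS]mulrA [leRHS]mulrC ler_wpM2r// ler_pdivlMr// -natrM ler_nat.
  exact: leq_trunc_div.
apply: (@le_trans _ _ C).
  rewrite (le_trans (ar _))// lerD2l ler_wpM2r// ler_nat ltnW// ltn_mod.
  by rewrite -(ltr0n R).
by rewrite mulrC -ler_pdivrMr// ltW.
Unshelve. all: end_near. Qed.

Section entropy_rate.
Context {R : realType} {X : pointedMetricType R}.
Variable T : X -> X.
Hypothesis cT : continuous T.
Implicit Types (mu nu : borelProb X).

(** The entropy of [T] relative to the partition coded by [c], in natural logarithms: the base 2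
    quantities of the statement carry a factor [(ln 2)^-1]. *)
Definition entropy_rate mu (A : finType) (c : X -> A) : R :=
  lim ((fun n => entropy mu (itinerary T c n) / n%:R) @ \oo).

Lemma is_cvg_entropy_rate mu (A : finType) (c : X -> A) : measurable_code c ->
  invariant_measures T mu ->
  cvg ((fun n => entropy mu (itinerary T c n) / n%:R) @ \oo).
Proof.
move=> mc imu; apply: (@fekete R (fun n => entropy mu (itinerary T c n))) => [n|m n].
  exact: entropy_ge0.
exact: entropy_subadditive.
Qed.

Lemma entropy_rate_ge mu (A : finType) (c : X -> A) (r : R) : measurable_code c ->
  invariant_measures T mu ->
  (forall n, (0 < n)%N -> r <= entropy mu (itinerary T c n) / n%:R) ->
  r <= entropy_rate mu c.
Proof.
move=> mc imu h; apply: limr_ge; first exact: is_cvg_entropy_rate.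
by exists 1%N => // n /= n0; exact: h.
Qed.

Lemma entropy_rate_ge0 mu (A : finType) (c : X -> A) : measurable_code c ->
  invariant_measures T mu -> 0 <= entropy_rate mu c.
Proof.
move=> mc imu; apply: entropy_rate_ge => // n n0.
by rewrite divr_ge0 ?entropy_ge0.
Qed.

Lemma measurable_partition_code k (xi : 'I_k -> set X) : measurable_partition xi ->
  exists2 c : X -> 'I_k, measurable_code c & forall i, xi i = [set x | c x = i].
Proof.
move=> [mxi txi cxi].
have /choice[c cP] : forall x, exists i, xi i x.
  by move=> x; have : [set: X] x by []; rewrite -cxi => -[i _ xix]; exists i.
have cE i : xi i = [set x | c x = i].
  apply/seteqP; split => x /=; last by move=> <-; exact: cP.
  move=> xix; have [|] := pselect (c x = i) => // ci.
  apply/eqP; apply: contrapT => /negP ci'.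
  have /trivIsetP/(_ (c x) i Logic.I Logic.I ci') := txi.
  by move/seteqP => [/(_ x (conj (cP x) xix))].
by exists c => // i; rewrite -cE.
Qed.

Lemma code_measurable_partition k (c : X -> 'I_k) : measurable_code c ->
  measurable_partition (fun i => [set x | c x = i]).
Proof.
move=> mc; split => //.
  by apply/trivIsetP => i j _ _ ij; apply/seteqP; split => x // [/= ->] /eqP; exact/negP.
by apply/seteqP; split => x // _; exists (c x).
Qed.

Lemma join_entropyE mu k (c : X -> 'I_k) n :
  join_entropy T mu (fun i => [set x | c x = i]) n = entropy mu (itinerary T c n) / ln 2.
Proof.
rewrite /join_entropy /entropy mulNr; congr (- _).
rewrite mulr_suml; apply: eq_bigr => w _; rewrite mulrA.
suff -> : join_cell T (fun i => [set x | c x = i]) w = [set x | itinerary T c n x = w] by [].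
apply/seteqP; split => x /=.
  by move=> h; apply/ffunP => i; rewrite ffunE; exact: h.
by move=> <- i /=; rewrite ffunE.
Qed.

Lemma ln2_gt0 : 0 < ln 2 :> R.
Proof. by rewrite ln_gt0// ltr1n. Qed.

Lemma partition_entropyE mu k (c : X -> 'I_k) : measurable_code c ->
  invariant_measures T mu ->
  partition_entropy T mu (fun i => [set x | c x = i]) = (entropy_rate mu c / ln 2)%:E.
Proof.
move=> mc imu; apply/cvg_lim => //; apply: cvg_EFin.
  by near=> n.
rewrite (_ : fine \o _ = fun n => entropy mu (itinerary T c n) / n%:R * (ln 2)^-1).
  by apply: cvgM; [exact: is_cvg_entropy_rate|exact: cvg_cst].
by apply/funext => n /=; rewrite join_entropyE mulrAC.
Unshelve. all: end_near. Qed.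

Lemma entropy_rate_comp_le mu (A B : finType) (phi : A -> B) (c : X -> A) :
  measurable_code c -> invariant_measures T mu ->
  entropy_rate mu (phi \o c) <= entropy_rate mu c.
Proof.
move=> mc imu; apply: ler_lim.
- by apply: is_cvg_entropy_rate => //; exact: measurable_code_comp.
- exact: is_cvg_entropy_rate.
near=> n; rewrite ler_wpM2r ?invr_ge0//.
have -> : itinerary T (phi \o c) n =
    (fun w : {ffun 'I_n -> A} => [ffun i => phi (w i)]) \o itinerary T c n.
  by apply/funext => x; apply/ffunP => i; rewrite !ffunE.
by apply: entropy_comp_le; exact: measurable_itinerary.
Unshelve. all: end_near. Qed.

Lemma metric_entropy_ge mu (A : finType) (c : X -> A) : measurable_code c ->
  invariant_measures T mu -> ((entropy_rate mu c / ln 2)%:E <= metric_entropy T mu)%E.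
Proof.
move=> mc imu.
pose d := enum_rank \o c : X -> 'I_#|A|.
have md : measurable_code d by exact: measurable_code_comp.
apply: (@le_trans _ _ (entropy_rate mu d / ln 2)%:E).
  rewrite lee_fin ler_wpM2r ?invr_ge0 ?(ltW ln2_gt0)//.
  have -> : c = enum_val \o d by apply/funext => x /=; rewrite enum_rankK.
  exact: entropy_rate_comp_le.
apply: ereal_sup_ubound; exists #|A|, (fun i => [set x | d x = i]).
by split; [exact: code_measurable_partition|rewrite partition_entropyE].
Qed.

Lemma metric_entropy_gt mu (r : R) : invariant_measures T mu ->
  (r%:E < metric_entropy T mu)%E ->
  exists k (c : X -> 'I_k), measurable_code c /\ r < entropy_rate mu c / ln 2.
Proof.
move=> imu /ereal_sup_gt[_ [k [xi [mxi ->]]]].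
have [c mc xiE] := measurable_partition_code mxi.
have -> : xi = (fun i => [set x | c x = i]) by apply/funext.
by rewrite partition_entropyE// lte_fin => rc; exists k, c.
Qed.

Lemma metric_entropy_ge0 mu : invariant_measures T mu -> (0 <= metric_entropy T mu)%E.
Proof.
move=> imu.
have mc : measurable_code (fun _ : X => tt).
  move=> []; rewrite (_ : [set x | _] = setT); first exact: (@measurableT _ (borel X)).
  by apply/seteqP; split.
apply: le_trans (metric_entropy_ge mc imu).
by rewrite lee_fin divr_ge0 ?entropy_rate_ge0// ltW// ln2_gt0.
Qed.

Lemma invariant_convex_comb t mu nu : invariant_measures T mu -> invariant_measures T nu ->
  invariant_measures T (convex_comb t mu nu).
Proof.
move=> imu inu A mA; rewrite [LHS]prE [RHS]prE !pr_convex_comb//.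
  by rewrite /pr imu// inu.
exact: borel_continuous.
Qed.

(** Nearly optimal partitions for [mu] and [nu] are refined by the pair code [e], to which
    [entropy_concave] applies at each length. Strict real bounds stand for the entropies, which may
    be infinite. *)
Lemma metric_entropy_convex_comb t mu nu (r s : R) :
  invariant_measures T mu -> invariant_measures T nu ->
  (r%:E < metric_entropy T mu)%E -> (s%:E < metric_entropy T nu)%E ->
  ((t%:num * r + (1 - t%:num) * s)%:E < metric_entropy T (convex_comb t mu nu))%E.
Proof.
move=> imu inu /(metric_entropy_gt imu)[k [c [mc rc]]] /(metric_entropy_gt inu)[l [d [md sd]]].
have imn := invariant_convex_comb t imu inu.
pose e x := (c x, d x).
have me : measurable_code e by exact: measurable_code_pair.
apply: lt_le_trans (metric_entropy_ge me imn); rewrite lte_fin.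
have t0 : 0 <= t%:num by [].
have t1 : 0 <= 1 - t%:num by rewrite subr_ge0.
have L0 : 0 <= (ln 2)^-1 :> R by rewrite invr_ge0 ltW// ln2_gt0.
apply: (@lt_le_trans _ _
  ((t%:num * entropy_rate mu e + (1 - t%:num) * entropy_rate nu e) / ln 2)).
  have h1 : r < entropy_rate mu e / ln 2.
    apply: lt_le_trans rc _; rewrite ler_wpM2r//.
    exact: (@entropy_rate_comp_le mu _ _ fst e).
  have h2 : s < entropy_rate nu e / ln 2.
    apply: lt_le_trans sd _; rewrite ler_wpM2r//.
    exact: (@entropy_rate_comp_le nu _ _ snd e).
  have -> : (t%:num * entropy_rate mu e + (1 - t%:num) * entropy_rate nu e) / ln 2 =
      t%:num * (entropy_rate mu e / ln 2) + (1 - t%:num) * (entropy_rate nu e / ln 2).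
    by rewrite mulrDl !mulrA.
  (* For a zero weight on [mu] the strict inequality has to come from [nu]. *)
  move: t0; rewrite le_eqVlt => /predU1P[<-|t0].
    by rewrite !mul0r !add0r subr0 !mul1r.
  apply: ltr_leD; first by rewrite ltr_pM2l.
  by rewrite ler_wpM2l// ltW.
rewrite ler_wpM2r//.
have cm := is_cvg_entropy_rate me imu; have cn := is_cvg_entropy_rate me inu.
have cmn := is_cvg_entropy_rate me imn.
have : (fun n => t%:num * (entropy mu (itinerary T e n) / n%:R) +
    (1 - t%:num) * (entropy nu (itinerary T e n) / n%:R)) @ \oo -->
    t%:num * entropy_rate mu e + (1 - t%:num) * entropy_rate nu e.
  by apply: cvgD; (apply: cvgM; first exact: cvg_cst).
move=> h; rewrite -(cvg_lim _ h)//; apply: ler_lim => //.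
  by apply/cvg_ex; eexists; exact: h.
near=> n; rewrite !mulrA -mulrDl ler_wpM2r ?invr_ge0//.
by apply: entropy_concave; exact: measurable_itinerary.
Unshelve. all: end_near. Qed.

End entropy_rate.

(** * The variational principle *)

Section bowen_entropy.
Context {R : realType} {X : pointedMetricType R}.
Variable T : X -> X.
Implicit Types (E : set X) (t e : R).

Lemma bowen_outer_ge0 E t n e : (0 <= bowen_outer T E t n e)%E.
Proof.
apply: le_ereal_inf_tmp => _ [C _ <-]; apply: esum_ge0 => p _.
by rewrite lee_fin powR_ge0.
Qed.

Lemma bowen_outer_homo E F t m n e e' : E `<=` F -> (m <= n)%N -> e' <= e ->
  (bowen_outer T E t m e <= bowen_outer T F t n e')%E.
Proof.
move=> EF mn ee; apply: ereal_inf_le_tmp => _ [C [cC Cn FC] <-]; exists C => //.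
split => // [p /Cn|x /EF/FC[p Cp xp]]; first exact: leq_trans.
by exists p => // j jn; exact: le_trans (xp j jn) ee.
Qed.

Lemma is_cvg_bowen_outer E t e : cvg ((fun n => bowen_outer T E t n e) @ \oo).
Proof.
by apply: ereal_nondecreasing_is_cvgn => m n mn; exact: bowen_outer_homo.
Qed.

Lemma bowen_measure_homo E F t e e' : E `<=` F -> e' <= e ->
  (bowen_measure T E t e <= bowen_measure T F t e')%E.
Proof.
move=> EF ee; apply: lee_lim; [exact: is_cvg_bowen_outer|exact: is_cvg_bowen_outer|].
by near=> n; exact: bowen_outer_homo.
Unshelve. all: end_near. Qed.

Lemma bowen_measure_ge0 E t e : (0 <= bowen_measure T E t e)%E.
Proof.
apply: lime_ge; first exact: is_cvg_bowen_outer.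
by near=> n; exact: bowen_outer_ge0.
Unshelve. all: end_near. Qed.

Lemma htop_scale_homo E F e e' : E `<=` F -> e' <= e ->
  (htop_scale T E e <= htop_scale T F e')%E.
Proof.
move=> EF ee; apply: ereal_inf_le_tmp => _ [t [t0 tF] <-]; exists t => //; split => //.
by apply/eqP; rewrite eq_le bowen_measure_ge0 andbT -tF bowen_measure_homo.
Qed.

Lemma htopE E : htop T E = ereal_sup [set htop_scale T E e | e in [set e | 0 < e]].
Proof.
apply/cvg_lim => //.
have := @nonincreasing_at_right_cvge R (htop_scale T E) 0 +oo%O isT.
rewrite (_ : [set htop_scale T E x | x in [set` `]0, +oo[]] =
  [set htop_scale T E e | e in [set e | 0 < e]]); last first.
  by apply/seteqP; split => _ [e e0 <-]; exists e => //=; move: e0; rewrite /= in_itv/= andbT.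
by apply=> e e' _ _ ee'; exact: htop_scale_homo.
Qed.

Lemma htop_mono E F : E `<=` F -> (htop T E <= htop T F)%E.
Proof.
move=> EF; rewrite !htopE; apply: ge_ereal_sup => _ [e e0 <-].
apply: le_trans (htop_scale_homo EF (lexx e)) _.
by apply: ereal_sup_ubound; exists e.
Qed.

Lemma htop_ge0 E : (0 <= htop T E)%E.
Proof.
rewrite htopE; apply: le_ereal_sup_tmp; exists (htop_scale T E 1).
  by exists 1 => //=.
by apply: le_ereal_inf_tmp => _ [t [t0 _] <-]; rewrite lee_fin.
Qed.

Lemma lt_htop (c : R) E : (c%:E < htop T E)%E ->
  exists2 e, 0 < e & (c%:E < htop_scale T E e)%E.
Proof. by rewrite htopE => /ereal_sup_gt[_ [e e0 <-] ce]; exists e. Qed.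

Lemma bowen_outer_finite E t n e (s : seq X) : uniq s ->
  E `<=` \bigcup_(x in [set` s]) bowen_ball T n x e ->
  (bowen_outer T E t n e <= ((size s)%:R * 2 `^ (- (t * n%:R)))%:E)%E.
Proof.
move=> us Es; apply: ereal_inf_lbound.
exists [set` [seq (x, n) | x <- s]].
  split; first by apply: finite_set_countable; exact: finite_seq.
  - by move=> p /= /mapP[x _ ->].
  - move=> x /Es[y ys xy]; exists (y, n) => //=.
    by rewrite map_f.
rewrite esum_fset; last 2 first.
- exact: finite_seq.
- by move=> p _; rewrite lee_fin powR_ge0.
rewrite -fsbig_seq; last by rewrite map_inj_uniq// => x y [].
rewrite big_map /= sumEFin big_const_seq count_predT; congr EFin.
by rewrite iter_addr_0 mulr_natl.
Qed.

(** Below the critical exponent the Bowen measure is positive, hence [bowen_outer] is at least some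
    [d > 0] from some length on. Covers by balls of one common length [n] compete in that infimum,
    and each ball weighs 2^(-c n). *)
Lemma htop_scale_cover (c : R) E e : 0 <= c -> (c%:E < htop_scale T E e)%E ->
  exists2 d, 0 < d & \forall n \near \oo, forall s : seq X, uniq s ->
    E `<=` \bigcup_(x in [set` s]) bowen_ball T n x e ->
    d * 2 `^ (c * n%:R) <= (size s)%:R.
Proof.
move=> c0 cE.
have m0 : (0 < bowen_measure T E c e)%E.
  rewrite lt_neqAle bowen_measure_ge0 andbT; apply/eqP => m0.
  have : (htop_scale T E e <= c%:E)%E by apply: ereal_inf_lbound; exists c.
  by rewrite leNgt cE.
have [N NE] : exists N, (0 < bowen_outer T E c N e)%E.
  apply: contrapT => h; move: m0; rewrite ltNge => /negP; apply.
  apply: lime_le; first exact: is_cvg_bowen_outer.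
  near=> n; rewrite leNgt; apply/negP => n0; apply: h; by exists n.
have [d d0 dN] : exists2 d : R, 0 < d & (d%:E <= bowen_outer T E c N e)%E.
  move: NE; case: (bowen_outer T E c N e) => [r|_|//].
    by rewrite lte_fin => r0; exists r.
  by exists 1 => //; rewrite leey.
exists d => //; near=> n => s us Es.
have Nn : (N <= n)%N by near: n; exact: nbhs_infty_ge.
have := le_trans (le_trans dN (bowen_outer_homo c (@subset_refl _ E) Nn (lexx e)))
  (bowen_outer_finite c us Es).
rewrite lee_fin => h.
have p0 : 0 < 2 `^ (c * n%:R) :> R by rewrite powR_gt0.
by move: h; rewrite powRN ler_pdivlMr.
Unshelve. all: end_near. Qed.

End bowen_entropy.

(** * Counting separated points by entropy *)

Section counting.
Context {R : realType}.

(** By induction on [L]: the points are grouped by their first letter, and those that share it are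
    told apart by the remaining ones. With no letter left there is at most one point. *)
Lemma kraft (A : finType) (Y : eqType) (f : nat -> Y -> A) (p : nat -> A -> R)
    (L : seq nat) (s : seq Y) : uniq s ->
  (forall i a, 0 <= p i a) -> (forall i, \sum_a p i a <= 1) ->
  (forall x y, x \in s -> y \in s -> (forall i, i \in L -> f i x = f i y) -> x = y) ->
  \sum_(x <- s) \prod_(i <- L) p i (f i x) <= 1.
Proof.
move=> + p0 p1; elim: L s => [|i L IH] s us inj.
  under eq_bigr do rewrite big_nil.
  case: s us inj => [|x [|y s]]; rewrite ?big_nil ?big_seq1 ?ler01// => /andP[+ _] inj.
  by rewrite (inj x y) ?inE ?eqxx ?orbT.
rewrite (partition_big (f i) predT)//=.
apply: le_trans (p1 i); apply: ler_sum => a _.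
rewrite (eq_bigr (fun x => p i a * \prod_(j <- L) p j (f j x))); last first.
  by move=> x /eqP <-; rewrite big_cons.
rewrite -mulr_sumr -[leRHS]mulr1 ler_wpM2l//.
rewrite -big_filter; apply: IH; first exact: filter_uniq.
move=> x y; rewrite !mem_filter => /andP[/eqP xa xs] /andP[/eqP ya ys] h.
apply: inj => // j; rewrite inE => /predU1P[->|/h//].
by rewrite xa ya.
Qed.

Context {X : pointedMetricType R}.
Variable T : X -> X.

(* Misiurewicz's estimate for the uniform measure on the orbits of a separated set: cut the
   itineraries into blocks of length q along each residue class modulo q, bound the product
   of the probabilities of the blocks by [kraft], and sum over the residue classes. *)
Lemma separated_counting (A : finType) (c : X -> A) (n q : nat) (s : seq X) (mu : borelProb X) :
  (0 < n)%N -> (0 < q)%N -> (0 < size s)%N -> uniq s ->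
  {in s &, injective (itinerary T c n)} ->
  (forall u : {ffun 'I_q -> A}, pr mu [set x | itinerary T c q x = u] =
    ((size s)%:R * n%:R)^-1 *
    \sum_(x <- s) \sum_(0 <= j < n) (itinerary T c q (iter j T x) == u)%:R) ->
  q%:R * ln (size s)%:R <=
    q%:R * (q%:R * ln (#|A|%:R)) + n%:R * entropy mu (itinerary T c q).
Proof.
move=> n0 q0 s0 us inj muE.
pose N : R := (size s)%:R; have N0 : 0 < N by rewrite ltr0n.
have n0' : 0 < n%:R :> R by rewrite ltr0n.
pose b j x := itinerary T c q (iter j T x).
pose p u := pr mu [set x | itinerary T c q x = u].
have A0 : (0 < #|A|)%N.
  by case: s s0 {us inj muE N N0} => // x s _; apply/card_gt0P; exists (c x).
have p0 u : 0 <= p u by exact: pr_ge0.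
have sump (g : {ffun 'I_q -> A} -> R) :
    \sum_u p u * g u = (N * n%:R)^-1 * \sum_(x <- s) \sum_(0 <= j < n) g (b j x).
  under eq_bigr do rewrite /p muE -mulrA mulr_suml.
  rewrite -mulr_sumr; congr (_ * _); rewrite exchange_big/=; apply: eq_bigr => x _.
  under eq_bigr do rewrite mulr_suml.
  rewrite exchange_big/=; apply: eq_bigr => j _.
  rewrite (bigD1 (b j x))//= /b eqxx mul1r big1 ?addr0// => u ub.
  by rewrite eq_sym (negbTE ub) mul0r.
have p1 : \sum_u p u = 1.
  have := sump (fun=> 1); under eq_bigr do rewrite mulr1.
  move=> ->; under eq_bigr do rewrite big_const_nat iter_addr_0 subn0.
  rewrite big_const_seq count_predT iter_addr_0 -[n%:R *+ _]mulr_natl.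
  by rewrite mulVf// mulf_neq0// gt_eqF.
have pb x j : x \in s -> (j < n)%N -> 0 < p (b j x).
  move=> xs jn; rewrite /p muE mulr_gt0 ?invr_gt0 ?mulr_gt0//.
  rewrite (big_rem x)//= (big_rem j) ?mem_index_iota//= /b eqxx.
  rewrite -addrA ltr_wpDr ?ltr01// addr_ge0//.
    by apply: sumr_ge0 => i _; rewrite ler0n.
  by apply: sumr_ge0 => y _; apply: sumr_ge0 => i _; rewrite ler0n.
(* The starting times of the blocks of class [l]. The last block may run past time [n], which is
   harmless: [muE] counts the words of length [q] at every start [j < n]. *)
pose J l := [seq j <- index_iota 0 n | (j %% q == l)%N].
pose k : R := #|{: {ffun 'I_q -> A}}|%:R.
have k0 : 0 < k by rewrite ltr0n card_ffun card_ord expn_gt0 A0.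
have key l : (l < q)%N ->
    N * ln N + \sum_(x <- s) (- ln k + \sum_(j <- J l) ln (p (b j x))) <= 0.
  move=> lq.
  (* Index 0 stands for the word of length [q] read at time 0, weighted uniformly: it covers the
     letters before the first block, at a cost of [ln k]. Index [j.+1] stands for the block that
     starts at [j]. *)
  pose P i u := if i is j.+1 then p u else k^-1.
  pose F i x := b i.-1 x.
  pose L := 0%N :: [seq j.+1 | j <- J l].
  have kr : \sum_(x <- s) \prod_(i <- L) P i (F i x) <= 1.
    apply: kraft => //.
    - by move=> [|i] u //=; rewrite invr_ge0 ltW.
    - by move=> [|i] /=; rewrite ?p1// sumr_const -mulr_natr mulVf// gt_eqF.
    - move=> x y xs ys h; apply: inj => //; apply/ffunP => i; rewrite !ffunE.
      have [iq|qi] := ltnP i q.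
        have /ffunP/(_ (Ordinal iq)) := h 0%N (mem_head _ _).
        by rewrite !ffunE.
      (* The start of the block of class [l] that contains the time [i]. *)
      pose j := (i - (i - l) %% q)%N.
      have il : (l <= i)%N by rewrite ltnW// (leq_trans lq).
      have rq : ((i - l) %% q < q)%N by rewrite ltn_mod.
      have rl : ((i - l) %% q <= i - l)%N by rewrite leq_mod.
      have jE : j = (l + (i - l) %/ q * q)%N.
        by rewrite /j; have := divn_eq (i - l) q; lia.
      have jJ : j \in J l.
        rewrite mem_filter jE addnC modnMDl modn_small// eqxx mem_index_iota /=.
        by have := divn_eq (i - l) q; have := ltn_ord i; lia.
      have ijq : (i - j < q)%N by rewrite /j; lia.
      have ji : (i - j + j = i)%N by rewrite /j; lia.
      have := h j.+1; rewrite inE map_f ?orbT// => /(_ isT)/ffunP/(_ (Ordinal ijq)).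
      by rewrite !ffunE /= -!iterD ji.
  have QE x : \prod_(i <- L) P i (F i x) = k^-1 * \prod_(j <- J l) p (b j x).
    by rewrite big_cons big_map.
  have Q0 x : x \in s -> 0 < \prod_(i <- L) P i (F i x).
    move=> xs; rewrite QE mulr_gt0 ?invr_gt0//.
    rewrite big_seq; apply: prodr_gt0 => j; rewrite mem_filter mem_index_iota => /andP[_ /andP[_ jn]].
    exact: pb.
  have lnQ x : x \in s -> ln (\prod_(i <- L) P i (F i x)) =
      - ln k + \sum_(j <- J l) ln (p (b j x)).
    move=> xs; rewrite QE.
    have H (r : seq nat) : {subset r <= index_iota 0 n} ->
        0 < \prod_(j <- r) p (b j x) /\
        ln (\prod_(j <- r) p (b j x)) = \sum_(j <- r) ln (p (b j x)).
      elim: r => [|j r IHr] sub; first by rewrite !big_nil ln1.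
      have [|pr0 lnr] := IHr; first by move=> i ir; apply: sub; rewrite inE ir orbT.
      have jn : 0 < p (b j x).
        by apply: pb => //; have := sub j (mem_head _ _); rewrite mem_index_iota.
      by rewrite !big_cons mulr_gt0// lnM ?posrE// lnr.
    have [h0 h1] := H (J l) (mem_subseq (filter_subseq _ _)).
    by rewrite lnM ?posrE ?invr_gt0// lnV ?posrE// h1.
  have -> : N * ln N + \sum_(x <- s) (- ln k + \sum_(j <- J l) ln (p (b j x))) =
      \sum_(x <- s) ln (N * \prod_(i <- L) P i (F i x)).
    transitivity (\sum_(x <- s) (ln N + (- ln k + \sum_(j <- J l) ln (p (b j x))))).
      by rewrite [RHS]big_split/= big_const_seq count_predT iter_addr_0 mulr_natl.
    rewrite [LHS]big_seq [RHS]big_seq; apply: eq_bigr => x xs.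
    by rewrite lnM ?posrE ?Q0// lnQ.
  (* The products have total at most 1, so [ln y <= y - 1], at [y] equal to [N] times the product,
     summed over the [N] points gives at most [N - N]. *)
  apply: (@le_trans _ _ (\sum_(x <- s) (N * \prod_(i <- L) P i (F i x) - 1))).
    rewrite big_seq [leRHS]big_seq; apply: ler_sum => x xs.
    by apply: ln_le_sub1; rewrite mulr_gt0// Q0.
  rewrite sumrB -mulr_sumr big_const_seq count_predT iter_addr_0 -/N.
  by rewrite subr_le0 -[leRHS]mulr1 ler_pM2l.
have total : \sum_(0 <= l < q) (N * ln N + \sum_(x <- s) (- ln k + \sum_(j <- J l) ln (p (b j x)))) <= 0.
  rewrite big_nat; apply: sumr_le0 => l /andP[_ lq]; exact: key.
move: total; rewrite big_split/= big_const_nat iter_addr_0 subn0 exchange_big/=.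
under eq_bigr do rewrite big_split/= big_const_nat iter_addr_0 subn0.
have blocks x : \sum_(0 <= l < q) \sum_(j <- J l) ln (p (b j x)) = \sum_(0 <= j < n) ln (p (b j x)).
  rewrite big_mkord; under eq_bigr do rewrite big_filter.
  rewrite [RHS](partition_big (fun j => Ordinal (ltn_pmod j q0)) predT)//=.
under eq_bigr do rewrite blocks.
rewrite big_split/= big_const_seq count_predT iter_addr_0.
have -> : \sum_(x <- s) \sum_(0 <= j < n) ln (p (b j x)) = - (N * n%:R * entropy mu (itinerary T c q)).
  have := sump (fun u => ln (p u)); rewrite /entropy -/(p _) => ->.
  by rewrite mulrN opprK mulVKf// mulf_neq0// gt_eqF.
have -> : ln k = q%:R * ln #|A|%:R.
  by rewrite /k card_ffun card_ord natrX lnXn ?ltr0n// mulr_natl.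
rewrite -mulr_natl -[X in _ + (X + _)]mulr_natl -/N -[(- _) *+ q]mulr_natl => h.
rewrite -(ler_pM2l N0); move: h; lra.
Qed.

End counting.

Section xlnx.
Context {R : realType}.

(** Apply [ln_le_sub1] to the inverse of the square root of [y]. The bound gives the continuity of
    [y * ln y] at 0; for negative [y] the convention [ln y = 0] makes the product 0. *)
Lemma xlnx_bound (y : R) : y <= 1 -> `|y * ln y| <= 2 * Num.sqrt `|y|.
Proof.
move=> y1; have [y0|y0] := leP y 0; first by rewrite ln0// mulr0 normr0 mulr_ge0.
have s0 : 0 < Num.sqrt y by rewrite sqrtr_gt0.
rewrite (gtr0_norm y0) ler0_norm; last by rewrite mulr_ge0_le0 ?(ltW y0)// ln_le0.
have : ln (Num.sqrt y)^-1 <= (Num.sqrt y)^-1.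
  by apply: le_trans (ln_le_sub1 _) _; rewrite ?invr_gt0// lerBlDr lerDl.
rewrite lnV ?posrE// => h.
have ly : ln y = 2 * ln (Num.sqrt y).
  by rewrite -{1}(sqr_sqrtr (ltW y0)) lnXn// mulr_natl.
rewrite ly; have : y * - ln (Num.sqrt y) <= y * (Num.sqrt y)^-1 by rewrite ler_pM2l.
rewrite -{3}(sqr_sqrtr (ltW y0)) expr2 mulfK ?gt_eqF//; lra.
Qed.

Lemma continuous_xlnx : continuous (fun y : R => y * ln y).
Proof.
move=> x; have [x0|x0|->] := ltrgtP x 0.
- rewrite /continuous_at ln0 ?ltW// mulr0; apply: cvg_near_cst.
  have : \forall y \near x, y < 0 by apply: open_nbhs_nbhs; split; [exact: open_lt|].
  by apply: filterS => y y0; rewrite ln0 ?ltW// mulr0.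
- by apply: cvgM; [exact: cvg_id|exact: continuous_ln].
- rewrite /continuous_at mul0r; apply/cvgr0Pnorm_le => e e0.
  have n1 := @nbhs0_le R R 1 ltr01.
  have e2 : 0 < (e / 2) ^+ 2 by rewrite exprn_gt0// divr_gt0.
  have n2 := @nbhs0_le R R _ e2.
  near=> y; have y1 : `|y| <= 1 by near: y.
  apply: le_trans (xlnx_bound _) _; first exact: le_trans (ler_norm _) y1.
  have ye : `|y| <= (e / 2) ^+ 2 by near: y.
  have e20 : 0 <= e / 2 by rewrite divr_ge0 ?ltW.
  have : Num.sqrt `|y| <= e / 2.
    apply: (@le_trans _ _ (Num.sqrt ((e / 2) ^+ 2))); last by rewrite sqrtr_sqr ger0_norm.
    by rewrite ler_sqrt// sqr_ge0.
  lra.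
Unshelve. all: end_near. Qed.

End xlnx.

Lemma in_big_setI (I : finType) (Y : Type) (D : I -> set Y) (x : Y) :
  (\big[setI/setT]_i D i) x <-> forall i, D i x.
Proof.
split => [h i|h]; first by move: h; rewrite (bigD1 i)//= => -[].
by apply: (big_ind (fun S : set Y => S x)) => // A B Ax Bx; split.
Qed.

Lemma cvg_sumr {R : realType} (Y I : Type) (F : set_system Y) {FF : Filter F} (s : seq I)
    (u : I -> Y -> R) (l : I -> R) : (forall i, u i y @[y --> F] --> l i) ->
  \sum_(i <- s) u i y @[y --> F] --> \sum_(i <- s) l i.
Proof.
move=> ul; elim: s => [|i s IH].
  by rewrite big_nil; under eq_fun do rewrite big_nil; exact: cvg_cst.
by rewrite big_cons; under eq_fun do rewrite big_cons; exact: cvgD.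
Qed.

Lemma open_mball {R : realType} {X : pointedMetricType R} (x : X) (r : R) : open (ball x r).
Proof.
have cd : continuous (fun y => mdist x y).
  apply: lipschitz_continuous => y z.
  by rewrite (le_trans (metric_triangle x z y))// lerD2l metric_sym.
rewrite (_ : ball x r = (fun y => mdist x y) @^-1` [set z | z < r]).
  by apply: open_comp => [y _|]; [exact: cd|exact: open_lt].
by apply/seteqP; split => y; rewrite ball_mdist.
Qed.

(** * Continuity sets and partitions of small diameter *)

Section jordan_sets.
Context {R : realType} {X : pointedMetricType R}.
Hypothesis cX : compact [set: X].
Implicit Types (mu nu : borelProb X) (f g : X -> R) (A B C U : set X).

(* A set satisfying [jordan mu] is a continuity set of [mu]; see [cvg_pr_jordan]. *)
Definition jordan mu A := forall e, 0 < e -> exists f g,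
  [/\ continuous f, continuous g,
      forall x, [/\ 0 <= f x, f x <= \1_A x, \1_A x <= g x & g x <= 1] &
      integ mu g <= integ mu f + e].

Lemma jordanT mu : jordan mu setT.
Proof.
move=> e e0; exists (fun=> 1), (fun=> 1); split; try exact: cont_cst.
  by move=> x; rewrite indicE in_setT lexx ler01.
by rewrite lerDl ltW.
Qed.

Lemma jordanC mu A : jordan mu A -> jordan mu (~` A).
Proof.
move=> jA e e0; have [f [g [cf cg fAg gf]]] := jA e e0.
exists (fun x => 1 - g x), (fun x => 1 - f x); split.
- by apply: contB => //; exact: cont_cst.
- by apply: contB => //; exact: cont_cst.
- move=> x; have [f0 fA Ag g1] := fAg x; have -> : \1_(~` A) x = 1 - \1_A x :> R.
    by rewrite !indicE in_setC; case: (x \in A); rewrite /= ?subrr ?subr0.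
  split; lra.
- rewrite !integB; [|exact: bm_cst|exact: bm_continuous|exact: bm_cst|exact: bm_continuous].
  by rewrite integ_cst; lra.
Qed.

Lemma jordanI mu A B : jordan mu A -> jordan mu B -> jordan mu (A `&` B).
Proof.
move=> jA jB e e0; have e20 : 0 < e / 2 by rewrite divr_gt0.
have [f1 [g1 [cf1 cg1 fAg1 gf1]]] := jA _ e20.
have [f2 [g2 [cf2 cg2 fAg2 gf2]]] := jB _ e20.
exists (fun x => f1 x * f2 x), (fun x => g1 x * g2 x).
have I x : \1_(A `&` B) x = \1_A x * \1_B x :> R.
  by rewrite !indicE in_setI; case: (x \in A); case: (x \in B); rewrite /= ?mulr1 ?mulr0.
split; [exact: contM|exact: contM| |].
  move=> x; have [a b c d] := fAg1 x; have [a' b' c' d'] := fAg2 x.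
  have i0 : 0 <= \1_A x :> R by rewrite indicE ler0n.
  have i0' : 0 <= \1_B x :> R by rewrite indicE ler0n.
  rewrite I mulr_ge0//; split => //.
  - exact: ler_pM.
  - exact: ler_pM.
  - by rewrite mulr_ile1//; [exact: le_trans c|exact: le_trans c'].
have bf1 := bm_continuous cX cf1; have bf2 := bm_continuous cX cf2.
have bg1 := bm_continuous cX cg1; have bg2 := bm_continuous cX cg2.
have bf := bm_continuous cX (contM cf1 cf2); have bg := bm_continuous cX (contM cg1 cg2).
(* From [g1 g2 - f1 f2 = g1 (g2 - f2) + f2 (g1 - f1)], where [g1] and [f2] are at most 1. *)
have : integ mu (fun x => g1 x * g2 x) <=
    integ mu (fun x => f1 x * f2 x + ((g1 x - f1 x) + (g2 x - f2 x))).
  apply: le_integ => //; first by apply: bmD => //; apply: bmD; exact: bmB.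
  move=> x; have [a b c d] := fAg1 x; have [a' b' c' d'] := fAg2 x.
  have h1 : 0 <= (1 - g1 x) * (g2 x - f2 x) by rewrite mulr_ge0//; lra.
  have h2 : 0 <= (1 - f2 x) * (g1 x - f1 x) by rewrite mulr_ge0//; lra.
  lra.
rewrite integD//; last by apply: bmD; exact: bmB.
by rewrite integD; [|exact: bmB|exact: bmB]; rewrite !integB//; lra.
Qed.

(** A tent around [C] bounds the indicator of [U] from above, and 1 minus a tent around the
    complement of [U] bounds it from below; both integrals are close to the measure of [U]. *)
Lemma jordan_sandwich mu U C : open U -> closed C -> U `<=` C ->
  pr mu C <= pr mu U -> jordan mu U.
Proof.
move=> oU cC UC CU e e0; have e20 : 0 < e / 2 by rewrite divr_gt0.
have cU : closed (~` U) by exact: open_closedC.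
have [d d0 hd] := closed_outer_approx mu cC e20.
have [d' d'0 hd'] := closed_outer_approx mu cU e20.
exists (fun x => 1 - tent (~` U) d' x), (tent C d).
have ct := @continuous_tent R X (~` U) d'.
split.
- by apply: contB => //; exact: cont_cst.
- exact: continuous_tent.
- move=> x; have /andP[a b] := tent01 (~` U) x d'0; have /andP[a' b'] := tent01 C x d0.
  rewrite indicE; have [xU|xU] := pselect (U x).
    rewrite mem_set//= (tent_in d (UC _ xU)); split; lra.
  by rewrite memNset//= (@tent_in _ _ (~` U))// subrr; split.
- rewrite (integB mu (bm_cst 1) (bm_continuous cX ct)).
  have h1 := le_trans (integ_tent cX mu C d0) hd.
  have h2 := le_trans (integ_tent cX mu (~` U) d'0) hd'.
  rewrite prC in h2; last exact: borel_open.
  by rewrite integ_cst; lra.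
Qed.

Lemma cvg_pr_jordan mu A : measurable (A : set (borel X)) -> jordan mu A ->
  pr nu A @[nu --> mu] --> pr mu A.
Proof.
move=> mA jA; have FF : Filter (nbhs mu) by exact: nbhs_filter.
apply/cvgrPdist_le => e e0; have e20 : 0 < e / 2 by rewrite divr_gt0.
have [f [g [cf cg fAg gf]]] := jA _ e20.
have bf := bm_continuous cX cf; have bg := bm_continuous cX cg.
have fA nu : integ nu f <= pr nu A.
  by rewrite -integ_indic//; apply: le_integ => //; [exact: bm_indic|move=> x; case: (fAg x)].
have Ag nu : pr nu A <= integ nu g.
  by rewrite -integ_indic//; apply: le_integ => //; [exact: bm_indic|move=> x; case: (fAg x)].
have := @continuous_integ R X f cf mu => /cvgrPdist_le /(_ _ e20) hf.
have := @continuous_integ R X g cg mu => /cvgrPdist_le /(_ _ e20) hg.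
near=> nu.
have h1 : `|integ mu f - integ nu f| <= e / 2 by near: nu.
have h2 : `|integ mu g - integ nu g| <= e / 2 by near: nu.
move: h1 h2; rewrite !ler_norml => /andP[a b] /andP[c d].
have := fA mu; have := fA nu; have := Ag mu; have := Ag nu.
by move=> ? ? ? ?; apply/andP; split; lra.
Unshelve. all: end_near. Qed.

Lemma cvg_entropy_jordan mu (A : finType) (c : X -> A) : measurable_code c ->
  (forall a, jordan mu [set x | c x = a]) ->
  entropy nu c @[nu --> mu] --> entropy mu c.
Proof.
move=> mc jc; have FF : Filter (nbhs mu) by exact: nbhs_filter.
apply: cvgN; apply: cvg_sumr => a.
apply: (@cvg_comp _ _ _ (fun nu => pr nu [set x | c x = a]) (fun y => y * ln y)).
  exact: cvg_pr_jordan.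
exact: continuous_xlnx.
Qed.

(* All but countably many of the spheres around [x] are [mu]-null. *)
Lemma jordan_ball mu x e : 0 < e -> exists r, [/\ 0 < r, r < e & jordan mu (ball x r)].
Proof.
move=> e0.
have cd : continuous (fun y => mdist x y).
  apply: lipschitz_continuous => y z.
  by rewrite (le_trans (metric_triangle x z y))// lerD2l metric_sym.
pose S r := [set y | mdist x y = r].
have cS r : closed (S r).
  rewrite /S (_ : [set y | _] = (fun y => mdist x y) @^-1` [set r]); last by [].
  by apply: closed_comp => //; exact: closed_eq.
have mS r : measurable (S r : set (borel X)) by exact: borel_closed.
pose big n := [set r | n.+1%:R^-1 < pr mu (S r)].
have fbig n : finite_set (big n).
  (* The spheres are disjoint, and [n.+2] of them with measure above [n.+1%:R^-1] would have total
     measure above 1. *)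
  apply: contrapT => /(infinite_set_fset n.+2)[B Bn cB].
  have : integ mu (fun y => \sum_(r <- B) \1_(S r) y) <= 1.
    apply: integ_le_cst; first by apply: bm_sum => r; exact: bm_indic.
    move=> y; have [yB|yB] := boolP (mdist x y \in enum_fset B).
      rewrite (bigD1_seq (mdist x y)) ?fset_uniq//= [X in _ + X]big1 ?addr0; last first.
        by move=> r ry; rewrite indicE memNset// => h; move: ry; rewrite -h eqxx.
      by rewrite indicE; case: (_ \in _).
    rewrite big_seq big1// => r rB; rewrite indicE memNset// => h.
    by move: yB; rewrite h rB.
  rewrite integ_sum; last by move=> r; exact: bm_indic.
  apply/negP; rewrite -ltNge.
  apply: (@lt_le_trans _ _ (\sum_(r <- B) n.+1%:R^-1)).
    by rewrite big_const_seq count_predT iter_addr_0 -[_ *+ size _]mulr_natl ltr_pdivlMr// mul1r ltr_nat.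
  rewrite big_seq [leRHS]big_seq; apply: ler_sum => r rB.
  by rewrite integ_indic// ltW//; exact: (Bn r rB).
have cbig : countable (\bigcup_n big n).
  by apply: bigcup_countable => // n _; exact: finite_set_countable.
have [r [r0 re nr]] : exists r, [/\ 0 < r, r < e & ~ (\bigcup_n big n) r].
  apply: contrapT => h.
  have sub : `]0, e[ `<=` \bigcup_n big n.
    move=> r /=; rewrite in_itv/= => /andP[r0 re]; apply: contrapT => nr.
    by apply: h; exists r.
  have := countable_lebesgue_measure0 (sub_countable (subset_card_le sub) cbig).
  rewrite lebesgue_measure_itv/= lte_fin e0 -EFinB subr0 => -[e1].
  by move: e0; rewrite e1 ltxx.
exists r; split => //.
have S0 : pr mu (S r) = 0.
  apply/eqP; rewrite eq_le pr_ge0 andbT leNgt; apply/negP => s0; apply: nr.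
  exists (Num.truncn (pr mu (S r))^-1) => //=.
  by rewrite /big /= invf_plt ?posrE// truncnS_gt.
have cC : closed [set y | mdist x y <= r].
  rewrite (_ : [set y | _] = (fun y => mdist x y) @^-1` [set z | z <= r]); last by [].
  by apply: closed_comp => //; exact: closed_le.
have oB := @open_mball R X x r.
apply: (jordan_sandwich (C := [set y | mdist x y <= r])) => //.
  by move=> y; rewrite ball_mdist => /ltW.
have -> : [set y | mdist x y <= r] = ball x r `|` S r.
  apply/seteqP; split => y /=.
    by rewrite le_eqVlt => /predU1P[h|h]; [right|left; rewrite ball_mdist].
  by rewrite ball_mdist => -[/ltW//|->].
rewrite prU ?S0 ?addr0//; first exact: borel_open.
by apply/seteqP; split => // y []; rewrite ball_mdist /S /= => + h; rewrite h ltxx.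
Qed.

Lemma finite_ball_cover (r : X -> R) : (forall x, 0 < r x) ->
  exists s : seq X, forall y, exists2 x, x \in s & ball x (r x) y.
Proof.
move=> r0.
have := cX; rewrite compact_cover => /(_ X setT (fun x => (ball x (r x))°)) [].
- by move=> x _; exact: open_interior.
- by move=> x _; exists x => //; apply: nbhsx_ballx.
- move=> D _ Dc; exists (enum_fset D) => y.
  have [x xD xy] := Dc y I.
  by exists x => //; exact: (interior_subset xy).
Qed.

(** The code records which balls of a finite cover contain the point; the balls are continuity sets
    of radius below [e / 2]. Points with the same code share a ball. *)
Lemma jordan_code mu e : 0 < e -> exists (A : finType) (c : X -> A),
  [/\ measurable_code c, forall a, jordan mu [set x | c x = a] &
      forall x y, c x = c y -> mdist x y <= e].
Proof.
move=> e0; have e20 : 0 < e / 2 by rewrite divr_gt0.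
have /choice[r rP] := fun x => jordan_ball mu x e20.
have [|s sP] := @finite_ball_cover r; first by move=> x; case: (rP x).
pose n := size s; pose B (i : 'I_n) := ball (nth point s i) (r (nth point s i)).
pose c x : {ffun 'I_n -> bool} := [ffun i => `[< B i x >]].
have fib (a : {ffun 'I_n -> bool}) :
    [set x | c x = a] = \big[setI/setT]_(i < n) (if a i then B i else ~` B i).
  apply/seteqP; split => x; rewrite in_big_setI /= => h.
    by move=> i; rewrite -h ffunE; case: asboolP.
  apply/ffunP => i; rewrite ffunE; have := h i; case: (a i) => [/asboolT//|].
  by move=> /asboolF.
exists {ffun 'I_n -> bool}, c; split.
- move=> a; rewrite fib; apply: bigsetI_measurable => i _.
  have mB : measurable (B i : set (borel X)).
    by apply: borel_open; exact: open_mball.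
  by case: (a i) => //; exact: (@measurableC _ (borel X)).
- move=> a; rewrite fib; apply: big_ind; [exact: jordanT|exact: jordanI|].
  move=> i _; have [_ _ jB] := rP (nth point s i).
  by case: (a i) => //; exact: jordanC.
- move=> x y cxy; have [z zs zx] := sP x.
  have iz : (index z s < n)%N by rewrite index_mem.
  have /ffunP/(_ (Ordinal iz)) := cxy; rewrite !ffunE /B /= nth_index//.
  rewrite (asboolT zx) => /esym/asboolP zy.
  have [_ rz _] := rP z.
  move: zx zy; rewrite !ball_mdist => zx zy.
  rewrite (le_trans (metric_triangle x z y))// (metric_sym x z).
  by move: zx zy rz; lra.
Qed.

End jordan_sets.

(** Lets inequalities pass to a cluster point without extracting a subsequence: for arbitrarily
    large [n], [Phi (m n)] is close to [Phi y], while [u n] stays close to [l]. *)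
Lemma cluster_continuous_ge {R : realType} (Y : topologicalType) (m : nat -> Y) (y : Y)
    (Phi : Y -> R) (u : nat -> R) (l : R) :
  cluster (m @ \oo) y -> Phi z @[z --> y] --> Phi y -> u @ \oo --> l ->
  (\forall n \near \oo, u n <= Phi (m n)) -> l <= Phi y.
Proof.
move=> my Py ul um; apply/ler_addgt0Pr => e e0.
have e20 : 0 < e / 2 by rewrite divr_gt0.
have near_y : nbhs y [set z | `|Phi y - Phi z| <= e / 2] by move/cvgrPdist_le : Py; exact.
have near_n : (m @ \oo) [set z | exists n, z = m n /\ u n <= Phi (m n) /\ `|l - u n| <= e / 2].
  have h : \forall n \near \oo, `|l - u n| <= e / 2 by move/cvgrPdist_le : ul; exact.
  suff : \forall n \near \oo, [set z | exists n, z = m n /\ u n <= Phi (m n) /\ `|l - u n| <= e / 2] (m n) by [].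
  by apply: filterS2 um h => n h1 h2; exists n.
have [z [[n [-> [h1 h2]]] /= h3]] := my _ _ near_n near_y.
move: h2 h3; rewrite !ler_norml => /andP[_ h2] /andP[h3 h4].
lra.
Qed.

Lemma cvg_invn {R : realType} : (n%:R^-1 : R) @[n --> \oo] --> 0.
Proof. by rewrite -cvg_shiftS; exact: cvg_harmonic. Qed.

Section variational_principle.
Context {R : realType} {X : pointedMetricType R}.
Hypothesis cX : compact [set: X].
Variable T : X -> X.
Hypothesis cT : continuous T.
Implicit Types (mu nu : borelProb X).

Lemma exists_orbit_average (s : seq X) n : (0 < size s)%N -> (0 < n)%N ->
  exists mu : borelProb X,
    (forall A, measurable (A : set (borel X)) -> pr mu A =
      ((size s)%:R * n%:R)^-1 * \sum_(x <- s) \sum_(0 <= j < n) \1_A (iter j T x)) /\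
    (forall f, bounded_measurable f -> integ mu f =
      ((size s)%:R * n%:R)^-1 * \sum_(x <- s) \sum_(0 <= j < n) f (iter j T x)).
Proof.
(* [empirical] at index [n] averages over [n.+1] points, hence the shift. *)
move=> s0; case: n => // n _.
have N0 : 0 < (size s)%:R :> R by rewrite ltr0n.
pose w (i : nat) : R := (size s)%:R^-1.
pose m i := empirical T (nth point s i) n.
have w0 i : 0 <= w i by rewrite invr_ge0 ltW.
have w1 : \sum_(i < size s) w i = 1.
  by rewrite /w sumr_const card_ord -[_ *+ size _]mulr_natl mulfV// gt_eqF.
have [mu muE] := exists_mixture m w0 w1.
have sumE (F : X -> R) : \sum_(i < size s) w i *
    (n.+1%:R^-1 * \sum_(j < n.+1) F (iter j T (nth point s i))) =
    ((size s)%:R * n.+1%:R)^-1 * \sum_(x <- s) \sum_(0 <= j < n.+1) F (iter j T x).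
  rewrite -mulr_sumr -mulr_sumr mulrA invfM; congr (_ * _).
  rewrite (big_nth point) big_mkord; apply: eq_bigr => i _.
  by rewrite big_mkord.
exists mu; split => [A mA|f bf].
  rewrite muE// -(sumE (\1_A)); apply: eq_bigr => i _.
  by rewrite pr_empirical.
rewrite (integ_mixture w0 muE bf) -sumE; apply: eq_bigr => i _.
by rewrite integ_empirical.
Qed.

(** By invariance, composing the two approximations with [iter n T] does not change their
    integrals. *)
Lemma jordan_iter mu n A : invariant_measures T mu -> jordan mu A ->
  jordan mu (iter n T @^-1` A).
Proof.
move=> /(invariant_integ cX _ cT) imu jA e e0.
have cTn (f : X -> R) k : continuous f -> continuous (f \o iter k T).
  move=> cf x; apply: (@continuous_comp _ _ _ (iter k T) f); last exact: cf.
  exact: continuous_iter.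
have In f : continuous f -> integ mu (f \o iter n T) = integ mu f.
  move=> cf; elim: n => [//|k IH]; rewrite -IH -[RHS]imu; last exact: cTn.
  by congr integ; apply/funext => x /=; rewrite -iterSr.
have [f [g [cf cg fAg gf]]] := jA e e0.
exists (f \o iter n T), (g \o iter n T); split; [exact: cTn|exact: cTn| |].
  by move=> x; have := fAg (iter n T x).
by rewrite !In.
Qed.

Definition separated (La : set X) n (e : R) (s : seq X) :=
  [/\ uniq s, forall x, x \in s -> La x &
      forall x y, x \in s -> y \in s -> x != y ->
        exists2 j, (j < n)%N & e < mdist (iter j T x) (iter j T y)].

Lemma separated_itinerary (A : finType) (c : X -> A) La n e s :
  (forall x y, c x = c y -> mdist x y <= e) -> separated La n e s ->
  {in s &, injective (itinerary T c n)}.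
Proof.
move=> ce [us sL sep] x y xs ys xy; apply/eqP; apply: contrapT => /negP nxy.
have [j jn] := sep x y xs ys nxy; rewrite ltNge => /negP; apply.
apply: ce; have /ffunP/(_ (Ordinal jn)) := xy.
by rewrite !ffunE.
Qed.

(** Points of a separated set have distinct itineraries for a code with cells of diameter at most
    [e], which bounds the size. At maximal size no point of [La] can be added, so the balls around
    the set cover [La]. *)
Lemma exists_maximal_separated La n e : 0 < e -> exists s, separated La n e s /\
  La `<=` \bigcup_(x in [set` s]) bowen_ball T n x e.
Proof.
move=> e0.
(* The measure is arbitrary here: of the code only its finiteness and the diameter of its cells
   matter. *)
have [mu0 _] := exists_orbit_average (s := [:: point]) (n := 1) isT isT.
have [A [c [_ _ ce]]] := jordan_code cX mu0 e0.
pose P k := `[< exists s, separated La n e s /\ size s = k >].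
have exP : exists k, P k by exists 0%N; apply/asboolP; exists [::]; split.
have bP k : P k -> (k <= #|{: {ffun 'I_n -> A}}|)%N.
  move/asboolP => [s [sep <-]]; have [us _ _] := sep.
  rewrite -(size_map (itinerary T c n)).
  have um : uniq (map (itinerary T c n) s).
    by rewrite map_inj_in_uniq//; exact: separated_itinerary ce sep.
  by rewrite -(card_uniqP um) max_card.
case: (ex_maxnP exP bP) => k /asboolP[s [sep sk]] kmax.
exists s; split => // x Lx; apply: contrapT => nx.
have [us sL sd] := sep.
have far y : y \in s -> exists2 j, (j < n)%N & e < mdist (iter j T y) (iter j T x).
  move=> ys; apply: contrapT => h; apply: nx; exists y => // j jn.
  by rewrite leNgt; apply/negP => h'; apply: h; exists j.
have xs : x \notin s.
  by apply/negP => /far[j _]; rewrite mdistxx ltNge ltW.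
suff : P k.+1 by move=> /kmax; rewrite ltnn.
apply/asboolP; exists (x :: s); split; last by rewrite /= sk.
split => /=.
- by rewrite xs.
- by move=> y; rewrite inE => /predU1P[->//|/sL].
- move=> y z; rewrite !inE => /predU1P[->|ys] /predU1P[->|zs] yz.
  + by rewrite eqxx in yz.
  + by have [j jn h] := far z zs; exists j => //; rewrite metric_sym.
  + exact: far.
  + exact: sd.
Qed.

Lemma iter_stable (La : set X) n x : T @` La `<=` La -> La x -> La (iter n T x).
Proof. by move=> TL Lx; elim: n => //= n IH; apply: TL; exists (iter n T x). Qed.

(** The function [cdist La] is bounded below near any point outside [La], so a support point there
    would make the integral positive. Such an inequality on an integral survives weak* limits. *)
Lemma integ_cdist_support (La : set X) mu : closed La -> integ mu (cdist La) <= 0 ->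
  msupport mu `<=` La.
Proof.
move=> cL I0 x Sx; apply: contrapT => nLx.
have d0 := cdist_gt0 cL nLx; set d := cdist La x / 2.
have d20 : 0 < d by rewrite divr_gt0.
pose V := [set y | d < cdist La y].
have oV : open V by exact: (strict_superlevel_open d (@continuous_cdist R X La)).
have Vx : V x by rewrite /V /= /d; lra.
have := Sx V oV Vx; rewrite prE lte_fin => pV.
have mV := borel_open oV.
have : d * pr mu V <= integ mu (cdist La).
  rewrite -integ_indic// -integZ; last exact: bm_indic.
  apply: le_integ; [exact/bmZ/bm_indic|exact/bm_continuous/continuous_cdist|].
  move=> y; rewrite indicE; have [yV|yV] := pselect (V y).
    by rewrite mem_set//= mulr1 ltW.
  by rewrite memNset//= mulr0 cdist_ge0.
have : 0 < d * pr mu V by rewrite mulr_gt0.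
lra.
Qed.

(** Common to the averages over one orbit and over separated sets: composition with [T] changes the
    integral by a boundary term of size at most [M * v n]. *)
Lemma cluster_invariant (m : nat -> borelProb X) (v : nat -> R) mu :
  cluster (m @ \oo) mu -> v @ \oo --> 0 ->
  (forall f M, continuous f -> (forall x, `|f x| <= M) ->
    \forall n \near \oo, `|integ (m n) (f \o T) - integ (m n) f| <= M * v n) ->
  invariant_measures T mu.
Proof.
move=> mmu v0 mI; apply/(invariant_integ cX _ cT) => f cf.
have [_ [M fM]] := bm_continuous cX cf.
have cfT : continuous (f \o T).
  by move=> x; apply: (@continuous_comp _ _ _ T f); [exact: cT|exact: cf].
have Mv : - (M * v n) @[n --> \oo] --> (0 : R).
  suff : - (M * v n) @[n --> \oo] --> - (M * 0) by rewrite mulr0 oppr0.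
  by apply: cvgN; apply: cvgM => //; exact: cvg_cst.
have FF : Filter (nbhs mu) by exact: nbhs_filter.
have cvgT := @continuous_integ R X _ cfT mu.
have cvgf := @continuous_integ R X _ cf mu.
apply/eqP; rewrite -subr_eq0 eq_le -oppr_ge0; apply/andP; split.
  apply: (cluster_continuous_ge (Phi := fun nu => - (integ nu (f \o T) - integ nu f)) mmu _ Mv).
    by apply: cvgN; apply: cvgB.
  have := mI f M cf fM; apply: filterS => n.
  by rewrite ler_norml => /andP[_ h]; rewrite lerN2.
apply: (cluster_continuous_ge (Phi := fun nu => integ nu (f \o T) - integ nu f) mmu _ Mv).
  by apply: cvgB.
have := mI f M cf fM; apply: filterS => n.
by rewrite ler_norml => /andP[].
Qed.

(** The measure is a cluster point of the averages over the orbits of length [n] of maximal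
    separated subsets of [La], which have at least d 2^(c n) points by [htop_scale_cover]. *)
Lemma variational_principle (La : set X) (c : R) : closed La -> T @` La `<=` La -> 0 <= c ->
  (c%:E < htop T La)%E ->
  exists mu, [/\ invariant_measures T mu, msupport mu `<=` La & (c%:E <= metric_entropy T mu)%E].
Proof.
move=> cL TL c0 /lt_htop[e e0 /(htop_scale_cover c0)[d d0 hN]].
have [N _ NP] := hN.
have /choice[m mP] : forall n, exists mu, (N < n)%N -> exists s,
    [/\ separated La n e s, d * 2 `^ (c * n%:R) <= (size s)%:R,
      forall A, measurable (A : set (borel X)) -> pr mu A =
      ((size s)%:R * n%:R)^-1 * \sum_(x <- s) \sum_(0 <= j < n) \1_A (iter j T x) &
      forall f, bounded_measurable f -> integ mu f =
      ((size s)%:R * n%:R)^-1 * \sum_(x <- s) \sum_(0 <= j < n) f (iter j T x)].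
  move=> n; have [Nn|nN] := ltnP N n; last first.
    by have [mu _] := exists_orbit_average (s := [:: point]) (n := 1) isT isT; exists mu.
  have [s [sep cov]] := exists_maximal_separated La n e0.
  have [us _ _] := sep.
  have sd := NP n (ltnW Nn) s us cov.
  have s0 : (0 < size s)%N.
    by rewrite -(ltr0n R); apply: lt_le_trans sd; rewrite mulr_gt0 ?powR_gt0.
  have n0 : (0 < n)%N by exact: leq_ltn_trans Nn.
  by have [mu [mu1 mu2]] := exists_orbit_average s0 n0; exists mu => _; exists s.
have [|mu [_ mmu]] := borelProb_compact cX (F := m @ \oo).
  by apply: filterS filterT.
have imu : invariant_measures T mu.
  (* Telescoping leaves two boundary values, each at most [M], divided by [n]. *)
  apply: (@cluster_invariant m (fun n => 2 / n%:R) mu mmu).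
    suff : 2 / n%:R @[n --> \oo] --> (2 * 0 : R) by rewrite mulr0.
    by apply: cvgM; [exact: cvg_cst|exact: cvg_invn].
  move=> f M cf fM; exists N.+1 => // n /= Nn.
  have [s [[us _ _] sd _ mI]] := mP n Nn.
  have n0 : 0 < n%:R :> R by rewrite ltr0n; exact: leq_ltn_trans Nn.
  have s0 : 0 < (size s)%:R :> R.
    by apply: lt_le_trans sd; rewrite mulr_gt0 ?powR_gt0.
  have cfT : continuous (f \o T).
    by move=> x; apply: (@continuous_comp _ _ _ T f); [exact: cT|exact: cf].
  rewrite !mI; [|exact: bm_continuous|exact: bm_continuous].
  rewrite -mulrBr -sumrB normrM gtr0_norm ?invr_gt0 ?mulr_gt0//.
  apply: (@le_trans _ _ (((size s)%:R * n%:R)^-1 * \sum_(x <- s) (2 * M))).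
    rewrite ler_pM2l ?invr_gt0 ?mulr_gt0//.
    apply: le_trans (ler_norm_sum _ _ _) _; apply: ler_sum => x _.
    have -> : \sum_(0 <= j < n) (f \o T) (iter j T x) = \sum_(0 <= j < n) f (iter j.+1 T x).
      by apply: eq_bigr.
    rewrite -sumrB telescope_sumr//.
    rewrite (le_trans (ler_normB _ _))// mulr_natl mulr2n lerD//.
  rewrite big_const_seq count_predT iter_addr_0 -[2 * M *+ _]mulr_natl.
  by rewrite invfM mulrACA mulVf ?gt_eqF// mul1r; lra.
have smu : msupport mu `<=` La.
  apply: integ_cdist_support => //; rewrite -oppr_ge0.
  have FF : Filter (nbhs mu) by exact: nbhs_filter.
  apply: (cluster_continuous_ge (Phi := fun nu => - integ nu (cdist La)) mmu _ (cvg_cst 0)).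
    by apply: cvgN; apply: continuous_integ; exact: continuous_cdist.
  exists N.+1 => // n /= Nn; have [s [[us sL _] _ _ mI]] := mP n Nn.
  rewrite mI; last by apply: bm_continuous => //; exact: continuous_cdist.
  rewrite big_seq big1 ?mulr0 ?oppr0// => x xs; rewrite big1// => j _.
  by apply: cdist0; apply: iter_stable => //; exact: sL.
exists mu; split => //.
(* The code is chosen once the limit [mu] is known, since its cells have to be continuity sets of
   [mu]; the entropy of words of length [q] is then continuous at [mu]. *)
have [A [co [mco jco coe]]] := jordan_code cX mu e0.
apply: le_trans (metric_entropy_ge cT mco imu); rewrite lee_fin ler_pdivlMr ?ln2_gt0//.
apply: entropy_rate_ge => // q q0; rewrite ler_pdivlMr ?ltr0n//.
have jit w : jordan mu [set x | itinerary T co q x = w].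
  rewrite (_ : [set x | _] = \big[setI/setT]_(i < q) [set x | co (iter i T x) = w i]).
    apply: big_ind; [exact: jordanT|exact: jordanI|] => i _.
    exact: (jordan_iter i imu (jco (w i))).
  apply/seteqP; split => x; rewrite in_big_setI /= => h.
    by move=> i; rewrite -h ffunE.
  by apply/ffunP => i; rewrite ffunE.
have q0' : 0 < q%:R :> R by rewrite ltr0n.
(* For fixed [q], dividing the counting inequality by [n] leaves an error [B / n] that vanishes as
   [n] grows, so that the words of length [q] have entropy at least [c * ln 2 * q] under [mu]. *)
pose B := q%:R * ln d - q%:R * (q%:R * ln #|A|%:R).
apply: (cluster_continuous_ge (Phi := fun nu => entropy nu (itinerary T co q)) mmu
    (u := fun n => c * ln 2 * q%:R + B * n%:R^-1)).
- apply: cvg_entropy_jordan => //; exact: measurable_itinerary.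
- rewrite -[X in _ --> X]addr0 -(mulr0 B); apply: cvgD; first exact: cvg_cst.
  apply: cvgM; first exact: cvg_cst.
  exact: cvg_invn.
- exists N.+1 => // n /= Nn; have [s [sep sd mpr _]] := mP n Nn.
  have n0 : (0 < n)%N by exact: leq_ltn_trans Nn.
  have n0' : 0 < n%:R :> R by rewrite ltr0n.
  have s0 : 0 < (size s)%:R :> R.
    by apply: lt_le_trans sd; rewrite mulr_gt0 ?powR_gt0.
  have [us _ _] := sep.
  have := separated_counting n0 q0 _ us (separated_itinerary coe sep) (mu := m n).
  rewrite -(ltr0n R) s0 => /(_ isT) key.
  have {key} : q%:R * ln (size s)%:R <=
    q%:R * (q%:R * ln (#|A|%:R)) + n%:R * entropy (m n) (itinerary T co q).
    apply: key => u; rewrite mpr; last exact: measurable_itinerary.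
    congr (_ * _); apply: eq_bigr => x _; apply: eq_bigr => j _.
    rewrite indicE (_ : (_ \in _) = (itinerary T co q (iter j T x) == u))//.
    by apply/idP/eqP => [/set_mem|] //; exact: mem_set.
  have : ln d + c * n%:R * ln 2 <= ln (size s)%:R.
    rewrite -ln_powR -lnM ?posrE ?powR_gt0// ler_ln ?posrE//.
    by rewrite mulr_gt0 ?powR_gt0.
  rewrite -(ler_pM2l q0') => h1 h2; have h := le_trans h1 h2.
  rewrite -(ler_pM2l n0') mulrDr [n%:R * (B / _)]mulrCA mulfV ?gt_eqF// mulr1.
  by move: h; rewrite /B; lra.
Qed.

End variational_principle.

(** * Supports and segments of measures *)

Section support.
Context {R : realType} {X : pointedMetricType R}.
Hypothesis cX : compact [set: X].
Implicit Types (mu nu : borelProb X) (A F : set X).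

Lemma msupportPn mu x : ~ msupport mu x <-> exists U, [/\ open U, U x & pr mu U = 0].
Proof.
split=> [h|[U [oU Ux U0]] Sx].
  apply: contrapT => nU; apply: h => U oU Ux; rewrite prE lte_fin lt_neqAle pr_ge0 andbT.
  by apply/eqP => U0; apply: nU; exists U.
by have := Sx U oU Ux; rewrite prE U0 lte_fin ltxx.
Qed.

Lemma msupport_closed mu : closed (msupport mu).
Proof.
rewrite -openC openE => x /= /msupportPn[U [oU Ux U0]].
apply: (@filterS _ _ _ U); last exact: open_nbhs_nbhs.
by move=> y Uy; apply/msupportPn; exists U.
Qed.

(** Each point of [F] has a null open neighbourhood, and compactness leaves finitely many. *)
Lemma msupport_null mu F : closed F -> (forall x, F x -> ~ msupport mu x) -> pr mu F = 0.
Proof.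
move=> cF FS.
have /choice[U UP] : forall x, exists U, F x -> [/\ open U, U x & pr mu U = 0].
  move=> x; have [Fx|nFx] := pselect (F x); last by exists setT.
  by have /msupportPn[U UP] := FS x Fx; exists U.
have : compact F by exact: (subclosed_compact cF cX).
rewrite compact_cover => /(_ X F U) [x /UP[]//|x Fx|D DF FD].
  by exists x => //; have [] := UP x Fx.
have DU x : x \in D -> open (U x) /\ pr mu (U x) = 0.
  by move=> /DF/set_mem/UP[].
apply/eqP; rewrite eq_le pr_ge0 andbT -(integ_indic mu (borel_closed cF)).
pose V x := if x \in D then U x else set0.
have mV x : measurable (V x : set (borel X)).
  by rewrite /V; case: ifPn => // xD; apply: borel_open; case: (DU x xD).
have -> : (0 : R) = \sum_(x <- D) integ mu (\1_(V x)).
  rewrite big_seq big1// => x xD; rewrite integ_indic// /V xD.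
  by case: (DU x xD).
rewrite -integ_sum; last by move=> x; exact: bm_indic.
apply: le_integ; [exact: bm_indic (borel_closed cF)|by apply: bm_sum => x; exact: bm_indic|].
move=> y; have [Fy|nFy] := pselect (F y); last first.
  by rewrite indicE memNset//=; apply: sumr_ge0 => x _; rewrite indicE ler0n.
have [x xD Uxy] := FD y Fy.
rewrite (big_rem x)//= !indicE mem_set//= mem_set; last by rewrite /V xD.
by rewrite lerDl sumr_ge0// => z _; rewrite indicE ler0n.
Qed.

Lemma msupport_neq0 mu : msupport mu !=set0.
Proof.
apply: contrapT => h; have := @msupport_null mu setT closedT.
rewrite pr_setT => /(_ _)/eqP; rewrite oner_eq0 => /(_ _)/wrap; case => // x _ Sx.
by apply: h; exists x.
Qed.

Lemma msupport_stable (T : X -> X) mu : continuous T -> invariant_measures T mu ->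
  T @` msupport mu `<=` msupport mu.
Proof.
move=> cT imu _ [x Sx <-] U oU UTx; rewrite -imu; last exact: borel_open.
by apply: Sx => //; apply: open_comp => // y _; exact: cT.
Qed.

Lemma convex_comb1 (t : {i01 R}) mu nu : t%:num = 1 -> convex_comb t mu nu = mu.
Proof.
move=> t1; apply: borelProb_eq => A mA; rewrite pr_convex_comb// t1.
by rewrite subrr mul0r addr0 mul1r.
Qed.

Lemma convex_comb0 (t : {i01 R}) mu nu : t%:num = 0 -> convex_comb t mu nu = nu.
Proof.
move=> t0; apply: borelProb_eq => A mA; rewrite pr_convex_comb// t0.
by rewrite subr0 mul0r add0r mul1r.
Qed.

Lemma msupport_convex_comb (t : {i01 R}) mu nu : 0 < t%:num -> t%:num < 1 ->
  msupport (convex_comb t mu nu) = msupport mu `|` msupport nu.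
Proof.
move=> t0 t1; have t1' : 0 < 1 - t%:num by rewrite subr_gt0.
apply/seteqP; split => x.
  move=> Sx; apply: contrapT => /not_orP[/msupportPn[U [oU Ux U0]] /msupportPn[V [oV Vx V0]]].
  have oUV := openI oU oV; have mUV := borel_open oUV.
  have := Sx _ oUV (conj Ux Vx); rewrite prE lte_fin pr_convex_comb//.
  have -> : pr mu (U `&` V) = 0.
    apply/eqP; rewrite eq_le pr_ge0 andbT.
    by have := le_pr mu mUV (borel_open oU) (@subIsetl _ U V); rewrite U0.
  have -> : pr nu (U `&` V) = 0.
    apply/eqP; rewrite eq_le pr_ge0 andbT.
    by have := le_pr nu mUV (borel_open oV) (@subIsetr _ U V); rewrite V0.
  by rewrite !mulr0 addr0 ltxx.
move=> Sx U oU Ux; have mU := borel_open oU; rewrite prE lte_fin pr_convex_comb//.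
case: Sx => /(_ U oU Ux); rewrite prE lte_fin => p0.
  by rewrite ltr_pwDl ?mulr_gt0// mulr_ge0 ?pr_ge0 ?ltW.
by rewrite ltr_wpDl ?mulr_gt0// mulr_ge0 ?pr_ge0 ?ltW.
Qed.

Lemma clamp_ge0 (t : R) : 0 <= Num.max 0 (Num.min 1 t).
Proof. by rewrite le_max lexx. Qed.

Lemma clamp_le1 (t : R) : Num.max 0 (Num.min 1 t) <= 1.
Proof. by rewrite ge_max ler01 ge_min lexx. Qed.

(** Lets the parameter be any real, so that segments are continuous images of a real interval and
    the intermediate value theorem applies to them. *)
Definition clamp (t : R) : {i01 R} := Itv01 (clamp_ge0 t) (clamp_le1 t).

Lemma clampE (t : R) : 0 <= t -> t <= 1 -> (clamp t)%:num = t.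
Proof. by move=> t0 t1; rewrite /= (min_idPr t1) (max_idPr t0). Qed.

Lemma continuous_convex_comb mu nu :
  continuous (fun t : R => convex_comb (clamp t) mu nu).
Proof.
move=> t; apply: borelProb_cvg => f cf.
have bf := bm_continuous cX cf.
rewrite integ_convex_comb//.
suff : (fun s : R => integ (convex_comb (clamp s) mu nu) f) @ t -->
    (clamp t)%:num * integ mu f + (1 - (clamp t)%:num) * integ nu f by [].
under eq_fun do rewrite (integ_convex_comb _ _ _ bf).
have cc : continuous (fun s : R => Num.max 0 (Num.min 1 s)).
  apply: cont_max; first exact: cont_cst.
  by apply: cont_min; [exact: cont_cst|move=> s; exact: cvg_id].
apply: cvgD; apply: cvgM; try exact: cvg_cst; first exact: cc.
by apply: cvgB; [exact: cvg_cst|exact: cc].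
Qed.

(** The parameter weighs the first endpoint: [mu] sits at 1 and [nu] at 0. *)
Definition segment mu nu : set (borelProb X) := [set convex_comb t mu nu | t in [set: {i01 R}]].

Lemma segmentE mu nu :
  segment mu nu = (fun t : R => convex_comb (clamp t) mu nu) @` `[0, 1]%classic.
Proof.
apply/seteqP; split => _ [t ht <-].
  exists t%:num; first by rewrite /= in_itv /=; apply/andP.
  by congr convex_comb; apply/val_inj/clampE.
by exists (clamp t).
Qed.

Lemma segment_compact mu nu : compact (segment mu nu).
Proof.
rewrite segmentE; apply: continuous_compact; last exact: segment_compact.
by apply: continuous_subspaceT; exact: continuous_convex_comb.
Qed.

Lemma segment_connected mu nu : connected (segment mu nu).
Proof.
rewrite segmentE; apply: connected_continuous_connected.
  by apply/connected_intervalP; exact: interval_is_interval.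
by apply: continuous_subspaceT; exact: continuous_convex_comb.
Qed.

Lemma segmentl mu nu : segment mu nu mu.
Proof. by exists (clamp 1) => //; apply: convex_comb1; rewrite clampE. Qed.

Lemma segmentr mu nu : segment mu nu nu.
Proof. by exists (clamp 0) => //; apply: convex_comb0; rewrite clampE. Qed.

Lemma segmentxx mu : segment mu mu = [set mu].
Proof.
apply/seteqP; split => [_ [t _ <-]|_ ->]; last exact: segmentl.
by apply: borelProb_eq => A mA; rewrite pr_convex_comb// -mulrDl addrC subrK mul1r.
Qed.

Lemma segmentP mu nu m : segment mu nu m ->
  [\/ m = mu, m = nu | exists2 t : {i01 R}, 0 < t%:num < 1 & m = convex_comb t mu nu].
Proof.
move=> [t _ <-]; have t0 : 0 <= t%:num by []. have t1 : t%:num <= 1 by [].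
move: t0 t1; rewrite le_eqVlt => /predU1P[t0 _|t0].
  by constructor 2; rewrite convex_comb0.
rewrite le_eqVlt => /predU1P[t1|t1]; first by constructor 1; rewrite convex_comb1.
by constructor 3; exists t => //; rewrite t0.
Qed.

Lemma msupport_segment mu nu m : segment mu nu m ->
  [\/ msupport m = msupport mu, msupport m = msupport nu |
      msupport m = msupport mu `|` msupport nu].
Proof.
case/segmentP => [->|->|[t /andP[t0 t1] ->]]; [constructor 1|constructor 2|constructor 3] => //.
exact: msupport_convex_comb.
Qed.

(** Coinciding vertices are allowed, so that single measures and segments are also hooks. *)
Definition hook p q r : set (borelProb X) := segment p q `|` segment q r.

Lemma hook_compact p q r : compact (hook p q r).
Proof. by apply: compactU; exact: segment_compact. Qed.

Lemma hook_connected p q r : connected (hook p q r).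
Proof.
apply: connectedU; [|exact: segment_connected|exact: segment_connected].
by exists q; split; [exact: segmentr|exact: segmentl].
Qed.

Lemma hook_invariant (T : X -> X) p q r : continuous T -> invariant_measures T p ->
  invariant_measures T q -> invariant_measures T r -> hook p q r `<=` invariant_measures T.
Proof.
by move=> cT ip iq ir _ [[t _ <-]|[t _ <-]]; exact: invariant_convex_comb.
Qed.

Lemma hook_convex_hull p q r :
  hook p q r `<=` convex_hull (fun i : 'I_3 => nth p [:: p; q; r] i).
Proof.
have H (w : nat -> R) m : (forall i, 0 <= w i) -> w 0%N + w 1%N + w 2%N = 1 ->
    (forall A, measurable (A : set (borel X)) ->
      pr m A = w 0%N * pr p A + w 1%N * pr q A + w 2%N * pr r A) ->
    convex_hull (fun i : 'I_3 => nth p [:: p; q; r] i) m.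
  move=> w0 w1 mE; exists (fun i : 'I_3 => w i); split => //.
    by rewrite !big_ord_recr big_ord0 /= add0r.
  move=> A mA; rewrite prE mE// !big_ord_recr big_ord0 /= add0e.
  by rewrite !EFinD !EFinM -!prE.
move=> _ [[t _ <-]|[t _ <-]].
- apply: (H (fun i => if i == 0%N then t%:num else if i == 1%N then 1 - t%:num else 0)).
  + by move=> [|[|i]] //=; rewrite subr_ge0.
  + by rewrite /= addr0 addrC subrK.
  + by move=> A mA; rewrite pr_convex_comb//= mul0r addr0.
- apply: (H (fun i => if i == 0%N then 0 else if i == 1%N then t%:num else 1 - t%:num)).
  + by move=> [|[|i]] //=; rewrite subr_ge0.
  + by rewrite /= add0r addrC subrK.
  + by move=> A mA; rewrite pr_convex_comb//= mul0r add0r.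
Qed.

End support.

(** * Recurrence of transitive points *)

Section recurrence.
Context {R : realType} {X : pointedMetricType R}.
Hypothesis cX : compact [set: X].
Variable T : X -> X.
Hypothesis cT : continuous T.
Implicit Types (mu nu : borelProb X) (C : set X) (x : X).

Lemma transitive_closed_stable C x : closed C -> T @` C `<=` C ->
  transitive_points T x -> C x -> C = setT.
Proof.
move=> cC TC tx Cx; apply/seteqP; split => // y _.
have : omega_limit T x y by rewrite tx.
move=> oy; apply: cC => V Vy.
apply: (oy C V _ Vy).
suff : \forall n \near \oo, C (orbit_seq T x n) by [].
by near=> n; exact: iter_stable.
Unshelve. all: end_near. Qed.

Lemma cluster_subseq (Y : topologicalType) (u : nat -> Y) (phi : nat -> nat) :
  (forall k, (k <= phi k)%N) -> cluster ((u \o phi) @ \oo) `<=` cluster (u @ \oo).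
Proof.
move=> phik y cy A B /= [N _ NA] By; apply: cy => //.
by exists N => // n /= Nn; apply: NA => /=; exact: leq_trans (phik n).
Qed.

Lemma krylov_bogoliubov C : closed C -> T @` C `<=` C -> C !=set0 ->
  exists2 mu, invariant_measures T mu & msupport mu `<=` C.
Proof.
move=> cC TC [x Cx].
have [|mu [_ mmu]] := borelProb_compact cX (F := empirical T x @ \oo).
  by apply: filterS filterT.
exists mu.
  apply: (@cluster_invariant R X cX T cT (empirical T x) (fun n => 2 * n.+1%:R^-1) mu mmu).
    suff : (2 * n.+1%:R^-1 : R) @[n --> \oo] --> (2 * 0 : R) by rewrite mulr0.
    by apply: cvgM; [exact: cvg_cst|exact: cvg_harmonic].
  move=> f M cf fM; near=> n.
  have cfT : continuous (f \o T).
    by move=> z; apply: (@continuous_comp _ _ _ T f); [exact: cT|exact: cf].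
  rewrite !integ_empirical; [|exact: bm_continuous|exact: bm_continuous].
  rewrite -mulrBr normrM gtr0_norm ?invr_gt0//.
  have -> : \sum_(j < n.+1) (f \o T) (iter j T x) = \sum_(0 <= j < n.+1) f (iter j.+1 T x).
    by rewrite big_mkord.
  rewrite -(big_mkord predT (fun j => f (iter j T x))) -sumrB telescope_sumr//.
  rewrite mulrCA mulrA mulrC ler_pM2r ?invr_gt0//.
  apply: le_trans (ler_normB _ _) _.
  by apply: (le_trans (lerD (fM _) (fM _))); lra.
apply: integ_cdist_support => //; rewrite -oppr_ge0.
have FF : Filter (nbhs mu) by exact: nbhs_filter.
apply: (cluster_continuous_ge (Phi := fun nu => - integ nu (cdist C)) mmu _ (cvg_cst 0)).
  by apply: cvgN; apply: continuous_integ; exact: continuous_cdist.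
near=> n; rewrite integ_empirical; last by apply: bm_continuous => //; exact: continuous_cdist.
rewrite big1 ?mulr0 ?oppr0// => j _.
by apply: cdist0; exact: iter_stable.
Unshelve. all: end_near. Qed.

(** The averages are taken over [n.+1] terms to match [empirical] at index [n]. *)
Lemma upper_density_gt0 (S : set nat) : (0 < upper_density S :> \bar R)%E ->
  exists2 d : R, 0 < d & forall N, exists n, (N <= n)%N /\
    d <= (\sum_(0 <= i < n.+1) \1_S i) / n.+1%:R.
Proof.
move=> S0.
have [d d0 dS] : exists2 d : R, 0 < d & (d%:E < upper_density S)%E.
  move: S0; case: (upper_density S) => [r| |//].
    by rewrite lte_fin => r0; exists (r / 2); rewrite ?lte_fin; lra.
  by exists 1; rewrite ?ltry.
exists d => // N; apply: contrapT => h; move: dS; rewrite ltNge => /negP; apply.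
apply: ge_ereal_inf.
exists (ereal_sup [set ((\sum_(0 <= i < n) \1_S i) / n%:R)%:E | n in [set n | (N < n)%N]]).
  by exists [set n | (N < n)%N] => //; exists N.+1.
apply: ge_ereal_sup => _ [[|n] /= Nn <-]; rewrite // lee_fin leNgt; apply/negP => /ltW dn.
by apply: h; exists n.
Qed.

(** If [x] were outside [C], returns of positive upper density to the ball of radius half of
    [cdist C x] would keep some averages of [g] along the orbit away from 0, and a limit measure
    would charge the complement of [C]. *)
Lemma QW_measure_center x C : closed C ->
  (forall mu, limit_measures T x mu -> msupport mu `<=` C) -> QW T x -> C x.
Proof.
move=> cC SC Qx; apply: contrapT => nCx.
have d0 := cdist_gt0 cC nCx; set e := cdist C x / 2.
have e0 : 0 < e by rewrite divr_gt0.
have [d dp dN] := upper_density_gt0 (Qx e e0).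
have /choice[phi phiP] := dN.
(* On the ball of radius [e] around [x] the distance to [C] exceeds [e], so [g] is at least [e / 2]
   there, while [g] vanishes near [C]. *)
pose g := cut (e / 2) (cdist C).
have cg : continuous g by apply: continuous_cut; exact: continuous_cdist.
have bg := bm_continuous cX cg.
have g0 y : 0 <= g y by rewrite /g /cut le_max lexx.
have [|mu [_ mmu]] := borelProb_compact cX (F := (empirical T x \o phi) @ \oo).
  by apply: filterS filterT.
have Mmu : limit_measures T x mu.
  by apply: (@cluster_subseq _ _ phi) mmu => k; case: (phiP k).
have Smu := SC mu Mmu.
have : e / 2 * d <= integ mu g.
  have FF : Filter (nbhs mu) by exact: nbhs_filter.
  apply: (cluster_continuous_ge (Phi := fun nu => integ nu g) mmu
    (@continuous_integ R X g cg mu) (cvg_cst (e / 2 * d))).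
  near=> k; have [_ dk] := phiP k.
  rewrite /= integ_empirical// mulrC -ler_pdivlMr ?divr_gt0//.
  apply: le_trans dk _; rewrite mulrC -mulrA ler_pM2l ?invr_gt0//.
  rewrite ler_pdivlMr ?divr_gt0// mulr_suml big_mkord; apply: ler_sum => i _.
  rewrite indicE; have [iS|iS] := pselect (return_times T x e i); last first.
    by rewrite memNset//= mul0r.
  rewrite mem_set//= mul1r; have [_ ] := iS; rewrite ball_mdist => xi.
  have := cdist_lipschitz C x (iter i T x); rewrite /g /cut /e in xi * => h.
  by rewrite le_max; apply/orP; right; rewrite /orbit_seq in xi; lra.
suff -> : integ mu g = 0.
  by rewrite leNgt mulr_gt0// divr_gt0.
apply/eqP; rewrite eq_le integ_ge0// andbT.
pose F := [set y | e / 2 <= cdist C y].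
have cF : closed F by apply: superlevel_closed; exact: continuous_cdist.
rewrite -(msupport_null cX (mu := mu) cF); last first.
  move=> y Fy /Smu Cy; move: Fy; rewrite /F/= (cdist0 Cy) leNgt.
  by rewrite divr_gt0.
rewrite -integ_indic; last exact: borel_closed.
apply: le_integ => //; first by apply: bm_indic; exact: borel_closed.
move=> y; rewrite indicE; have [Fy|Fy] := pselect (F y).
  rewrite mem_set//= /g /cut ge_max ler01/=.
  by have := cdist_le1 C y; rewrite lerBlDr; lra.
rewrite memNset//= /g /cut ge_max lexx/= subr_le0 ltW// ltNge; exact/negP.
Unshelve. all: end_near. Qed.

Lemma transitive_not_QW x C : transitive_points T x -> closed C -> T @` C `<=` C ->
  C <> setT -> (forall mu, limit_measures T x mu -> msupport mu `<=` C) -> ~ QW T x.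
Proof.
move=> tx cC TC CT SC /(QW_measure_center cC SC) Cx; apply: CT.
exact: transitive_closed_stable tx Cx.
Qed.

(** By invariance the expected number of visits to the ball [U] around [x] during [n] steps is
    [n * pr mu U], so some point [y] makes at least half as many. The orbit of [x] passes near [y]
    and repeats these visits, which gives a long interval rich in return times. *)
Lemma transitive_BR x mu : transitive_points T x -> invariant_measures T mu ->
  msupport mu = setT -> BR T x.
Proof.
move=> tx imu Smu e e0.
pose U := ball x e; have oU : open U by exact: open_mball.
have mU := borel_open oU.
have p0 : 0 < pr mu U.
  have : msupport mu x by rewrite Smu.
  move=> /(_ U oU); rewrite prE lte_fin; apply.
  by rewrite /U ball_mdist mdistxx.
apply: (@lt_le_trans _ _ (pr mu U / 2)%:E); first by rewrite lte_fin divr_gt0.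
apply: le_ereal_inf_tmp => _ [N _ <-].
pose n := N.+1; have n0 : 0 < n%:R :> R by rewrite ltr0n.
have mUi i : measurable (iter i T @^-1` U : set (borel X)).
  exact: borel_continuous (@continuous_iter R X T cT i) mU.
have [y yU] : exists y, n%:R * (pr mu U / 2) <= \sum_(0 <= i < n) \1_(iter i T @^-1` U) y.
  apply: contrapT => h.
  have : integ mu (fun y => \sum_(0 <= i < n) \1_(iter i T @^-1` U) y) <= n%:R * (pr mu U / 2).
    apply: integ_le_cst; first by apply: bm_sum => i; exact: bm_indic.
    by move=> y; rewrite leNgt; apply/negP => h'; apply: h; exists y; exact: ltW.
  rewrite integ_sum; last by move=> i; exact: bm_indic.
  under eq_bigr do rewrite integ_indic// (invariant_iter cT _ imu mU).
  rewrite big_const_nat subn0 iter_addr_0 -[_ *+ n]mulr_natl ler_pM2l//.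
  by rewrite leNgt; apply/negP; rewrite negbK; lra.
(* Visits to the open set [U] persist under small perturbations, and only finitely many of them are
   concerned. *)
pose W := [set z | forall i, (i < n)%N -> U (iter i T y) -> U (iter i T z)].
have nW : nbhs y W.
  have H k : nbhs y [set z | forall i, (i < k)%N -> U (iter i T y) -> U (iter i T z)].
    elim: k => [|k IH]; first by apply: filterS filterT.
    have nk : nbhs y [set z | U (iter k T y) -> U (iter k T z)].
      have [Uk|nUk] := pselect (U (iter k T y)); last by apply: filterS filterT => z _ /nUk.
      have : nbhs y (iter k T @^-1` U).
        by apply: (@continuous_iter R X T cT k y); exact: open_nbhs_nbhs.
      by apply: filterS => z Uz _.
    apply: filterS2 IH nk => z h1 h2 i; rewrite ltnS leq_eqVlt => /predU1P[->//|].
    exact: h1.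
  exact: H.
have : omega_limit T x y by rewrite tx.
(* The passage near [y] is taken at a positive time because return times start at 1. *)
move=> /(_ [set z | exists2 a, (0 < a)%N & z = orbit_seq T x a] W _ nW)[].
  suff : \forall a \near \oo, exists2 b, (0 < b)%N & orbit_seq T x a = orbit_seq T x b by [].
  by exists 1%N => // a /= a0; exists a.
move=> z [[a a0 ->] Wa].
apply: le_ereal_sup_tmp.
exists ((\sum_(a <= i < a + n) \1_(return_times T x e) i) / n%:R)%:E.
  by exists a => //; exists n => //=; rewrite /n.
rewrite lee_fin ler_pdivlMr// mulrC (le_trans yU)//.
have -> : \sum_(a <= i < a + n) \1_(return_times T x e) i =
    \sum_(0 <= i < n) \1_(return_times T x e) (i + a)%N :> R.
  by rewrite -{1}[a]add0n big_addn addKn.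
rewrite !big_mkord; apply: ler_sum => i _; rewrite !indicE.
have [Ui|Ui] := pselect ((iter i T @^-1` U) y); last by rewrite (memNset Ui) ler0n.
have Sia : return_times T x e (i + a)%N.
  split; first by rewrite addn_gt0 a0 orbT.
  by have := Wa i (ltn_ord i) Ui; rewrite /orbit_seq -iterD.
by rewrite (mem_set Sia) ler_nat; case: (_ \in _).
Qed.

End recurrence.

(** * Full entropy gaps *)

Section entropy_gaps.
Context {R : realType} {X : pointedMetricType R}.
Variables (T : X -> X) (alpha : borelProb X -> R).
Hypothesis cX : compact [set: X].
Hypothesis cT : continuous T.
Hypothesis tcsT : transitively_convex_saturated T.
Hypothesis edT : entropy_dense T.
Hypothesis calpha : {within invariant_measures T, continuous alpha}.
Hypothesis alphaA2 : condA2 T alpha.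
Hypothesis nueT : ~ uniquely_ergodic T.
Hypothesis fullT : exists mu, invariant_measures T mu /\ msupport mu = [set: X].
Implicit Types (mu nu p q r : borelProb X) (c : R).

Let inv := invariant_measures T.

(** Saturation for the hook reduced to one invariant measure. A transitive point is what shows that
    the union of the supports is not all of [X]. *)
Lemma exists_transitive : exists x, transitive_points T x.
Proof.
have [mu [imu _]] := fullT.
have [|||||[x [tx _]] _] := tcsT (K := hook mu mu mu).
- exact: hook_invariant.
- by exists mu; left; exact: segmentl.
- exact: hook_compact.
- exact: hook_connected.
- exists 3%N, (fun i : 'I_3 => nth mu [:: mu; mu; mu] i); split; last exact: hook_convex_hull.
  by case=> [[|[|[|]]]].
- by exists x.
Qed.

Lemma exists_distinct mu : inv mu -> exists2 nu, inv nu & nu <> mu.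
Proof.
move=> imu; apply: contrapT => h; apply: nueT; exists mu; apply/seteqP; split => [nu inu|_ ->//].
by apply: contrapT => nmu; apply: h; exists nu.
Qed.

Lemma separating_integ mu nu : nu <> mu ->
  exists2 f : X -> R, continuous f & integ nu f != integ mu f.
Proof.
move=> nmu; apply: contrapT => h; apply: nmu; apply: (borelProb_eq_integ cX) => f cf.
by apply/eqP; apply: contrapT => /negP e; apply: h; exists f.
Qed.

Lemma between (c : R) (h : \bar R) : (c%:E < h)%E -> exists2 d : R, c < d & (d%:E < h)%E.
Proof.
case: h => [h| |//].
  by rewrite lte_fin => ch; exists ((c + h) / 2); rewrite ?lte_fin; lra.
by exists (c + 1); rewrite ?ltry//; lra.
Qed.

(** Entropy density supplies [La] and the variational principle a measure on it. [La] is kept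
    because disjointness will be proved for these sets, through the invariant measures that they
    carry. *)
Lemma dense_measure mu (G : set (borelProb X)) c : 0 <= c -> inv mu -> nbhs mu G ->
  (c%:E < metric_entropy T mu)%E ->
  exists nu (La : set X), [/\ inv nu, msupport nu `<=` La, (c%:E < metric_entropy T nu)%E,
    closed La & T @` La `<=` La] /\
    forall m, inv m -> msupport m `<=` La -> G m.
Proof.
move=> c0 imu GG cmu.
have [La [cL TL LG cLa]] : exists La, [/\ closed La, T @` La `<=` La,
    forall nu, inv nu -> msupport nu `<=` La -> G nu & (c%:E < htop T La)%E].
  case E : (metric_entropy T mu) cmu => [h| |//] cmu.
    rewrite lte_fin in cmu; have hc : 0 < h - c by lra.
    have [La [cL TL LG]] := edT imu GG hc.
    rewrite E -EFinB (_ : h - (h - c) = c); last by ring.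
    by move=> cLa; exists La; split.
  (* Infinite entropy is excluded: entropy density would give a set of topological entropy above
     infinity. *)
  have [La [_ _ _]] := edT imu GG ltr01.
  by rewrite E /= ltNge leey.
have [d cd dLa] := between cLa.
have [nu [inu snu dnu]] := variational_principle cX cT cL TL (ltW (le_lt_trans c0 cd)) dLa.
exists nu, La; split; last exact: LG.
by split => //; apply: lt_le_trans dnu; rewrite lte_fin.
Qed.

Definition disjoint_supports mu nu := forall y, msupport mu y -> msupport nu y -> False.

(* Entropy density is applied to n convex combinations of two invariant measures, mostly
   weighted on one of large entropy, which a continuous function [f] separates.  The
   resulting closed invariant sets are pairwise disjoint: an invariant measure carried by
   the intersection of two of them would give two different integrals to [f]. *)
Lemma disjoint_measures n c : 0 <= c -> (c%:E < htop T setT)%E ->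
  exists m : nat -> borelProb X,
    (forall i, (i < n)%N -> inv (m i) /\ (c%:E < metric_entropy T (m i))%E) /\
    forall i j, (i < n)%N -> (j < n)%N -> i != j -> disjoint_supports (m i) (m j).
Proof.
move=> c0 cX'; have [d cd dX] := between cX'.
have d0 : 0 <= d by lra.
have [mu [imu _ dmu]] := variational_principle cX cT closedT (@subsetT _ _) d0 dX.
have [r cr rmu] : exists2 r, c < r & (r%:E < metric_entropy T mu)%E.
  by exists ((c + d) / 2); [lra|apply: lt_le_trans dmu; rewrite lte_fin; lra].
have [nu inu nmu] := exists_distinct imu.
have [f cf fmn] := separating_integ nmu.
have bf := bm_continuous cX cf.
case: n => [|n]; first by exists (fun=> mu).
have n0 : 0 < n.+1%:R :> R by rewrite ltr0n.
have r1 : 0 < r + 1 by lra.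
(* The entropy of [nu] is only known to exceed -1, so a weight [s] on [nu] leaves more than
   [r - s * (r + 1)], which is at least [c] for [s <= th]. *)
pose th := (r - c) / (r + 1).
have th0 : 0 < th by rewrite divr_gt0// subr_gt0.
have th1 : th <= 1 by rewrite ler_pdivrMr// mul1r; lra.
pose s i := th / n.+1%:R * i%:R.
have s0 i : 0 <= s i by rewrite mulr_ge0// divr_ge0 ?ltW.
have sth i : (i < n.+1)%N -> s i <= th.
  move=> ni; rewrite /s -mulrA -[leRHS]mulr1 ler_pM2l// mulrC ler_pdivrMr// mul1r ler_nat ltnW//.
pose mi i := convex_comb (clamp (s i)) nu mu.
have imi i : inv (mi i) by exact: invariant_convex_comb.
have hmi i : (i < n.+1)%N -> (c%:E < metric_entropy T (mi i))%E.
  move=> ni; have h1 : ((-1)%:E < metric_entropy T nu)%E.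
    by apply: lt_le_trans (metric_entropy_ge0 cT inu); rewrite lte_fin; lra.
  apply: le_lt_trans (metric_entropy_convex_comb cT (clamp (s i)) inu imu h1 rmu).
  rewrite clampE ?(le_trans (sth i ni))// lee_fin.
  have : s i * (r + 1) <= r - c.
    by have := sth i ni; rewrite /th ler_pdivlMr.
  lra.
(* The common difference of the integrals of [f] over the measures [mi i]; the neighbourhoods [G i],
   of radius half its absolute value, are disjoint. *)
pose eta := th / n.+1%:R * (integ nu f - integ mu f).
have eta0 : 0 < `|eta|.
  by rewrite normr_gt0 mulf_neq0 ?subr_eq0// gt_eqF// divr_gt0.
have fmi i : (i < n.+1)%N -> integ (mi i) f = integ mu f + eta * i%:R.
  move=> ni; rewrite integ_convex_comb// clampE ?(le_trans (sth i ni))//.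
  by rewrite /eta /s; ring.
pose G i := [set m | `|integ (mi i) f - integ m f| < `|eta| / 2].
have nG i : nbhs (mi i) (G i).
  have := @continuous_integ R X f cf (mi i) => /cvgrPdist_lt; apply.
  by rewrite divr_gt0.
have disj i j m : (i < n.+1)%N -> (j < n.+1)%N -> i != j -> G i m -> G j m -> False.
  move=> ni nj ij; rewrite /G /= !fmi// => h1 h2.
  have : `|eta * i%:R - eta * j%:R| < `|eta|.
    rewrite (_ : _ - _ = (integ mu f + eta * i%:R - integ m f) -
      (integ mu f + eta * j%:R - integ m f)); last by ring.
    by apply: le_lt_trans (ler_normB _ _) _; lra.
  rewrite -mulrBr normrM -[ltRHS]mulr1 ltr_pM2l//; apply/negP; rewrite -leNgt.
  move: ij; rewrite neq_ltn => /orP[lt_ij|lt_ij].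
    have : i%:R + 1 <= j%:R :> R by rewrite natr1 ler_nat.
    by rewrite ler_normr => h; apply/orP; right; lra.
  have : j%:R + 1 <= i%:R :> R by rewrite natr1 ler_nat.
  by rewrite ler_normr => h; apply/orP; left; lra.
have /choice[m mP] : forall i, exists nu, (i < n.+1)%N ->
    (inv nu /\ (c%:E < metric_entropy T nu)%E) /\ exists La : set X,
    [/\ closed La, T @` La `<=` La, msupport nu `<=` La &
      forall m, inv m -> msupport m `<=` La -> G i m].
  move=> i; have [ni|ni] := ltnP i n.+1; last by exists mu.
  have [nu' [La [[h1 h2 h3 h4 h5] h6]]] := dense_measure c0 (imi i) (nG i) (hmi i ni).
  by exists nu' => _; split => //; exists La; split.
exists m; split; first by move=> i ni; case: (mP i ni).
move=> i j ni nj ij y Si Sj.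
have [_ [A [cA TA SA GA]]] := mP i ni; have [_ [B [cB TB SB GB]]] := mP j nj.
have [||| nu' inu' snu'] := @krylov_bogoliubov R X cX T cT (A `&` B).
- exact: closedI.
- by move=> _ [z [Az Bz] <-]; split; [apply: TA; exists z|apply: TB; exists z].
- by exists y; split; [exact: SA|exact: SB].
apply: (disj i j nu' ni nj ij).
  by apply: GA => // z /snu'[].
by apply: GB => // z /snu'[].
Qed.

Lemma alpha_segment mu nu m : inv mu -> inv nu -> alpha mu = alpha nu ->
  segment mu nu m -> alpha m = alpha mu.
Proof.
move=> imu inu amn [t _ <-]; rewrite (alphaA2 imu inu amn t (clamp 1)).
by rewrite convex_comb1// clampE.
Qed.

(** Continuity of [alpha] is relative to the invariant measures; the segment stays among them, which
    removes the restriction after composition. *)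
Lemma continuous_alpha_convex_comb mu nu : inv mu -> inv nu ->
  continuous (fun t : R => alpha (convex_comb (clamp t) mu nu)).
Proof.
move=> imu inu t V nV.
have it s : inv (convex_comb (clamp s) mu nu) by exact: invariant_convex_comb.
have := calpha (x := convex_comb (clamp t) mu nu) nV.
rewrite /nbhs /= -(nbhs_subspace_in (it t)) => h.
have h2 : nbhs (t : R) (fun s : R => inv (convex_comb (clamp s) mu nu) ->
    V (alpha (convex_comb (clamp s) mu nu))).
  exact: (@continuous_convex_comb R X cX mu nu t _ h).
suff : nbhs (t : R) (fun s : R => V (alpha (convex_comb (clamp s) mu nu))) by [].
by apply: filterS h2 => s; apply.
Qed.

Lemma alpha_intermediate mu nu (a : R) : inv mu -> inv nu -> alpha mu <= a <= alpha nu ->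
  exists2 m, segment mu nu m & alpha m = a.
Proof.
move=> imu inu /andP[ma an].
pose g (t : R) := alpha (convex_comb (clamp t) mu nu).
have g0 : g 0 = alpha nu by rewrite /g convex_comb0// clampE.
have g1 : g 1 = alpha mu by rewrite /g convex_comb1// clampE.
have [||t _ gt] := @IVT R g 0 1 a ler01.
- by apply: continuous_subspaceT; exact: continuous_alpha_convex_comb.
- by rewrite g0 g1 ge_min ma orbT le_max an.
- by exists (convex_comb (clamp t) mu nu) => //; exists (clamp t).
Qed.

Lemma segment_entropy mu nu m c : inv mu -> inv nu ->
  (c%:E < metric_entropy T mu)%E -> (c%:E < metric_entropy T nu)%E ->
  segment mu nu m -> (c%:E < metric_entropy T m)%E.
Proof.
move=> imu inu cmu cnu [t _ <-].
have := metric_entropy_convex_comb cT t imu inu cmu cnu.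
by rewrite -mulrDl addrC subrK mul1r.
Qed.

Lemma segment_inv mu nu m : inv mu -> inv nu -> segment mu nu m -> inv m.
Proof. by move=> imu inu [t _ <-]; exact: invariant_convex_comb. Qed.

Lemma segment_support mu nu m : segment mu nu m -> msupport m `<=` msupport mu `|` msupport nu.
Proof. by case/msupport_segment => -> y; [left|right|]. Qed.

(* Sort five measures with disjoint supports by their value of [alpha]: the middle value is
   attained at the third one, and by continuity on the segments joining the second to the
   fourth and the first to the fifth. *)
Lemma level_triple c : 0 <= c -> (c%:E < htop T setT)%E -> exists a b d : borelProb X,
  [/\ inv a /\ (c%:E < metric_entropy T a)%E, inv b /\ (c%:E < metric_entropy T b)%E,
      inv d /\ (c%:E < metric_entropy T d)%E, alpha a = alpha b /\ alpha b = alpha d &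
      [/\ disjoint_supports a b, disjoint_supports a d & disjoint_supports b d]].
Proof.
move=> c0 cX'; have [m [mP mD]] := disjoint_measures 5 c0 cX'.
pose le i j := alpha (m i) <= alpha (m j).
pose l := sort le (iota 0 5).
have sl : size l = 5%N by rewrite size_sort.
have ul : uniq l by rewrite sort_uniq iota_uniq.
have ml i : i \in l -> (i < 5)%N by rewrite mem_sort mem_iota.
have srt : sorted le l by apply: sort_sorted => i j; exact: le_total.
clearbody l; case: l sl ul ml srt => [|i0 [|i1 [|i2 [|i3 [|i4 [|//]]]]]] // _ ul ml.
rewrite /sorted /= /le => /and5P[h01 h12 h23 h34 _].
have [m0 m1 m2 m3 m4] : [/\ (i0 < 5)%N, (i1 < 5)%N, (i2 < 5)%N, (i3 < 5)%N & (i4 < 5)%N].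
  by split; apply: ml; rewrite !inE eqxx ?orbT.
move: ul; rewrite /= !inE !negb_or => /and5P[/and4P[n01 n02 n03 n04]].
move=> /and3P[n12 n13 n14] /andP[n23 n24] n34 _.
have [v0 e0] := mP _ m0; have [v1 e1] := mP _ m1; have [v2 e2] := mP _ m2.
have [v3 e3] := mP _ m3; have [v4 e4] := mP _ m4.
have [b sb ab] : exists2 b, segment (m i1) (m i3) b & alpha b = alpha (m i2).
  by apply: alpha_intermediate => //; rewrite h12.
have [d sd ad] : exists2 d, segment (m i0) (m i4) d & alpha d = alpha (m i2).
  apply: alpha_intermediate => //.
  by rewrite (le_trans h01 h12) (le_trans h23 h34).
exists (m i2), b, d; split.
- by [].
- by split; [exact: segment_inv v1 v3 sb|exact: segment_entropy v1 v3 e1 e3 sb].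
- by split; [exact: segment_inv v0 v4 sd|exact: segment_entropy v0 v4 e0 e4 sd].
- by rewrite ab ad.
- split=> y.
  + move=> y2 /(segment_support sb)[]; first by apply: (mD i2 i1) => //; rewrite eq_sym.
    exact: (mD i2 i3).
  + move=> y2 /(segment_support sd)[]; first by apply: (mD i2 i0) => //; rewrite eq_sym.
    exact: (mD i2 i4).
  + move=> /(segment_support sb)[y1|y1] /(segment_support sd)[].
    * by apply: (mD i1 i0) y1 => //; rewrite eq_sym.
    * exact: (mD i1 i4) y1.
    * by apply: (mD i3 i0) y1 => //; rewrite eq_sym.
    * exact: (mD i3 i4) y1.
Qed.

(** Collects what the six gaps share: the entropy bound comes from concavity along the edges, the
    constancy of [alpha] from [A.2], and [C] keeps [x] out of [QW]. *)
Lemma hook_points p q r C c : inv p -> inv q -> inv r ->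
  (c%:E < metric_entropy T p)%E -> (c%:E < metric_entropy T q)%E ->
  (c%:E < metric_entropy T r)%E -> alpha p = alpha q -> alpha q = alpha r ->
  closed C -> T @` C `<=` C -> C <> setT ->
  msupport p `|` msupport q `|` msupport r `<=` C ->
  let G := transitive_points T `&` [set x | limit_measures T x = hook p q r] in
  (c%:E <= htop T G)%E /\
  forall x, G x -> [/\ (Ralpha T alpha `&` transitive_points T) x, BRs T x,
    limit_measures T x = hook p q r &
    measure_center T x = msupport p `|` msupport q `|` msupport r].
Proof.
move=> ip iq ir cp cq cr apq aqr cC TC CT SC G.
have Ksub m : hook p q r m -> msupport m `<=` msupport p `|` msupport q `|` msupport r.
  case=> /segment_support sm y /sm[]; [by left; left|by left; right|by left; right|by right].
split.
  have [|||||_ ->] := tcsT (K := hook p q r).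
  - exact: hook_invariant.
  - by exists p; left; exact: segmentl.
  - exact: hook_compact.
  - exact: hook_connected.
  - exists 3%N, (fun i : 'I_3 => nth p [:: p; q; r] i); split; last exact: hook_convex_hull.
    by case=> [[|[|[|]]]].
  apply: le_ereal_inf_tmp => _ [m Km <-]; apply: ltW.
  by case: Km; [exact: segment_entropy ip iq cp cq|exact: segment_entropy iq ir cq cr].
move=> x [tx Mx]; rewrite /= in Mx; split => //.
- split => //; rewrite /Ralpha /= Mx.
  rewrite (_ : [set (alpha mu)%:E | mu in hook p q r] = [set (alpha p)%:E]).
    by rewrite ereal_inf1 ereal_sup1.
  apply/seteqP; split => [_ [m Km <-] /=|_ ->].
    congr EFin; case: Km; first exact: alpha_segment.
    by rewrite apq; exact: alpha_segment.
  by exists p => //; left; exact: segmentl.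
- split; first by have [mu [imu smu]] := fullT; exact: transitive_BR imu smu.
  apply: (transitive_not_QW cX tx cC TC CT) => mu.
  by rewrite Mx => /Ksub h y /h; exact: SC.
- rewrite /measure_center Mx; apply/seteqP; split.
    have cS : closed (msupport p `|` msupport q `|` msupport r).
      by apply: closedU; [apply: closedU|]; exact: msupport_closed.
    rewrite [X in _ `<=` X]((closure_id _).1 cS).
    by apply: closure_subset => y [m Km my]; exact: Ksub Km y my.
  move=> y Sy; apply: subset_closure.
  case: Sy => [[py|qy]|ry]; [exists p|exists q|exists r] => //.
  + by left; exact: segmentl.
  + by left; exact: segmentr.
  + by right; exact: segmentr.
Qed.

Lemma htop_gap (Z Y : set X) : Z `<=` Y ->
  (forall c, 0 <= c -> (c%:E < htop T setT)%E ->
    exists2 G : set X, G `<=` Z & (c%:E <= htop T G)%E) ->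
  htop T Z = htop T Y.
Proof.
move=> ZY h; apply/eqP; rewrite eq_le htop_mono//= leNgt; apply/negP => lt_ZY.
have Z0 := htop_ge0 T Z.
case E : (htop T Z) lt_ZY Z0 => [z| |//] lt_ZY Z0; last by rewrite ltNge leey in lt_ZY.
have [c zc cY] := between lt_ZY.
have [||G GZ cG] := h c.
- by rewrite lee_fin in Z0; lra.
- by apply: lt_le_trans cY _; exact: htop_mono.
have := le_trans cG (htop_mono T GZ).
by rewrite E lee_fin leNgt zc.
Qed.

End entropy_gaps.

Section hook_vertices.
Context {R : realType} {X : pointedMetricType R}.
Implicit Types (p q r : borelProb X) (t : {i01 R}).

Lemma hook_first p q r : hook p q r p.
Proof. by left; exact: segmentl. Qed.

Lemma hook_second p q r : hook p q r q.
Proof. by left; exact: segmentr. Qed.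

Lemma hook_third p q r : hook p q r r.
Proof. by right; exact: segmentr. Qed.

Lemma hook_first_edge t p q r : hook p q r (convex_comb t p q).
Proof. by left; exists t. Qed.

Lemma hook_second_edge t p q r : hook p q r (convex_comb t q r).
Proof. by right; exists t. Qed.

(** Only the vertices and the interiors of the two edges have to be inspected, so a property of all
    the supports on a hook becomes a finite check. *)
Lemma hook_support p q r (Q : set X -> Prop) :
  Q (msupport p) -> Q (msupport q) -> Q (msupport r) ->
  Q (msupport p `|` msupport q) -> Q (msupport q `|` msupport r) ->
  forall m, hook p q r m -> Q (msupport m).
Proof. by move=> Qp Qq Qr Qpq Qqr m [] /msupport_segment[] ->. Qed.

Lemma segment_convex_comb s t p q : segment p q (convex_comb s (convex_comb t p q) q).
Proof.
have [s0 s1] : 0 <= s%:num :> R /\ s%:num <= 1 :> R by split.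
have [t0 t1] : 0 <= t%:num :> R /\ t%:num <= 1 :> R by split.
exists (clamp (s%:num * t%:num)) => //; apply: borelProb_eq => A mA.
rewrite !pr_convex_comb// clampE ?mulr_ge0// ?mulr_ile1//; ring.
Qed.

End hook_vertices.

(** * The six gaps *)

Section gap_cases.
Context {R : realType} {X : pointedMetricType R}.
Variables (T : X -> X) (alpha : borelProb X -> R).
Hypothesis cX : compact [set: X].
Hypothesis cT : continuous T.
Hypothesis tcsT : transitively_convex_saturated T.
Hypothesis edT : entropy_dense T.
Hypothesis calpha : {within invariant_measures T, continuous alpha}.
Hypothesis alphaA2 : condA2 T alpha.
Hypothesis nueT : ~ uniquely_ergodic T.
Hypothesis fullT : exists mu, invariant_measures T mu /\ msupport mu = [set: X].

Let Y := Ralpha T alpha `&` transitive_points T.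

(** Entropy, level and recurrence are settled here once; each gap then only has to name three points
    of the broken line and inspect supports. *)
Lemma gap_of_hook (Z : set X) :
  (forall a b d, disjoint_supports a b -> disjoint_supports a d -> disjoint_supports b d ->
    exists p q r, [/\ hook b a d p, hook b a d q, hook b a d r &
      forall x, BRs T x -> limit_measures T x = hook p q r ->
        measure_center T x = msupport p `|` msupport q `|` msupport r -> Z x]) ->
  htop T (Z `&` Y) = htop T Y.
Proof.
move=> hZ; apply: htop_gap; first exact: subIsetr.
move=> c c0 cX'.
have [a [b [d [[ia ca] [ib cb] [id cd] [aab abd] [dab dad dbd]]]]] :=
  level_triple cX cT edT calpha nueT c0 cX'.
have [p [q [r [hp hq hr hx]]]] := hZ a b d dab dad dbd.
pose C := msupport a `|` msupport b `|` msupport d.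
have good m : hook b a d m -> [/\ invariant_measures T m, (c%:E < metric_entropy T m)%E,
    alpha m = alpha a & msupport m `<=` C].
  case=> sm; split.
  - exact: segment_inv ib ia sm.
  - exact: segment_entropy ib ia cb ca sm.
  - by rewrite (alpha_segment alphaA2 ib ia (esym aab) sm).
  - by move=> y /(segment_support sm)[sy|sy]; [left; right|left; left].
  - exact: segment_inv ia id sm.
  - exact: segment_entropy ia id ca cd sm.
  - by rewrite (alpha_segment alphaA2 ia id (etrans aab abd) sm).
  - by move=> y /(segment_support sm)[sy|sy]; [left; left|right].
have [ip cp ap sp] := good p hp; have [iq cq aq sq] := good q hq; have [ir cr ar sr] := good r hr.
have TS m := @msupport_stable R X T m cT.
have [ya ay] := msupport_neq0 cX a; have [yb by_] := msupport_neq0 cX b.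
have cC : closed C by apply: closedU; [apply: closedU|]; exact: msupport_closed.
have TC : T @` C `<=` C.
  move=> _ [y [[Cy|Cy]|Cy] <-].
  - by left; left; apply: (TS a ia); exists y.
  - by left; right; apply: (TS b ib); exists y.
  - by right; apply: (TS d id); exists y.
(* A transitive point in [C] lies in one of the three supports, which is then all of [X] and leaves
   no room for the nonempty support of another. *)
have CT : C <> setT.
  have [x tx] := exists_transitive cX cT tcsT fullT.
  have whole m : invariant_measures T m -> msupport m x -> msupport m = setT.
    by move=> im mx; exact: (transitive_closed_stable (@msupport_closed _ _ _) (TS m im) tx mx).
  move=> CE; have : C x by rewrite CE.
  case=> [[/(whole a ia) E|/(whole b ib) E]|/(whole d id) E].
  - by apply: (dab yb) => //; rewrite E.
  - by apply: (dab ya) => //; rewrite E.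
  - by apply: (dad ya) => //; rewrite E.
have apq : alpha p = alpha q by rewrite ap aq.
have aqr : alpha q = alpha r by rewrite aq ar.
have SC : msupport p `|` msupport q `|` msupport r `<=` C by move=> y [[/sp|/sq]|/sr].
have [hG hGx] := hook_points cX cT tcsT alphaA2 fullT ip iq ir cp cq cr apq aqr cC TC CT SC.
exists (transitive_points T `&` [set x | limit_measures T x = hook p q r]) => //.
move=> x Gx; have [Yx Bx Mx Sx] := hGx x Gx.
by split => //; exact: hx.
Qed.

Variable half : {i01 R}.
Hypotheses (half_gt0 : 0 < half%:num :> R) (half_lt1 : half%:num < 1 :> R).

Let mid (mu nu : borelProb X) : msupport (convex_comb half mu nu) = msupport mu `|` msupport nu.
Proof. exact: msupport_convex_comb. Qed.

Lemma gap_QR : htop T (((QR T `&` BR1 T) `\` set0) `&` Y) = htop T Y.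
Proof.
apply: gap_of_hook => a b d _ _ _; exists a, a, a.
have ha := hook_second b a d; split=> [|||x Bx Mx Sx]; [exact: ha| exact: ha| exact: ha|].
rewrite /hook segmentxx setUid in Mx; split; last by [].
split; first by exists a.
by split; [exact: Bx|move=> m; rewrite Mx Sx !setUid => ->].
Qed.

(* The hook degenerates to a segment between two measures with the same support. *)
Lemma gap_BR1 : htop T ((BR1 T `\` (QR T `&` BR1 T)) `&` Y) = htop T Y.
Proof.
apply: gap_of_hook => a b d dab _ _.
pose p := convex_comb half b a; pose q := convex_comb half p a.
have Sp : msupport p = msupport b `|` msupport a by exact: mid.
have Sq : msupport q = msupport b `|` msupport a by rewrite mid Sp -setUA setUid.
have hp : hook b a d p by exact: hook_first_edge.
have hq : hook b a d q by left; exact: segment_convex_comb.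
exists p, q, q; split=> [|||x Bx Mx]; [exact: hp|exact: hq|exact: hq|].
rewrite Sp Sq !setUid => Sx; split.
  split; first exact: Bx.
  by rewrite Mx Sx; apply: (hook_support (Q := fun S => S = _)); rewrite ?Sp ?Sq ?setUid.
case=> -[m Mm] _.
have pm : p = m by have := hook_first p q q; rewrite -Mx Mm.
have qm : q = m by have := hook_second p q q; rewrite -Mx Mm.
(* As [q] is a proper average of [p] and [a], the equality of [p] and [q] forces [p = a]; but the
   support of [p] contains that of [b], which is disjoint from that of [a]. *)
have pa : p = a.
  apply: borelProb_eq => A mA.
  have : pr p A = half%:num * pr p A + (1 - half%:num) * pr a A.
    by rewrite -(pr_convex_comb half p a mA) -/q qm pm.
  move: (pr p A) (pr a A) (half%:num) half_lt1 => u v h h1 e.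
  have : (1 - h) * (u - v) = 0.
    have -> : (1 - h) * (u - v) = u - (h * u + (1 - h) * v) by ring.
    by rewrite -e subrr.
  by move/eqP; rewrite mulf_eq0 !subr_eq0 (gt_eqF h1)/= => /eqP.
have [y yb] := msupport_neq0 cX b.
by apply: (dab y _ yb); rewrite -pa Sp; left.
Qed.

(** Every support along the segment contains that of [a], and [p] sees all of C_x, but the endpoint
    [a] misses the support of [b]. *)
Lemma gap_BR2 : htop T ((BR2 T `\` BR1 T) `&` Y) = htop T Y.
Proof.
apply: gap_of_hook => a b d dab _ _; pose p := convex_comb half b a.
have hp : hook b a d p by exact: hook_first_edge.
exists a, p, p; split=> [|||x Bx Mx]; [exact: hook_second|exact: hp|exact: hp|].
have Sp : msupport p = msupport b `|` msupport a by exact: mid.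
have [ya ay] := msupport_neq0 cX a; have [yb bb] := msupport_neq0 cX b.
have -> : msupport a `|` msupport p `|` msupport p = msupport p.
  by rewrite Sp -setUA setUid setUC -setUA setUid.
move=> Sx; split.
  split.
    split; first exact: Bx.
    exists p; rewrite Mx Sx; split; last by [].
    exact: hook_second.
  exists ya => /=; rewrite /= Mx.
  by apply: (hook_support (Q := fun S => S ya)); rewrite ?Sp //; [right|right|right; right|left; right].
move=> [_ W]; have /W : limit_measures T x a by rewrite Mx; exact: hook_first.
by rewrite Sx Sp => E; apply: (dab yb _ bb); rewrite E; left.
Qed.

(** Interior measures of the segment see both supports, while its endpoints have disjoint ones. *)
Lemma gap_BR3 : htop T ((BR3 T `\` BR2 T) `&` Y) = htop T Y.
Proof.
apply: gap_of_hook => a b d dab _ _.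
exists a, b, b; split=> [|||x Bx Mx Sx];
  [exact: hook_second|exact: hook_first|exact: hook_first|split].
  split; first exact: Bx.
  exists (convex_comb half a b); rewrite Mx Sx mid -setUA setUid; split; last by [].
  exact: hook_first_edge.
move=> [_ [y Sy]]; apply: (dab y); apply: Sy; rewrite /= Mx; first exact: hook_first.
exact: hook_second.
Qed.

(** All the supports contain that of [a], but no measure of the hook sees both [b] and [d], since
    [a] sits between them. *)
Lemma gap_BR4 : htop T ((BR4 T `\` BR3 T) `&` Y) = htop T Y.
Proof.
apply: gap_of_hook => a b d dab dad dbd.
exists (convex_comb half b a), a, (convex_comb half a d).
split=> [|||x Bx Mx];
  [exact: hook_first_edge|exact: hook_second|exact: hook_second_edge|].
have [ya ay] := msupport_neq0 cX a.
have [yb bb] := msupport_neq0 cX b; have [yd dd] := msupport_neq0 cX d.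
rewrite !mid => Sx; split.
  right; split; first exact: Bx.
  exists ya => /=; rewrite Mx.
  apply: (hook_support (Q := fun S => S ya)); rewrite ?mid.
  - by right.
  - by [].
  - by left.
  - by right.
  - by left.
move=> [_ [m []]]; rewrite Mx Sx => hm E.
have [] : msupport m yb /\ msupport m yd by rewrite E; split; [left; left; left|right; right].
move: m hm {E}; apply: (hook_support (Q := fun S => S yb -> S yd -> False)); rewrite ?mid.
- by move=> _ [/dbd|/dad]; apply.
- by move=> _ /dad; apply.
- by move=> [/dab|/(dbd _ bb)//]; case.
- by move=> _ [[/dbd|/dad]|/dad]; apply.
- by move=> [/dab|[/dab|/(dbd _ bb)//]]; case.
Qed.

(** The hook runs from [a] through [b] to [d]: its second edge is not part of the broken line, but
    [alpha] agrees at the vertices and so is constant there as well. No measure sees both [a] and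
    [d], and the supports of [a] and [b] have no common point. *)
Lemma gap_BR5 : htop T ((BR5 T `\` BR4 T) `&` Y) = htop T Y.
Proof.
apply: gap_of_hook => a b d dab dad dbd.
exists a, b, d; split=> [|||x Bx Mx Sx];
  [exact: hook_second|exact: hook_first|exact: hook_third|].
have [ya ay] := msupport_neq0 cX a.
have [yb bb] := msupport_neq0 cX b; have [yd dd] := msupport_neq0 cX d.
split; first exact: Bx.
move=> -[[_ [m []]]|[_ [y Sy]]]; last first.
  apply: (dab y); apply: Sy; rewrite /= Mx; first exact: hook_first.
  exact: hook_second.
rewrite Mx Sx => hm E.
have [] : msupport m ya /\ msupport m yd by rewrite E; split; [left; left|right].
move: m hm {E}; apply: (hook_support (Q := fun S => S ya -> S yd -> False)).
- by move=> _ /dad; apply.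
- by move=> _ /dbd; apply.
- by move=> /(dad _ ay).
- by move=> _ [/dad|/dbd]; apply.
- by move=> [/(dab _ ay)|/(dad _ ay)].
Qed.

End gap_cases.

Unset Implicit Arguments.

Theorem theorem5 (R : realType) (X : pointedMetricType R) (T : X -> X)
  (alpha : borelProb X -> R) :
  compact [set: X] ->
  continuous T ->
  transitively_convex_saturated T ->
  entropy_dense T ->
  {within invariant_measures T, continuous alpha} ->
  condA1 T alpha ->
  condA2 T alpha ->
  ~ uniquely_ergodic T ->
  (exists mu, invariant_measures T mu /\ msupport mu = [set: X]) ->
  full_entropy_gaps T
    [:: set0; QR T `&` BR1 T; BR1 T; BR2 T; BR3 T; BR4 T; BR5 T]
    (Ralpha T alpha `&` transitive_points T).
Proof.
move=> cX cT tcsT edT calpha _ alphaA2 nueT fullT; split; first by [].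
have [h h0 h1] : exists2 h : {i01 R}, 0 < h%:num :> R & h%:num < 1 :> R.
  by exists (clamp 2^-1); rewrite clampE; lra.
case=> [|[|[|[|[|[|i]]]]]] lti.
- exact: gap_QR.
- exact: gap_BR1 h0 h1.
- exact: gap_BR2 h0 h1.
- exact: gap_BR3 h0 h1.
- exact: gap_BR4 h0 h1.
- exact: gap_BR5.
- case: (notF lti).
Qed.
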